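(* For $t\in\mathbb R\setminus\{0,-1\}$ let $V_t\subset T_{\mathbb C}\mathrm{SL}_2(\mathbb R)$ be the left-invariant CR structure spanned at the identity by $$L_t=\begin{pmatrix} i\frac{1+t}{2} & t\\ 1 & -i\frac{1+t}{2}\end{pmatrix}\in\mathfrak{sl}_2(\mathbb C).$$ (a) The elliptic left-invariant spherical CR structure $V_1$ on $\mathrm{SL}_2(\mathbb R)$ is realizable as any of the generic (3-dimensional) $\mathrm{SL}_2(\mathbb R)$-orbits in $\mathbb C^2$ (for the complexification of the standard linear action on $\mathbb R^2$). It is also CR equivalent to the complement of a chain in $S^3\subset\mathbb C^2$ (a curve in $S^3$ given by the intersection of a complex affine line in $\mathbb C^2$ with $S^3$; e.g. $z_1=0$). (b) The rest of the left-invariant CR structures $V_t$ on $\mathrm{SL}_2(\mathbb R)$, with $0<|t|<1$, are either $4:1$ covers, in the aspherical elliptic case $0<t<1$, or $2:1$ covers, in the hyperbolic case $-1<t<0$, of the $\mathrm{SL}_2(\mathbb R)$-orbits (of $[L_t]$, under the adjoint action) in $\mathrm P(\mathfrak{sl}_2(\mathbb C))\simeq\mathbb{CP}^2$. (c) The spherical hyperbolic orbit (the orbit in (b) with $t=-3+2\sqrt2$) is also CR equivalent to the complement of $S^3\cap\mathbb R^2$ in $S^3\subset\mathbb C^2$.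
   Context: A CR structure on a 3-manifold $M$ is a complex line subbundle $V\subset T_{\mathbb C}M:=TM\otimes\mathbb C$ with $V\cap\overline V=\{0\}$ and such that the sections of $V\oplus\overline V$ bracket-generate $T_{\mathbb C}M$; its contact plane field $D$ is the real part of $V\oplus\overline V$. A real hypersurface $M$ in a complex 2-manifold $N$ carries the induced structure $V=T_{\mathbb C}M\cap T^{(0,1)}N$; the unit sphere $S^3=\{|z_1|^2+|z_2|^2=1\}\subset\mathbb C^2$, its open subsets, and the 3-dimensional orbits in $\mathbb C^2$ and $\mathrm P(\mathfrak{sl}_2(\mathbb C))$ carry these induced structures. A CR equivalence is a diffeomorphism $f$ with $(\mathrm df)_{\mathbb C}V_1=V_2$. ''Realizable as'' a hypersurface means CR equivalent to it. ''An $n:1$ cover'' means an $n$-sheeted covering map which is locally a CR equivalence. A CR structure is spherical if locally CR equivalent to $S^3$ near every point, and a left-invariant one is aspherical if not spherical. With $\langle X,Y\rangle=\frac12\mathrm{tr}(XY)$ on $\mathfrak{sl}_2(\mathbb R)$, a left-invariant CR structure on $\mathrm{SL}_2(\mathbb R)$ is elliptic (resp. hyperbolic) if $\langle\cdot,\cdot\rangle$ restricted to $D_e$ is definite (resp. indefinite non-degenerate); $V_t$ is elliptic for $t>0$ and hyperbolic for $t<0$, $t\ne-1$, and the only spherical $V_t$ with $t\in(-1,0)\cup(0,1]$ are $t=1$ and $t=-3+2\sqrt2$. $\mathrm{SL}_2(\mathbb R)$ acts on $\mathrm P(\mathfrak{sl}_2(\mathbb C))$ by $g\cdot[L]=[gLg^{-1}]$.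 *)

(* Defs.v *)
From mathcomp Require Import all_boot all_order all_algebra complex.
From mathcomp Require Import all_classical all_reals all_analysis.

Set Implicit Arguments.
Unset Strict Implicit.
Unset Printing Implicit Defensive.

Import Order.TTheory GRing.Theory Num.Theory.
Import numFieldNormedType.Exports.

Local Open Scope classical_set_scope.
Local Open Scope ring_scope.
Local Open Scope complex_scope.

(** * Smooth maps between open subsets of normed spaces *)

(* [Ck k U f]: [f] is of class C^k on the open set [U]; the spaces used below
   are finite dimensional, so it suffices to iterate directional derivatives. *)
Fixpoint Ck (R : realType) (E F : normedModType R) (k : nat) (U : set E)
    (f : E -> F) : Prop :=
  match k with
  | 0 => forall x, U x -> {for x, continuous f}
  | k'.+1 => (forall x, U x -> differentiable f x) /\
             (forall v, Ck k' U (fun x => 'd f x v))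
  end.

Definition smooth (R : realType) (E F : normedModType R) (U : set E)
    (f : E -> F) : Prop :=
  open U /\ forall k, Ck k U f.

(** * Ambient manifolds and their submanifolds *)

(* An n-manifold whose topology and smooth structure are given by the maps
   [par i : R^n -> N], the inverses of the charts of an atlas.  All ambient
   manifolds needed here have an atlas of charts that are onto R^n. *)
Record ambient (R : realType) (n : nat) := Ambient {
  carrier :> Type;
  chart : Type;
  par : chart -> 'rV[R]_n -> carrier }.

Arguments par {R n} _ _ _.

Definition euclid (R : realType) (n : nat) : ambient R n :=
  @Ambient R n 'rV[R]_n unit (fun _ p => p).

Definition aopen (R : realType) n (N : ambient R n) (W : set N) : Prop :=
  forall i, open (par N i @^-1` W).

Section Maps.
Context (R : realType) (n1 n2 : nat) (N1 : ambient R n1) (N2 : ambient R n2).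

(* [F] is a smooth local extension, in the charts [i] and [j], of the
   restriction of [f] to the subset [M1], around the point of coordinates [p]. *)
Definition local_ext (M1 : set N1) (f : N1 -> N2) (i : chart N1) (j : chart N2) (p : 'rV[R]_n1)
    (F : 'rV[R]_n1 -> 'rV[R]_n2) : Prop :=
  exists O : set 'rV[R]_n1, [/\ O p, smooth O F &
    forall q, O q -> M1 (par N1 i q) -> f (par N1 i q) = par N2 j (F q)].

Definition smooth_map (M1 : set N1) (M2 : set N2) (f : N1 -> N2) : Prop :=
  set_fun M1 M2 f /\
  forall x, M1 x -> exists i j p F, par N1 i p = x /\ local_ext M1 f i j p F.

Definition continuous_map (M1 : set N1) (M2 : set N2) (f : N1 -> N2) : Prop :=
  set_fun M1 M2 f /\
  forall W : set N2, aopen W ->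
    exists2 U : set N1, aopen U & forall x, M1 x -> (U x <-> W (f x)).

Definition inverses (M1 : set N1) (M2 : set N2) (f : N1 -> N2)
    (g : N2 -> N1) : Prop :=
  (forall x, M1 x -> g (f x) = x) /\ (forall y, M2 y -> f (g y) = y).

End Maps.

Definition diffeo (R : realType) n1 n2 (N1 : ambient R n1) (N2 : ambient R n2)
    (M1 : set N1) (M2 : set N2) (f : N1 -> N2) : Prop :=
  exists g : N2 -> N1,
    [/\ smooth_map M1 M2 f, smooth_map M2 M1 g & inverses M1 M2 f g].

Definition homeo (R : realType) n1 n2 (N1 : ambient R n1) (N2 : ambient R n2)
    (M1 : set N1) (M2 : set N2) (f : N1 -> N2) : Prop :=
  exists g : N2 -> N1,
    [/\ continuous_map M1 M2 f, continuous_map M2 M1 g & inverses M1 M2 f g].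

Definition submanifold (R : realType) n (N : ambient R n) (k : nat)
    (M : set N) : Prop :=
  forall x, M x ->
    exists (W : set N) (O : set (euclid R k)) (g : euclid R k -> N),
      [/\ aopen W, W x, aopen O & diffeo O (M `&` W) g].

(** * Complexified tangent vectors *)

(* Elements of C^n = R^n (x) C, as u + i v with u, v in R^n *)
Definition cvec (R : realType) n (u v : 'rV[R]_n) : 'rV[R[i]]_n :=
  \row_j (u 0 j +i* v 0 j).
Definition Re_vec (R : realType) n (w : 'rV[R[i]]_n) : 'rV[R]_n :=
  map_mx (@complex.Re R) w.
Definition Im_vec (R : realType) n (w : 'rV[R[i]]_n) : 'rV[R]_n :=
  map_mx (@complex.Im R) w.
Definition conj_vec (R : realType) n (w : 'rV[R[i]]_n) : 'rV[R[i]]_n :=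
  map_mx (@conjc R) w.
Definition cline (R : realType) n (w : 'rV[R[i]]_n) : set 'rV[R[i]]_n :=
  [set c *: w | c in [set: R[i]]].

Definition diffC (R : realType) n1 n2 (F : 'rV[R]_n1 -> 'rV[R]_n2)
    (p : 'rV[R]_n1) (w : 'rV[R[i]]_n1) : 'rV[R[i]]_n2 :=
  cvec ('d F p (Re_vec w)) ('d F p (Im_vec w)).

Definition lie_bracket (R : realType) n (A B : 'rV[R]_n -> 'rV[R]_n)
    (p : 'rV[R]_n) : 'rV[R]_n :=
  'd B p (A p) - 'd A p (B p).

(* The tangent space of [M] at [par i p], read in the chart [i]: velocities of
   smooth curves in [M]. *)
Definition tangent (R : realType) n (N : ambient R n) (M : set N)
    (i : chart N) (p : 'rV[R]_n) : set 'rV[R]_n :=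
  [set v | exists (O : set R) (c : R -> 'rV[R]_n),
     [/\ O 0, smooth O c, (forall s, O s -> M (par N i (c s))), c 0 = p &
         'd c 0 1 = v]].

Definition tangentC (R : realType) n (N : ambient R n) (M : set N)
    (i : chart N) (p : 'rV[R]_n) : set 'rV[R[i]]_n :=
  [set w | tangent M i p (Re_vec w) /\ tangent M i p (Im_vec w)].

(** * CR structures *)

(* A field of sets of complex tangent vectors: [V i p] is its value at
   [par i p], read in the chart [i].  The fields used below are compatible with
   changes of charts, so a condition may be checked in any one chart. *)
Definition cfield (R : realType) n (N : ambient R n) : Type :=
  chart N -> 'rV[R]_n -> set 'rV[R[i]]_n.

(* [V] is a CR structure on the 3-manifold [M].  Around every point, [V] has a
   smooth frame A + iB, with A, B real vector fields tangent to [M]; then A, B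
   is a frame of the plane field D, and the sections of V (+) conj V are the
   complex combinations of A and B.  D being a contact plane field,
   bracket-generation means that A, B and [A, B] span the tangent space. *)
Definition cr_structure (R : realType) n (N : ambient R n) (M : set N)
    (V : cfield N) : Prop :=
  submanifold 3 M /\
  forall x, M x -> exists (i : chart N) (p : 'rV[R]_n), par N i p = x /\
    exists (O : set 'rV[R]_n) (A B : 'rV[R]_n -> 'rV[R]_n),
    [/\ O p, smooth O A, smooth O B &
      forall q, O q -> M (par N i q) ->
      [/\ cvec (A q) (B q) != 0,
          V i q = cline (cvec (A q) (B q)),
          V i q `<=` tangentC M i q,
          (forall w, V i q w -> V i q (conj_vec w) -> w = 0) &
          forall u, tangent M i q u -> exists a b c : R,
            u = a *: A q + b *: B q + c *: lie_bracket A B q]].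

(* (df)_C V1 = V2 along M1 *)
Definition pushes_forward (R : realType) n1 n2 (N1 : ambient R n1)
    (N2 : ambient R n2) (M1 : set N1) (V1 : cfield N1) (V2 : cfield N2)
    (f : N1 -> N2) : Prop :=
  forall x, M1 x -> exists i j p F,
    [/\ par N1 i p = x, local_ext M1 f i j p F &
        V2 j (F p) = [set diffC F p w | w in V1 i p]].

Definition cr_equivalence (R : realType) n1 n2 (N1 : ambient R n1)
    (N2 : ambient R n2) (M1 : set N1) (V1 : cfield N1) (M2 : set N2)
    (V2 : cfield N2) (f : N1 -> N2) : Prop :=
  diffeo M1 M2 f /\ pushes_forward M1 V1 V2 f.

Definition cr_equivalent (R : realType) n1 n2 (N1 : ambient R n1)
    (N2 : ambient R n2) (M1 : set N1) (V1 : cfield N1) (M2 : set N2)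
    (V2 : cfield N2) : Prop :=
  [/\ cr_structure M1 V1, cr_structure M2 V2 &
      exists f : N1 -> N2, cr_equivalence M1 V1 M2 V2 f].

Definition covering_map (R : realType) n1 n2 (N1 : ambient R n1)
    (N2 : ambient R n2) (d : nat) (M1 : set N1) (M2 : set N2)
    (f : N1 -> N2) : Prop :=
  continuous_map M1 M2 f /\
  forall y, M2 y -> exists (W : set N2) (U : 'I_d -> set N1),
    [/\ aopen W /\ W y, (forall k, aopen (U k)),
        M1 `&` f @^-1` W = \bigcup_k (M1 `&` U k),
        trivIset [set: 'I_d] (fun k => M1 `&` U k) &
        forall k, homeo (M1 `&` U k) (M2 `&` W) f].

Definition local_cr_equivalence (R : realType) n1 n2 (N1 : ambient R n1)
    (N2 : ambient R n2) (M1 : set N1) (V1 : cfield N1) (M2 : set N2)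
    (V2 : cfield N2) (f : N1 -> N2) : Prop :=
  forall x, M1 x -> exists (U : set N1) (W : set N2),
    [/\ aopen U, aopen W, U x &
        cr_equivalence (M1 `&` U) V1 (M2 `&` W) V2 f].

(* (M1, V1) is a d:1 cover of (M2, V2) *)
Definition cr_cover (R : realType) n1 n2 (N1 : ambient R n1)
    (N2 : ambient R n2) (d : nat) (M1 : set N1) (V1 : cfield N1) (M2 : set N2)
    (V2 : cfield N2) : Prop :=
  [/\ cr_structure M1 V1, cr_structure M2 V2 &
      exists f : N1 -> N2,
        covering_map d M1 M2 f /\ local_cr_equivalence M1 V1 M2 V2 f].

(** * Real hypersurfaces in complex 2-manifolds *)

(* The real coordinates of C^2 are (x1, x2, y1, y2), with zj = xj + i yj. *)
Definition cplx (R : realType) (p : 'rV[R]_(2 + 2)) : 'rV[R[i]]_2 :=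
  cvec (lsubmx p) (rsubmx p).

(* The span of the vectors d/d(conj zj) = (d/dxj + i d/dyj)/2 *)
Definition T01 (R : realType) : set 'rV[R[i]]_(2 + 2) :=
  [set row_mx a ((0 +i* 1) *: a) | a in [set: 'rV[R[i]]_2]].
Arguments T01 : clear implicits.

(* The structure induced on [M] by the complex manifold [N], whose charts are
   read as complex charts through [cplx]. *)
Definition induced_cr (R : realType) (N : ambient R (2 + 2)) (M : set N) :
    cfield N :=
  fun i p => tangentC M i p `&` T01 R.

Definition C2 (R : realType) : ambient R (2 + 2) :=
  @Ambient R (2 + 2) 'cV[R[i]]_2 unit (fun _ p => (cplx p)^T).

Definition S3 (R : realType) : set (C2 R) :=
  [set z : 'cV[R[i]]_2 | `|z 0 0| ^+ 2 + `|z 1 0| ^+ 2 = 1].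
Arguments S3 : clear implicits.

(* R^2 in C^2 *)
Definition real_plane (R : realType) : set (C2 R) :=
  [set z : 'cV[R[i]]_2 | forall k, complex.Im (z k 0) = 0].
Arguments real_plane : clear implicits.

Definition complex_line (R : realType) (a b c : R[i]) : set (C2 R) :=
  [set z : 'cV[R[i]]_2 | a * z 0 0 + b * z 1 0 = c].

(* A complex line may miss S^3 or be tangent to it; nonemptiness is required
   since the empty set is a submanifold of every dimension. *)
Definition is_chain (R : realType) (K : set (C2 R)) : Prop :=
  [/\ exists a b c : R[i], (a, b) != (0, 0) /\ K = S3 R `&` complex_line a b c,
      K !=set0 & submanifold 1 K].

Definition mx22 (T : Type) (a b c d : T) : 'M[T]_2 :=
  \matrix_(i, j) if i == 0 then if j == 0 then a else b
                 else if j == 0 then c else d.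

(* P(sl_2(C)): the points are the lines <[L]>, L nonzero and traceless.  The
   k-th chart covers the lines whose k-th homogeneous coordinate is nonzero,
   for the coordinates (a, b, c) of the matrix with rows (a, b) and (c, - a). *)
Definition sl2_mx (R : realType) (Z : 'rV[R[i]]_3) : 'M[R[i]]_2 :=
  mx22 (Z 0 0) (Z 0 1) (Z 0 (inord 2)) (- Z 0 0).

Definition homog (R : realType) (k : 'I_3) (z : 'rV[R[i]]_2) : 'rV[R[i]]_3 :=
  \row_l (if unlift k l is Some m then z 0 m else 1).

Definition Psl2C (R : realType) : ambient R (2 + 2) :=
  @Ambient R (2 + 2) {vspace 'M[R[i]]_2} 'I_3
    (fun k p => <[sl2_mx (homog k (cplx p))]>%VS).

(** * SL_2(R), its left-invariant structures and its orbits *)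

Definition M2R (R : realType) : ambient R (2 * 2) :=
  @Ambient R (2 * 2) 'M[R]_2 unit (fun _ p => vec_mx p).

Definition SL2 (R : realType) : set (M2R R) := [set g : 'M[R]_2 | \det g = 1].
Arguments SL2 : clear implicits.

Definition toC (R : realType) (g : 'M[R]_2) : 'M[R[i]]_2 :=
  map_mx (real_complex R) g.

(* Its value at g is the line spanned by g L. *)
Definition left_invariant (R : realType) (L : 'M[R[i]]_2) : cfield (M2R R) :=
  fun _ p => cline (mxvec (toC (vec_mx p) *m L)).

Definition L_ (R : realType) (t : R) : 'M[R[i]]_2 :=
  mx22 (0 +i* ((1 + t) / 2)) t%:C 1 (- (0 +i* ((1 + t) / 2))).

Definition V_ (R : realType) (t : R) : cfield (M2R R) := left_invariant (L_ t).

Definition orbit_C2 (R : realType) (v : 'cV[R[i]]_2) : set (C2 R) :=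
  [set toC g *m v | g in SL2 R].

Definition orbit_P (R : realType) (L : 'M[R[i]]_2) : set (Psl2C R) :=
  [set <[toC g *m L *m invmx (toC g)]>%VS | g in SL2 R].

(* Main.v *)
(* For t = 1, L_1 kills (1, -i), hence the two coordinates of g (1, -i) are CR
   functions; they identify V_1 with a hermitian quadric, which is an orbit in
   C^2 after a real linear change of variables and S^3 minus a chain after a
   projective one.  If v is proportional to a real vector, its orbit lies in a
   real plane and is not a 3-dimensional submanifold.
   For the adjoint orbits put L = X + iY with X and Y real.  On a line of the
   orbit the invariants tr(L^2) and tr(L conj L) determine L up to sign, and g is
   recovered from eigenvectors of Y.  This gives smooth local sections of
   g -> [g L_t g^-1], whose fibres are the cosets of a group of order 4 for t > 0
   and of {1, -1} for t < 0, as well as the tangent spaces of the orbit.  For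
   t = -3 + 2 sqrt 2 one has tr(L conj L) = 0, and the orbit is an open part of a
   quadric projectively equivalent to S^3, missing its real points. *)
Require Import Defs.
From mathcomp Require Import all_boot all_order all_algebra complex.
From mathcomp Require Import all_classical all_reals all_analysis.
From mathcomp Require Import ring lra.
Import Order.TTheory GRing.Theory Num.Theory.
Import numFieldNormedType.Exports.
Local Open Scope classical_set_scope.
Local Open Scope ring_scope.

Set Implicit Arguments.
Unset Strict Implicit.
Unset Printing Implicit Defensive.

(** * Locality of differentials and of the classes C^k *)

Section Ck_calculus.
Context {R : realType}.

(** Every diffeomorphism built here has an explicit smooth inverse, in place of an inverse function
    theorem. The sets to be parametrised are level sets q = 1 of quadratic forms on R^4 (det or a
    hermitian form), charted by stereographic projection, or the image of SL_2(R) under the orbit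
    map, charted through local sections. A single chart of P(sl_2(C)) suffices because the lower
    left entry never vanishes on the orbit. A CR condition is checked on one vector: a differential
    that is injective on tangent vectors and sends the generator of V_t to a (0,1) vector maps the
    whole line onto the induced one. For the orbit map this is the identity [Im L, L] = i [Re L, L].
    Since det L_t = ((1 - t)/2)^2, the matrix L_1 is nilpotent and tr(L^2) then fixes no scale,
    hence 1 - t != 0. The value -3 + 2 sqrt 2 is the root in (-1, 0) of t + ((1 + t)/2)^2 = 0, that
    is of tr(L_t conj L_t) = 0. An element of SL_2(R) sending L_t to -L_t involves a real square
    root of t, hence 4 sheets for t > 0 and 2 for t < 0. *)

Lemma diff_near_eq {E F : normedModType R} (f g : E -> F) (x : E) :
  (\forall y \near x, f y = g y) -> differentiable f x ->
  differentiable g x /\ 'd g x = 'd f x :> (E -> F).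
Proof.
move=> fg fx; have fgx : f x = g x by exact: nbhs_singleton fg.
have cf := diff_continuous fx.
have o : g \o shift x = cst (g x) + 'd f x +o_ 0 id.
  apply/eqaddoP => e e0; have /eqaddoP/(_ e e0) := diff_locally fx.
  have fg0 : \forall y \near (0 : E), f (y + x) = g (y + x).
    have := near_shift 0 x (fun y => f y = g y).
    by rewrite subr0 /= => <-.
  apply: filterS2 fg0 => y /= fgy; rewrite !fctE /=.
  by rewrite fgy fgx.
have dg : 'd g x = 'd f x :> (E -> F) by apply: diff_unique.
by split=> //; apply/diff_locallyP; rewrite dg.
Qed.

Section Generic.
Context {E F : normedModType R}.
Implicit Types (U : set E) (f g : E -> F).

Lemma open_near (T : topologicalType) (U : set T) (P : T -> Prop) x :
  open U -> U x -> (forall y, U y -> P y) -> \forall y \near x, P y.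
Proof. by move=> oU Ux UP; apply: filterS UP _; apply: open_nbhs_nbhs. Qed.

Lemma Ck_eq k U f g : open U -> (forall x, U x -> f x = g x) ->
  Ck k U f -> Ck k U g.
Proof.
move=> oU; elim: k f g => [|k IH] f g fg /=.
  move=> cf x Ux; have := cf x Ux; rewrite /prop_for /continuous_at -fg //.
  by apply: cvg_trans; apply: near_eq_cvg; apply: open_near fg.
move=> [df Hf].
have H x : U x -> differentiable g x /\ 'd g x = 'd f x :> (E -> F).
  by move=> Ux; apply: diff_near_eq (df x Ux); apply: open_near fg.
split=> [x /H[]//|v]; apply: IH (Hf v) => x /H[_ ->] //.
Qed.

(** A formula for the differential valid on U is enough, since C^k on an open set does not see f
    elsewhere. Most closure rules below are this step followed by induction on k. *)
Lemma CkS_step k U f (df : E -> E -> F) : open U ->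
  (forall x, U x -> differentiable f x /\ 'd f x = df x :> (E -> F)) ->
  (forall v, Ck k U (df^~ v)) -> Ck k.+1 U f.
Proof.
move=> oU H Hdf; rewrite /=; split=> [x /H[]//|v].
by apply: Ck_eq (Hdf v) => // x /H[_ ->].
Qed.

Lemma CkW k U f : Ck k.+1 U f -> Ck k U f.
Proof.
elim: k f => [|k IH] f [df Hf]; first by move=> x /df; exact: differentiable_continuous.
by rewrite /=; split=> // v; apply: IH (Hf v).
Qed.

Lemma Ck_sub k U V f : V `<=` U -> Ck k U f -> Ck k V f.
Proof.
move=> VU; elim: k f => [|k IH] f; first by move=> cf x /VU /cf.
by move=> [df Hf]; rewrite /=; split=> [x /VU /df//|v]; apply: IH (Hf v).
Qed.

Lemma Ck_cst k U (a : F) : Ck k U (fun=> a).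
Proof.
elim: k a => [|k IH] a /=; first by move=> x _; exact: cst_continuous.
split=> [x _|v]; first exact: differentiable_cst.
under eq_fun do rewrite (diff_cst a); exact: IH.
Qed.

End Generic.

End Ck_calculus.

(** * Differentiation rules and stability of C^k under algebraic operations *)

Section Differentials.
Context {R : realType}.

(** The operator ['d] is total and carries no information where f is not differentiable, so a
    derivative is always recorded together with differentiability. *)
Definition isd {E F : normedModType R} (f : E -> F) (x : E) (df : E -> F) :=
  differentiable f x /\ 'd f x = df :> (E -> F).

Context {E F : normedModType R}.

Lemma isd_cst (a : F) (x : E) : isd (fun=> a) x (fun=> 0).
Proof. by split; [exact: differentiable_cst | exact: diff_cst]. Qed.

Lemma isdD (f g df dg : E -> F) x : isd f x df -> isd g x dg ->
  isd (fun y => f y + g y) x (fun v => df v + dg v).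
Proof.
move=> [f1 f2] [g1 g2]; split; first exact: differentiableD.
by rewrite -f2 -g2; exact: (diffD f1 g1).
Qed.

Lemma isdN (f df : E -> F) x : isd f x df ->
  isd (fun y => - f y) x (fun v => - df v).
Proof.
move=> [f1 f2]; split; first exact: differentiableN.
by rewrite -f2; exact: (diffN f1).
Qed.

Lemma isdM (f g df dg : E -> R) x : isd f x df -> isd g x dg ->
  isd (fun y => f y * g y) x (fun v => f x * dg v + g x * df v).
Proof.
move=> [f1 f2] [g1 g2]; split; first exact: differentiableM.
by rewrite -f2 -g2; exact: (diffM f1 g1).
Qed.

Lemma isdV (f df : E -> R) x : f x != 0 -> isd f x df ->
  isd (fun y => (f y)^-1) x (fun v => - ((f x)^-1 * (f x)^-1 * df v)).
Proof.
move=> fx [f1 f2]; split; first exact: differentiableV.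
rewrite diffV // f2; apply/funext => v /=.
by rewrite -[LHS]/(_ * _) expr2 invfM mulNr.
Qed.

Lemma isd_sqrt (f df : E -> R) x : 0 < f x -> isd f x df ->
  isd (fun y => Num.sqrt (f y)) x (fun v => (2 * Num.sqrt (f x))^-1 * df v).
Proof.
move=> fx [f1 f2]; have [d1 d2] := is_derive1_sqrt fx.
have s1 : differentiable (@Num.sqrt R) (f x) by apply/derivable1_diffP.
split; first exact: differentiable_comp.
have -> := diff_comp f1 s1; rewrite deriv1E // f2; apply/funext => v /=.
by rewrite derive1E d2 -[LHS]/(_ * _) mulrC.
Qed.

Lemma isd_lin (f : {linear E -> F}) x : continuous f -> isd f x f.
Proof. by move=> cf; split; [exact: linear_differentiable | exact: diff_lin]. Qed.

Lemma isd_eq (f g df dg : E -> F) x : isd f x df -> f =1 g -> df =1 dg -> isd g x dg.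
Proof. by move=> h /funext<- /funext<-. Qed.

End Differentials.

Section Smooth.
Context {R : realType} {E : normedModType R}.
Implicit Types (f g : E -> R) (U : set E).

Lemma Ck_diff (F : normedModType R) k U (f : E -> F) x :
  Ck k.+1 U f -> U x -> isd f x ('d f x).
Proof. by case=> h _ /h. Qed.

Lemma CkD (F : normedModType R) k U (f g : E -> F) : open U -> Ck k U f -> Ck k U g ->
  Ck k U (fun x => f x + g x).
Proof.
move=> oU; elim: k f g => [|k IH] f g cf cg.
  by move=> x Ux; apply: continuousD; [exact: (cf _ Ux) | exact: (cg _ Ux)].
apply: (CkS_step (df := fun x v => 'd f x v + 'd g x v)) => // [x Ux|v].
  by apply: isdD; [apply: Ck_diff cf _ | apply: Ck_diff cg _].
by case: cf cg => _ cf [_ cg]; exact: IH (cf v) (cg v).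
Qed.

Lemma CkN (F : normedModType R) k U (f : E -> F) : open U -> Ck k U f ->
  Ck k U (fun x => - f x).
Proof.
move=> oU; elim: k f => [|k IH] f cf.
  by move=> x Ux; apply: continuousN; exact: (cf _ Ux).
apply: (CkS_step (df := fun x v => - 'd f x v)) => // [x Ux|v].
  by apply: isdN; apply: Ck_diff cf _.
by case: cf => _ cf; exact: IH (cf v).
Qed.

Lemma CkM k U f g : open U -> Ck k U f -> Ck k U g ->
  Ck k U (fun x => f x * g x).
Proof.
move=> oU; elim: k f g => [|k IH] f g cf cg.
  by move=> x Ux; apply: continuousM; [exact: (cf _ Ux) | exact: (cg _ Ux)].
apply: (CkS_step (df := fun x v => f x * 'd g x v + g x * 'd f x v)) => // [x Ux|v].
  by apply: isdM; [apply: Ck_diff cf _ | apply: Ck_diff cg _].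
case: (cf) (cg) => _ /(_ v) cf' [_ /(_ v) cg'].
by apply: CkD => //; [apply: IH cg' | apply: IH cf']; exact: CkW.
Qed.

Lemma CkV k U f : open U -> (forall x, U x -> f x != 0) -> Ck k U f ->
  Ck k U (fun x => (f x)^-1).
Proof.
move=> oU f0; elim: k f f0 => [|k IH] f f0 cf.
  by move=> x Ux; apply: continuousV; [exact: f0 | exact: (cf _ Ux)].
apply: (CkS_step (df := fun x v => - ((f x)^-1 * (f x)^-1 * 'd f x v))) => // [x Ux|v].
  by apply: isdV; [exact: f0 | apply: Ck_diff cf _].
case: (cf) => _ /(_ v) cf'; apply: CkN => //; apply: CkM cf' => //.
by apply: CkM => //; apply: IH => //; exact: CkW.
Qed.

Lemma Ck_sqrt k U f : open U -> (forall x, U x -> 0 < f x) -> Ck k U f ->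
  Ck k U (fun x => Num.sqrt (f x)).
Proof.
move=> oU f0; elim: k f f0 => [|k IH] f f0 cf.
  move=> x Ux; apply: (@continuous_comp _ _ _ f (@Num.sqrt R)); first exact: (cf _ Ux).
  exact: sqrt_continuous.
apply: (CkS_step (df := fun x v => (2 * Num.sqrt (f x))^-1 * 'd f x v)) => // [x Ux|v].
  by apply: isd_sqrt; [exact: f0 | apply: Ck_diff cf _].
case: (cf) => _ /(_ v) cf'; apply: CkM cf' => //.
apply: CkV => // [x Ux|]; first by rewrite mulf_neq0 ?pnatr_eq0 // gt_eqF ?sqrtr_gt0 ?f0.
by apply: CkM => //; [exact: Ck_cst | apply: IH => //; exact: CkW].
Qed.

Lemma Ck_isd_lin (F : normedModType R) k U (f : E -> F) : open U ->
  (forall x, isd f x f) -> Ck k U f.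
Proof.
move=> oU lf; have cf : continuous f by move=> x; have [/differentiable_continuous] := lf x.
case: k => [|k]; first by move=> x _; exact: (cf x).
apply: (CkS_step (df := fun _ => f)) => [//|x _|v]; [exact: lf | exact: Ck_cst].
Qed.

Lemma Ck_sum k U I (r : seq I) (f : I -> E -> R) :
  open U -> (forall i, Ck k U (f i)) -> Ck k U (fun x => \sum_(i <- r) f i x).
Proof.
move=> oU H; elim: r => [|i r IH].
  by apply: Ck_eq (Ck_cst k U 0) => // x _; rewrite big_nil.
by apply: Ck_eq (CkD oU (H i) IH) => // x _; rewrite big_cons.
Qed.

End Smooth.

(** * Maps into R^m, coordinate by coordinate, and composition *)

Section Rows.
Context {R : realType} {E : normedModType R}.

Lemma isd_comp {F G : normedModType R} (f df : E -> F) (g dg : F -> G) x :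
  isd f x df -> isd g (f x) dg -> isd (fun y => g (f y)) x (fun v => dg (df v)).
Proof.
move=> [f1 f2] [g1 g2]; split; first exact: differentiable_comp.
by have -> := diff_comp f1 g1; rewrite f2 g2.
Qed.

Lemma isd_sum {F : normedModType R} (I : Type) (s : seq I) (f df : I -> E -> F) x :
  (forall i, isd (f i) x (df i)) ->
  isd (fun y => \sum_(i <- s) f i y) x (fun v => \sum_(i <- s) df i v).
Proof.
move=> H; elim: s => [|i s IH].
  by apply: isd_eq (isd_cst 0 x) _ _ => y; rewrite big_nil.
by apply: isd_eq (isdD (H i) IH) _ _ => y; rewrite big_cons.
Qed.

Lemma isd_coord n (p : 'rV[R]_n) j : isd (fun q : 'rV[R]_n => q 0 j) p (fun v => v 0 j).
Proof.
have @f : {linear 'rV[R]_n -> R}.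
  by exists (fun N : 'rV[R]_n => N 0 j); do 2![eexists]; do ?[constructor];
     rewrite ?mxE// => ? *; rewrite ?mxE//; move=> ?; rewrite !mxE.
have cf : continuous f by exact: coord_continuous.
by apply: isd_eq (isd_lin p cf) _ _.
Qed.

Lemma isd_rowP m (F dF : E -> 'rV[R]_m) x :
  isd F x dF <-> forall j, isd (fun y => F y 0 j) x (fun v => dF v 0 j).
Proof.
split=> [H j|H]; first exact: (isd_comp H (isd_coord _ j)).
have K j : isd (fun y => F y 0 j *: (delta_mx 0 j : 'rV[R]_m)) x
               (fun v => dF v 0 j *: (delta_mx 0 j : 'rV[R]_m)).
  have [h1 h2] := H j; split; first exact: differentiableZl.
  by rewrite diffZl // h2.
by apply: isd_eq (isd_sum _ K) _ _ => y; rewrite [RHS]row_sum_delta.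
Qed.

Lemma Ck_rowP m k U (F : E -> 'rV[R]_m) : open U ->
  Ck k U F <-> forall j, Ck k U (fun y => F y 0 j).
Proof.
move=> oU; elim: k F => [|k IH] F; split=> H.
- move=> j x Ux; apply: (@continuous_comp _ _ _ F (fun q : 'rV[R]_m => q 0 j)).
    exact: H.
  exact: coord_continuous.
- move=> x Ux; apply/cvg_ballP => e e0; near=> y.
  split=> // i j; rewrite (ord1 i); move: j; near: y; apply: filter_forall => j.
  by have /cvg_ballP/(_ e e0) := H j x Ux.
- move=> j; apply: (CkS_step (df := fun x v => 'd F x v 0 j)) => // [x Ux|v].
    by move: j; apply/isd_rowP; apply: Ck_diff H _.
  by move: j; apply/IH; case: H => _; exact.
- apply: (CkS_step (df := fun x v => \row_j 'd (fun y => F y 0 j) x v)) => // [x Ux|v].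
    apply/isd_rowP => j; apply: isd_eq (Ck_diff (H j) Ux) _ _ => // v.
    by rewrite mxE.
  apply/IH => j; apply: (@Ck_eq _ _ _ _ _ (fun x => 'd (fun y => F y 0 j) x v)) => //.
    by move=> x _; rewrite mxE.
  by case: (H j) => _; exact.
Unshelve. all: by end_near. Qed.

(** Expanding the chain rule along the basis vectors writes the derivative of the composite as a sum
    of products of real functions, whose second factors are again composites with a real-valued
    outer function, one order lower; this is what closes the induction. *)
Lemma Ck_comp m k (U : set E) (W : set 'rV[R]_m) (f : E -> 'rV[R]_m) (g : 'rV[R]_m -> R) :
  open U -> (forall x, U x -> W (f x)) -> Ck k U f -> Ck k W g ->
  Ck k U (fun x => g (f x)).
Proof.
move=> oU fUW; elim: k g => [|k IH] g cf cg.
  by move=> x Ux; apply: (@continuous_comp _ _ _ f g); [exact: cf | apply: cg; exact: fUW].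
apply: (CkS_step (df := fun x v => \sum_j 'd f x v 0 j * 'd g (f x) (delta_mx 0 j))) => //.
  move=> x Ux; apply: isd_eq (isd_comp (Ck_diff cf Ux) (Ck_diff cg (fUW x Ux))) _ _ => // v.
  rewrite {1}[X in 'd g (f x) X](row_sum_delta ('d f x v)) linear_sum.
  by apply: eq_bigr => j _; rewrite linearZ.
move=> v; apply: (Ck_sum _ oU) => j; apply: CkM => //.
  by case: (cf) => _ /(_ v) /(Ck_rowP _ _ oU) /(_ j).
by case: (cg) => _ /(_ (delta_mx 0 j)) cg'; apply: IH cg'; exact: CkW.
Qed.

End Rows.

Local Open Scope complex_scope.
Local Notation Re := complex.Re.
Local Notation Im := complex.Im.

(** * Complex-valued functions of real variables *)

Section ComplexValued.
Context {R : realType} {E : normedModType R}.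
Implicit Types (f g df dg : E -> R[i]) (U : set E).

(** The derivative is only real-linear: conjugation has to be allowed, because the frames and
    hermitian forms below involve it. *)
Definition isdC f (x : E) df :=
  isd (fun y => Re (f y)) x (fun v => Re (df v)) /\
  isd (fun y => Im (f y)) x (fun v => Im (df v)).

Definition smC U f :=
  forall k, Ck k U (fun y => Re (f y)) /\ Ck k U (fun y => Im (f y)).

Lemma ReM (a b : R[i]) : Re (a * b) =
  Re a * Re b - Im a * Im b.
Proof. by case: a b => [? ?] [? ?]. Qed.
Lemma ImM (a b : R[i]) : Im (a * b) =
  Re a * Im b + Im a * Re b.
Proof. by case: a b => [? ?] [? ?]. Qed.
Lemma ReD (a b : R[i]) : Re (a + b) = Re a + Re b.
Proof. by case: a b => [? ?] [? ?]. Qed.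
Lemma ImD (a b : R[i]) : Im (a + b) = Im a + Im b.
Proof. by case: a b => [? ?] [? ?]. Qed.
Lemma ReN (a : R[i]) : Re (- a) = - Re a.
Proof. by case: a => [? ?]. Qed.
Lemma ImN (a : R[i]) : Im (- a) = - Im a.
Proof. by case: a => [? ?]. Qed.
Lemma ReV (a : R[i]) : Re a^-1 =
  Re a * (Re a * Re a + Im a * Im a)^-1.
Proof. by case: a => [? ?]. Qed.
Lemma ImV (a : R[i]) : Im a^-1 =
  - (Im a * (Re a * Re a + Im a * Im a)^-1).
Proof. by case: a => [? ?] /=; rewrite -mulNr. Qed.
Lemma ReConj (a : R[i]) : Re (conjc a) = Re a.
Proof. by case: a => [? ?]. Qed.
Lemma ImConj (a : R[i]) : Im (conjc a) = - Im a.
Proof. by case: a => [? ?]. Qed.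
Lemma conjcD (a b : R[i]) : conjc (a + b) = conjc a + conjc b.
Proof. by rewrite rmorphD. Qed.
Lemma conjcN (a : R[i]) : conjc (- a) = - conjc a.
Proof. by rewrite rmorphN. Qed.
Lemma conjcM (a b : R[i]) : conjc (a * b) = conjc a * conjc b.
Proof. by rewrite rmorphM. Qed.
Definition ReImE := (ReM, ImM, ReD, ImD, ReN, ImN, ReV, ImV, ReConj, ImConj).

Lemma cplx_eq (a b : R[i]) : Re a = Re b ->
  Im a = Im b -> a = b.
Proof. by case: a b => [? ?] [? ?] /= -> ->. Qed.

Lemma sqnorm_neq0 (a : R[i]) : a != 0 ->
  Re a * Re a + Im a * Im a != 0.
Proof.
case: a => a b; rewrite eq_complex /= => /nandP h.
rewrite -!expr2 paddr_eq0 ?sqr_ge0 // !sqrf_eq0; apply/nandP; exact: h.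
Qed.

Lemma isdC_cst (a : R[i]) x : isdC (fun=> a) x (fun=> 0).
Proof. by split; exact: isd_cst. Qed.

Lemma isdC_D f g df dg x : isdC f x df -> isdC g x dg ->
  isdC (fun y => f y + g y) x (fun v => df v + dg v).
Proof.
move=> [f1 f2] [g1 g2]; split.
  by apply: isd_eq (isdD f1 g1) _ _ => ?; rewrite ?ReImE.
by apply: isd_eq (isdD f2 g2) _ _ => ?; rewrite ?ReImE.
Qed.

Lemma isdC_N f df x : isdC f x df -> isdC (fun y => - f y) x (fun v => - df v).
Proof.
move=> [f1 f2]; split.
  by apply: isd_eq (isdN f1) _ _ => ?; rewrite ?ReImE.
by apply: isd_eq (isdN f2) _ _ => ?; rewrite ?ReImE.
Qed.

Lemma isdC_conj f df x : isdC f x df -> isdC (fun y => conjc (f y)) x (fun v => conjc (df v)).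
Proof.
move=> [f1 f2]; split.
  by apply: isd_eq f1 _ _ => ?; rewrite ?ReImE.
by apply: isd_eq (isdN f2) _ _ => ?; rewrite ?ReImE.
Qed.

Lemma isdC_M f g df dg x : isdC f x df -> isdC g x dg ->
  isdC (fun y => f y * g y) x (fun v => f x * dg v + g x * df v).
Proof.
move=> [f1 f2] [g1 g2]; split.
  apply: isd_eq (isdD (isdM f1 g1) (isdN (isdM f2 g2))) _ _ => ?; rewrite ?ReImE //; ring.
by apply: isd_eq (isdD (isdM f1 g2) (isdM f2 g1)) _ _ => ?; rewrite ?ReImE //; ring.
Qed.

Lemma isdC_V f df x : f x != 0 -> isdC f x df ->
  isdC (fun y => (f y)^-1) x (fun v => - ((f x)^-1 * (f x)^-1 * df v)).
Proof.
move=> fx [f1 f2]; have n0 := sqnorm_neq0 fx.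
have dn := isdV (n0 : (fun y => _) x != 0) (isdD (isdM f1 f1) (isdM f2 f2)).
split.
  by apply: isd_eq (isdM f1 dn) _ _ => ?; rewrite ?ReImE //; field; rewrite -?expr2.
by apply: isd_eq (isdN (isdM f2 dn)) _ _ => ?; rewrite ?ReImE //; field; rewrite -?expr2.
Qed.

Lemma isdC_real (f df : E -> R) x : isd f x df ->
  isdC (fun y => (f y)%:C) x (fun v => (df v)%:C).
Proof. by move=> h; split=> //; exact: isd_cst. Qed.

Lemma isdC_eq f g df dg x : isdC f x df -> f =1 g -> df =1 dg -> isdC g x dg.
Proof. by move=> h /funext<- /funext<-. Qed.

Lemma smC_sub U W f : W `<=` U -> smC U f -> smC W f.
Proof. by move=> WU sf k; split; [apply: Ck_sub (sf k).1 | apply: Ck_sub (sf k).2]. Qed.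

Lemma smC_cst U (a : R[i]) : smC U (fun=> a).
Proof. by move=> k; split; exact: Ck_cst. Qed.

Lemma smC_D U f g : open U -> smC U f -> smC U g -> smC U (fun y => f y + g y).
Proof.
move=> oU hf hg k; have [f1 f2] := hf k; have [g1 g2] := hg k; split.
  by apply: Ck_eq (CkD oU f1 g1) => // ? _; rewrite ReImE.
by apply: Ck_eq (CkD oU f2 g2) => // ? _; rewrite ReImE.
Qed.

Lemma smC_N U f : open U -> smC U f -> smC U (fun y => - f y).
Proof.
move=> oU hf k; have [f1 f2] := hf k; split.
  by apply: Ck_eq (CkN oU f1) => // ? _; rewrite ReImE.
by apply: Ck_eq (CkN oU f2) => // ? _; rewrite ReImE.
Qed.

Lemma smC_conj U f : open U -> smC U f -> smC U (fun y => conjc (f y)).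
Proof.
move=> oU hf k; have [f1 f2] := hf k; split.
  by apply: Ck_eq f1 => // ? _; rewrite ReImE.
by apply: Ck_eq (CkN oU f2) => // ? _; rewrite ReImE.
Qed.

Lemma smC_M U f g : open U -> smC U f -> smC U g -> smC U (fun y => f y * g y).
Proof.
move=> oU hf hg k; have [f1 f2] := hf k; have [g1 g2] := hg k; split.
  by apply: Ck_eq (CkD oU (CkM oU f1 g1) (CkN oU (CkM oU f2 g2))) => // ? _; rewrite ReImE.
by apply: Ck_eq (CkD oU (CkM oU f1 g2) (CkM oU f2 g1)) => // ? _; rewrite ReImE.
Qed.

Lemma smC_V U f : open U -> (forall x, U x -> f x != 0) -> smC U f ->
  smC U (fun y => (f y)^-1).
Proof.
move=> oU f0 hf k; have [f1 f2] := hf k.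
have n : Ck k U (fun y => (Re (f y) * Re (f y) +
                           Im (f y) * Im (f y))^-1).
  apply: CkV => // [x Ux|]; first exact/sqnorm_neq0/f0.
  by apply: (CkD oU); apply: (CkM oU).
split; first by apply: Ck_eq (CkM oU f1 n) => // ? _; rewrite ReImE.
by apply: Ck_eq (CkN oU (CkM oU f2 n)) => // ? _; rewrite ReImE.
Qed.

End ComplexValued.

(** * Complex coordinates on R^4 *)

Section C2points.
Context {R : realType}.
Implicit Types (p : 'rV[R]_(2 + 2)) (a b : R[i]).

Definition pt a b : 'rV[R]_(2 + 2) :=
  row_mx (\row_j if j == 0 then Re a else Re b)
         (\row_j if j == 0 then Im a else Im b).

Definition z1 p : R[i] := cplx p 0 0.
Definition z2 p : R[i] := cplx p 0 1.

Lemma cplxE p j : cplx p 0 j = p 0 (lshift 2 j) +i* p 0 (rshift 2 j).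
Proof. by rewrite !mxE. Qed.

Lemma z1_pt a b : z1 (pt a b) = a.
Proof. by rewrite /z1 cplxE row_mxEl row_mxEr !mxE; case: a. Qed.
Lemma z2_pt a b : z2 (pt a b) = b.
Proof. by rewrite /z2 cplxE row_mxEl row_mxEr !mxE; case: b. Qed.

Lemma ord2P (j : 'I_2) : j = 0 \/ j = 1.
Proof. by case: j => [[|[|//]] h]; [left | right]; apply: val_inj. Qed.

Lemma pt_z p : pt (z1 p) (z2 p) = p.
Proof.
apply/rowP => k; rewrite -(splitK k); case: (fintype.split k) => j /=.
  by rewrite row_mxEl mxE; case: (ord2P j) => -> /=; rewrite /z1 /z2 cplxE.
by rewrite row_mxEr mxE; case: (ord2P j) => -> /=; rewrite /z1 /z2 cplxE.
Qed.

Lemma pt_inj a b c d : pt a b = pt c d -> a = c /\ b = d.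
Proof.
by move=> h; rewrite -[a](z1_pt a b) -[b in _ /\ b = _](z2_pt a b) h z1_pt z2_pt.
Qed.

Lemma z_ext p q : z1 p = z1 q -> z2 p = z2 q -> p = q.
Proof. by move=> h1 h2; rewrite -(pt_z p) -(pt_z q) h1 h2. Qed.

Lemma isdC_z1 p : isdC z1 p z1.
Proof.
split; apply: isd_eq (isd_coord p _) _ _ => q; rewrite /z1 cplxE //=.
Qed.
Lemma isdC_z2 p : isdC z2 p z2.
Proof.
split; apply: isd_eq (isd_coord p _) _ _ => q; rewrite /z2 cplxE //=.
Qed.

Lemma smC_z1 U : open U -> smC U z1.
Proof. by move=> oU k; split; apply: Ck_isd_lin => // x; have [] := isdC_z1 x. Qed.
Lemma smC_z2 U : open U -> smC U z2.
Proof. by move=> oU k; split; apply: Ck_isd_lin => // x; have [] := isdC_z2 x. Qed.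

Lemma isd_pt {E : normedModType R} (f g df dg : E -> R[i]) x :
  isdC f x df -> isdC g x dg ->
  isd (fun y => pt (f y) (g y)) x (fun v => pt (df v) (dg v)).
Proof.
move=> [f1 f2] [g1 g2]; apply/isd_rowP => k.
rewrite -(splitK k); case: (fintype.split k) => j /=; case: (ord2P j) => ->.
- by apply: isd_eq f1 _ _ => y; rewrite row_mxEl mxE.
- by apply: isd_eq g1 _ _ => y; rewrite row_mxEl mxE.
- by apply: isd_eq f2 _ _ => y; rewrite row_mxEr mxE.
- by apply: isd_eq g2 _ _ => y; rewrite row_mxEr mxE.
Qed.

Lemma Ck_pt {E : normedModType R} k U (f g : E -> R[i]) : open U ->
  smC U f -> smC U g -> Ck k U (fun y => pt (f y) (g y)).
Proof.
move=> oU hf hg; have [f1 f2] := hf k; have [g1 g2] := hg k; apply/Ck_rowP => // l.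
rewrite -(splitK l); case: (fintype.split l) => j /=; case: (ord2P j) => ->.
- by apply: Ck_eq f1 => // y _; rewrite row_mxEl mxE.
- by apply: Ck_eq g1 => // y _; rewrite row_mxEl mxE.
- by apply: Ck_eq f2 => // y _; rewrite row_mxEr mxE.
- by apply: Ck_eq g2 => // y _; rewrite row_mxEr mxE.
Qed.

End C2points.

(** * Reduction of statements on ambient manifolds to subsets of R^n *)

Section Flat.
Context {R : realType}.

(** The second condition makes an open set of coordinates open when read in every other chart, so
    that subsets of the image can be studied in this chart alone. *)
Definition good_chart n (N : ambient R n) (i : chart N) :=
  injective (par N i) /\ forall O, open O -> aopen (par N i @` O : set N).

(** F and G are smooth on open neighbourhoods but mutually inverse only on A and B, which are
    typically hypersurfaces. *)
Definition fdiffeo m n (A : set 'rV[R]_m) (B : set 'rV[R]_n)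
    (F : 'rV[R]_m -> 'rV[R]_n) (G : 'rV[R]_n -> 'rV[R]_m) :=
  (exists2 U, A `<=` U & smooth U F) /\ (exists2 W, B `<=` W & smooth W G) /\
  (forall p, A p -> B (F p) /\ G (F p) = p) /\
  (forall q, B q -> A (G q) /\ F (G q) = q).

Definition ftangent n (A : set 'rV[R]_n) (p : 'rV[R]_n) : set 'rV[R]_n :=
  [set v | exists (O : set R) (c : R -> 'rV[R]_n),
     [/\ O 0, smooth O c, (forall s, O s -> A (c s)), c 0 = p & 'd c 0 1 = v]].

Lemma fdiffeo_sym m n A B (F : 'rV[R]_m -> 'rV[R]_n) G :
  fdiffeo A B F G -> fdiffeo B A G F.
Proof. by move=> [? [? [? ?]]]. Qed.

Lemma smooth_continuous (E F : normedModType R) (U : set E) (f : E -> F) x :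
  smooth U f -> U x -> {for x, continuous f}.
Proof. by move=> [_ /(_ 0%N) h]; exact: h. Qed.

Lemma smooth_diff (E F : normedModType R) (U : set E) (f : E -> F) x :
  smooth U f -> U x -> isd f x ('d f x).
Proof. by move=> [_ /(_ 1%N) [h _]] /h. Qed.

Lemma smooth_open (E F : normedModType R) (U : set E) (f : E -> F) (W : set F) :
  smooth U f -> open W -> open (U `&` f @^-1` W).
Proof.
move=> sf oW; have [oU _] := sf; rewrite openE => x [Ux Wfx].
apply: filterI; first by apply: open_nbhs_nbhs.
by apply: (smooth_continuous sf Ux); apply: open_nbhs_nbhs.
Qed.

Lemma smooth_comp (E : normedModType R) m n (U : set E) (W : set 'rV[R]_m)
  (f : E -> 'rV[R]_m) (g : 'rV[R]_m -> 'rV[R]_n) :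
  smooth U f -> smooth W g -> smooth (U `&` f @^-1` W) (fun x => g (f x)).
Proof.
move=> sf [oW sg]; have oV := smooth_open sf oW; split=> // k.
apply/Ck_rowP => // j; apply: (@Ck_comp _ _ _ _ _ W f (fun y => g y 0 j)) => //.
- by move=> x [].
- by apply: Ck_sub (sf.2 k) => x [].
- exact: ((Ck_rowP _ _ oW).1 (sg k) j).
Qed.

Section OneChart.
Context {n : nat} {N : ambient R n} {i : chart N}.
Hypothesis Ni : good_chart i.

Lemma par_setI A O : (par N i @` A : set N) `&` (par N i @` O) = par N i @` (A `&` O).
Proof.
apply/seteqP; split=> x /=.
  by move=> [[p Ap <-] [q Oq /Ni.1 e]]; exists p => //; split=> //; rewrite -e.
by move=> [p [Ap Op] <-]; split; exists p.
Qed.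

Lemma par_img A p : (par N i @` A : set N) (par N i p) <-> A p.
Proof. by split=> [[q Aq /Ni.1 <-]|Ap] //; exists p. Qed.

Lemma tangent_par A p v : tangent (par N i @` A) i p v <-> ftangent A p v.
Proof.
by split=> [[ O [c [h0 sc cA c0 dc]]]|[ O [c [h0 sc cA c0 dc]]]]; exists O, c; split=> //
  s /cA /par_img.
Qed.

Lemma cr_structure_par (A : set 'rV[R]_n) (V : cfield N) :
  submanifold 3 (par N i @` A) ->
  (forall p, A p -> exists (O : set 'rV[R]_n) (X Y : 'rV[R]_n -> 'rV[R]_n),
    [/\ O p, smooth O X, smooth O Y &
      forall q, O q -> A q ->
      [/\ cvec (X q) (Y q) != 0,
          V i q = cline (cvec (X q) (Y q)),
          (forall w, V i q w -> ftangent A q (Re_vec w) /\ ftangent A q (Im_vec w)),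
          (forall w, V i q w -> V i q (conj_vec w) -> w = 0) &
          forall u, ftangent A q u -> exists a b c : R,
            u = a *: X q + b *: Y q + c *: lie_bracket X Y q]]) ->
  cr_structure (par N i @` A) V.
Proof.
move=> sA H; split=> // x [p Ap <-]; exists i, p; split=> //.
have [ O [X [Y [Op sX sY h]]]] := H p Ap; exists O, X, Y; split=> // q Oq /par_img Aq.
have [h1 h2 h3 h4 h5] := h q Oq Aq; split=> //.
  by move=> w /h3 [? ?]; split; apply/tangent_par.
by move=> u /tangent_par /h5.
Qed.

End OneChart.

Section TwoCharts.
Context {m n : nat} {N1 : ambient R m} {N2 : ambient R n} {i : chart N1} {j : chart N2}.
Hypotheses (Ni : good_chart i) (Nj : good_chart j).

(** Coordinates are recovered by choice, with default 0 off the image of the chart; only points of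
    the image matter below. *)
Definition lift_chart (F : 'rV[R]_m -> 'rV[R]_n) (x : N1) : N2 :=
  par N2 j (F (xget 0 [set p | par N1 i p = x])).

Lemma lift_chartE F p : lift_chart F (par N1 i p) = par N2 j (F p).
Proof.
rewrite /lift_chart; congr (par N2 j (F _)); apply: Ni.1.
by apply: (xgetPex 0 (P := [set q | par N1 i q = par N1 i p])); exists p.
Qed.

Lemma smooth_map_par (A : set 'rV[R]_m) (B : set 'rV[R]_n) U f F :
  A `<=` U -> smooth U F -> (forall p, A p -> B (F p)) ->
  (forall p, A p -> f (par N1 i p) = par N2 j (F p)) ->
  smooth_map (par N1 i @` A) (par N2 j @` B) f.
Proof.
move=> AU sF FAB fF; split=> [x [p Ap <-]|x [p Ap <-]].
  by rewrite /= fF //; exists (F p) => //; exact: FAB.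
exists i, j, p, F; split=> //; exists U; split=> //; first exact: AU.
by move=> q _ /(par_img Ni) /fF.
Qed.

Lemma continuous_map_par (A : set 'rV[R]_m) (B : set 'rV[R]_n) U f F :
  A `<=` U -> smooth U F -> (forall p, A p -> B (F p)) ->
  (forall p, A p -> f (par N1 i p) = par N2 j (F p)) ->
  continuous_map (par N1 i @` A) (par N2 j @` B) f.
Proof.
move=> AU sF FAB fF; split=> [x [p Ap <-]|W oW].
  by rewrite /= fF //; exists (F p) => //; exact: FAB.
exists (par N1 i @` (U `&` F @^-1` (par N2 j @^-1` W))).
  by apply: Ni.2; apply: smooth_open => //; exact: oW.
move=> x [p Ap <-]; rewrite (par_img Ni) fF //; split; first by case.
by move=> h; split=> //; exact: AU.
Qed.

Lemma pushes_forward_par (A : set 'rV[R]_m) U f F (V1 : cfield N1) (V2 : cfield N2) :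
  A `<=` U -> smooth U F ->
  (forall p, A p -> f (par N1 i p) = par N2 j (F p)) ->
  (forall p, A p -> V2 j (F p) = [set diffC F p w | w in V1 i p]) ->
  pushes_forward (par N1 i @` A) V1 V2 f.
Proof.
move=> AU sF fF h x [p Ap <-]; exists i, j, p, F; split=> //; last exact: h.
exists U; split=> //; first exact: AU.
by move=> q _ /(par_img Ni) /fF.
Qed.

End TwoCharts.

Section TwoCharts2.
Context {m n : nat} {N1 : ambient R m} {N2 : ambient R n} {i : chart N1} {j : chart N2}.
Hypotheses (Ni : good_chart i) (Nj : good_chart j).

Lemma diffeo_par (A : set 'rV[R]_m) (B : set 'rV[R]_n) f F G :
  fdiffeo A B F G -> (forall p, A p -> f (par N1 i p) = par N2 j (F p)) ->
  diffeo (par N1 i @` A) (par N2 j @` B) f.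
Proof.
move=> [[U AU sF] [[W BW sG] [FB GA]]] fF.
exists (lift_chart (i := j) (j := i) G); split.
- by apply: smooth_map_par sF _ fF => // p /FB[].
- apply: (smooth_map_par Nj BW sG) => [p /GA[]//|p _]; exact: lift_chartE.
- split=> [x [p Ap <-]|y [q Bq <-]].
    by rewrite fF // lift_chartE //; have [_ ->] := FB p Ap.
  by rewrite lift_chartE //; have [h e] := GA q Bq; rewrite fF // e.
Qed.

Lemma homeo_par (A : set 'rV[R]_m) (B : set 'rV[R]_n) f F G :
  fdiffeo A B F G -> (forall p, A p -> f (par N1 i p) = par N2 j (F p)) ->
  homeo (par N1 i @` A) (par N2 j @` B) f.
Proof.
move=> [[U AU sF] [[W BW sG] [FB GA]]] fF.
exists (lift_chart (i := j) (j := i) G); split.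
- by apply: (continuous_map_par Ni AU sF _ fF) => // p /FB[].
- apply: (continuous_map_par Nj BW sG) => [p /GA[]//|p _]; exact: lift_chartE.
- split=> [x [p Ap <-]|y [q Bq <-]].
    by rewrite fF // lift_chartE //; have [_ ->] := FB p Ap.
  by rewrite lift_chartE //; have [h e] := GA q Bq; rewrite fF // e.
Qed.

End TwoCharts2.

Lemma euclid_good n : @good_chart n (euclid R n) tt.
Proof.
by split=> [p q //|O oO i]; rewrite (_ : _ @^-1` _ = O) //; apply/seteqP; split=> x /=;
  [move=> [q Oq <-] | exists x].
Qed.

Lemma submanifold_par k n (N : ambient R n) (i : chart N) (A : set 'rV[R]_n) :
  good_chart i ->
  (forall p, A p -> exists (W : set 'rV[R]_n) (O : set 'rV[R]_k) G H,
     [/\ open W, W p, open O & fdiffeo O (A `&` W) G H]) ->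
  submanifold k (par N i @` A).
Proof.
move=> Ni h x [p Ap <-]; have [W [ O [G [H [oW Wp oO d]]]]] := h p Ap.
exists (par N i @` W), O, (fun q => par N i (G q)); split.
- exact: Ni.2.
- by exists p.
- by move=> ?.
- rewrite par_setI //.
  have {1}-> : O = par (euclid R k) tt @` O.
    by apply/seteqP; split=> y /=; [exists y | move=> [z Oz <-]].
  by apply: (diffeo_par (@euclid_good k) Ni d).
Qed.

End Flat.

(** * Open sets cut out by smooth inequalities *)

Section OpenSets.
Context {R : realType} {E : normedModType R}.
Implicit Types (U : set E).

Lemma open_ngt0 U (f : E -> R) : open U -> (forall k, Ck k U f) ->
  open [set x | U x /\ 0 < f x].
Proof.
by move=> oU sf; apply: (@smooth_open _ _ _ U f [set y | 0 < y]); [split | exact: open_gt].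
Qed.

Lemma open_neq0 U (f : E -> R) : open U -> (forall k, Ck k U f) ->
  open [set x | U x /\ f x != 0].
Proof.
move=> oU sf; apply: (@smooth_open _ _ _ U f [set y | y != 0]); first by split.
exact: open_neq.
Qed.

Lemma open_neq0C U (f : E -> R[i]) : open U -> smC U f -> open [set x | U x /\ f x != 0].
Proof.
move=> oU sf.
pose n x := Re (f x) * Re (f x) + Im (f x) * Im (f x).
have -> : [set x | U x /\ f x != 0] = [set x | U x /\ n x != 0].
  apply/seteqP; split=> x /= [Ux h]; split=> //; first exact: sqnorm_neq0.
  by apply: contra h => /eqP h; rewrite /n h /= !mulr0 addr0.
apply: open_neq0 => // k; have [f1 f2] := sf k.
by apply: (CkD oU); apply: (CkM oU).
Qed.

End OpenSets.

(** * The charts of M_2(R), C^2 and P(sl_2(C)) *)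

Section Charts.
Context {R : realType}.

Lemma good_unit n (N : ambient R n) (i : chart N) :
  (forall j, j = i) -> injective (par N i) -> good_chart i.
Proof.
move=> ui inj; split=> // O oO j; rewrite (ui j).
rewrite (_ : _ @^-1` _ = O) //; apply/seteqP; split=> p /=; last by exists p.
by move=> [q Oq /inj <-].
Qed.

Lemma good_M2R : @good_chart R _ (M2R R) tt.
Proof. by apply: good_unit => [[]//|]; exact: (can_inj vec_mxK). Qed.

Lemma par_C2 p : par (C2 R) tt p = \col_k if k == 0 then z1 p else z2 p.
Proof.
by apply/matrixP => k l; rewrite (ord1 l) /= mxE; case: (ord2P k) => -> /=; rewrite mxE.
Qed.

Lemma good_C2 : @good_chart R _ (C2 R) tt.
Proof.
apply: good_unit => [[]//|p q]; rewrite !par_C2 => /colP e; apply: z_ext.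
  by have := e 0; rewrite !mxE.
by have := e 1; rewrite !mxE.
Qed.

Lemma vline_eq (K : fieldType) (V : vectType K) (v w : V) : v != 0 -> w != 0 ->
  (<[v]> = <[w]>)%VS <-> exists2 c : K, c != 0 & v = c *: w.
Proof.
move=> v0 w0; split=> [e|[c c0 ->]].
  have /vlineP [c vc] : v \in <[w]>%VS by rewrite -e memv_line.
  by exists c => //; apply: contra v0 => /eqP c0; rewrite vc c0 scale0r.
apply/eqP; rewrite eqEsubv -!memvE memvZ ?memv_line //=.
apply/vlineP; exists c^-1; by rewrite scalerA mulVf // scale1r.
Qed.

(** The affine chart in which the lower left entry is 1. It contains the whole orbit of [L_t], by
    [Mc_neq0]. *)
Definition proj_chart : chart (Psl2C R) := inord 2.

Lemma ord3P (l : 'I_3) : [\/ l = 0, l = 1 | l = inord 2].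
Proof.
case: l => [[|[|[|//]]] h]; [apply: Or31 | apply: Or32 | apply: Or33];
  by apply: val_inj; rewrite /= ?inordK.
Qed.

Definition sl2 (a b c : R[i]) : 'M[R[i]]_2 := mx22 a b c (- a).

Lemma sl2_mxE (Z : 'rV[R[i]]_3) : sl2_mx Z = sl2 (Z 0 0) (Z 0 1) (Z 0 (inord 2)).
Proof. by []. Qed.

Lemma sl2_inj a b c a' b' c' : sl2 a b c = sl2 a' b' c' -> [/\ a = a', b = b' & c = c'].
Proof.
move=> /matrixP e; split.
- by have := e 0 0; rewrite !mxE.
- by have := e 0 1; rewrite !mxE.
- by have := e 1 0; rewrite !mxE.
Qed.

Lemma sl2_scale k a b c : k *: sl2 a b c = sl2 (k * a) (k * b) (k * c).
Proof.
apply/matrixP => i j; rewrite !mxE.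
by case: (ord2P i) => ->; case: (ord2P j) => -> //=; rewrite mulrN.
Qed.

Lemma sl2_eq0 a b c : (sl2 a b c == 0) = [&& a == 0, b == 0 & c == 0].
Proof.
apply/eqP/and3P => [/matrixP e|[/eqP-> /eqP-> /eqP->]].
  have := e 0 0; have := e 0 1; have := e 1 0; rewrite !mxE /= => -> -> ->.
  by rewrite !eqxx.
by apply/matrixP => i j; rewrite !mxE oppr0; case: ifP => _; case: ifP.
Qed.

Lemma par_Psl2C p : par (Psl2C R) proj_chart p = <[sl2 (z1 p) (z2 p) 1]>%VS.
Proof.
rewrite /= sl2_mxE !mxE.
have -> : unlift (inord 2 : 'I_3) 0 = Some (0 : 'I_2).
  have -> : (0 : 'I_3) = lift (inord 2) (0 : 'I_2) by apply: val_inj; rewrite /= inordK.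
  by rewrite liftK.
have -> : unlift (inord 2 : 'I_3) 1 = Some (1 : 'I_2).
  have -> : (1 : 'I_3) = lift (inord 2) (1 : 'I_2) by apply: val_inj; rewrite /= inordK.
  by rewrite liftK.
by rewrite unlift_none /z1 /z2 !cplxE.
Qed.

Lemma sl2_line a b c : c != 0 ->
  <[sl2 a b c]>%VS = par (Psl2C R) proj_chart (pt (a / c) (b / c)).
Proof.
move=> c0; rewrite par_Psl2C z1_pt z2_pt; apply/vline_eq.
- by rewrite sl2_eq0 (negbTE c0) !andbF.
- by rewrite sl2_eq0 oner_eq0 !andbF.
- by exists c => //; rewrite sl2_scale mulr1 [c * _]mulrC divfK // [c * _]mulrC divfK.
Qed.

(** Read in the chart j, the image of O is the preimage of O under the change of charts, which
    divides the homogeneous coordinates by the last one and is smooth on the open set where that one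
    is nonzero. *)
Lemma good_Psl2C : good_chart proj_chart.
Proof.
split=> [p q|O oO j].
  rewrite !par_Psl2C => /vline_eq [||c c0].
  - by rewrite sl2_eq0 oner_eq0 !andbF.
  - by rewrite sl2_eq0 oner_eq0 !andbF.
  rewrite sl2_scale => /sl2_inj [e1 e2 e3].
  by apply: z_ext; rewrite ?e1 ?e2 -[c]mulr1 -e3 mul1r.
pose h l q : R[i] := homog j (cplx q) 0 l.
have sh l : smC setT (h l).
  have oT : open (setT : set 'rV[R]_(2 + 2)) by exact: openT.
  case u : (unlift j l) => [m|]; last first.
    by rewrite (_ : h l = fun=> 1); [exact: smC_cst | apply/funext => q; rewrite /h mxE u].
  case: (ord2P m) => em.
    by rewrite (_ : h l = z1); [exact: smC_z1 | apply/funext => q; rewrite /h mxE u em].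
  by rewrite (_ : h l = z2); [exact: smC_z2 | apply/funext => q; rewrite /h mxE u em].
set U := [set q | setT q /\ h (inord 2) q != 0].
have oU : open U by apply: open_neq0C => //; exact: openT.
have shU l : smC U (h l) by exact: smC_sub (sh l).
have shV : smC U (fun q => (h (inord 2) q)^-1) by apply: smC_V => // q [].
have sP : smooth U (fun q => pt (h 0 q / h (inord 2) q) (h 1 q / h (inord 2) q)).
  by split=> // k; apply: Ck_pt => //; exact: smC_M.
rewrite (_ : _ @^-1` _ = U `&` (fun q => pt (h 0 q / h (inord 2) q) (h 1 q / h (inord 2) q)) @^-1` O).
  exact: smooth_open.
have parh q : par (Psl2C R) j q = <[sl2 (h 0%R q) (h 1%R q) (h (inord 2) q)]>%VS by [].
have hj q : h j q = 1 by rewrite /h mxE unlift_none.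
have hn0 q : sl2 (h 0 q) (h 1 q) (h (inord 2) q) != 0.
  apply/negP; rewrite sl2_eq0 => /and3P[/eqP k0 /eqP k1 /eqP k2].
  have := hj q; have [e|e|e] := ord3P j; rewrite e ?k0 ?k1 ?k2 => /esym/eqP; rewrite oner_eq0 //.
apply/seteqP; split=> q /=.
  move=> [p Op e]; have : par (Psl2C R) proj_chart p = par (Psl2C R) j q by exact: e.
  rewrite par_Psl2C parh => /esym /vline_eq [//||c c0].
    by rewrite sl2_eq0 oner_eq0 !andbF.
  rewrite sl2_scale => /sl2_inj [e1 e2 e3]; rewrite e1 e2 e3 mulr1.
  split; first by split=> //; rewrite e3 mulr1.
  by rewrite ![c * _]mulrC !mulfK // pt_z.
by move=> [[_ h2] Oh]; eexists; [exact: Oh|]; exact: (esym (sl2_line _ _ h2)).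
Qed.

End Charts.

(** * Level sets of a quadratic form: charts and tangent spaces *)

Section Quadrics.
Context {R : realType}.

Lemma isd_id {E : normedModType R} (x : E) : isd id x id.
Proof. by have [] := is_diff_id x. Qed.

Lemma Ck_coord n k (U : set 'rV[R]_n) j : open U -> Ck k U (fun x => x 0 j).
Proof. by move=> oU; apply: Ck_isd_lin => // x; exact: isd_coord. Qed.

Section Hyperplane.
Variables (n : nat) (w : 'rV[R]_n.+1) (k : 'I_n.+1).
Hypothesis wk : w 0 k != 0.

(** Parametrises the hyperplane orthogonal to w as a graph, by solving its equation for the
    coordinate k; [hyp_out] forgets that coordinate. *)
Definition hyp_in (z : 'rV[R]_n) : 'rV[R]_n.+1 :=
  \row_l if unlift k l is Some m then z 0 m
         else - ((w 0 k)^-1 * \sum_m z 0 m * w 0 (lift k m)).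

Definition hyp_out (y : 'rV[R]_n.+1) : 'rV[R]_n := \row_m y 0 (lift k m).

Lemma hyp_inK : cancel hyp_in hyp_out.
Proof. by move=> z; apply/rowP => m; rewrite !mxE liftK. Qed.

Lemma hyp_in_perp z : \sum_l w 0 l * hyp_in z 0 l = 0.
Proof.
rewrite (bigD1_ord k) //= mxE unlift_none mulrN mulrA divff // mul1r addrC.
apply/eqP; rewrite subr_eq0; apply/eqP; apply: eq_bigr => m _.
by rewrite mxE liftK mulrC.
Qed.

Lemma hyp_outK (y : 'rV[R]_n.+1) : \sum_l w 0 l * y 0 l = 0 -> hyp_in (hyp_out y) = y.
Proof.
rewrite (bigD1_ord k) //= => e; apply/rowP => l; rewrite mxE.
case: unliftP => [m ->|->]; first by rewrite mxE.
have -> : \sum_m hyp_out y 0 m * w 0 (lift k m) = - (w 0 k * y 0 k).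
  apply/eqP; rewrite -addr_eq0 addrC -[X in _ == X]e; apply/eqP; congr (_ + _).
  by apply: eq_bigr => m _; rewrite mxE mulrC.
by rewrite mulrN opprK mulKf.
Qed.

Lemma Ck_hyp_in d (U : set 'rV[R]_n) l : open U -> Ck d U (fun z => hyp_in z 0 l).
Proof.
move=> oU; case u : (unlift k l) => [m|].
  by apply: Ck_eq (Ck_coord d m oU) => // z _; rewrite mxE u.
apply: (@Ck_eq _ _ _ _ _
  (fun z : 'rV[R]_n => - ((w 0 k)^-1 * \sum_m z 0 m * w 0 (lift k m)))) => // [z _|].
  by rewrite mxE u.
apply: (CkN oU); apply: (CkM oU); first exact: Ck_cst.
by apply: (Ck_sum _ oU) => m; apply: (CkM oU); [exact: Ck_coord | exact: Ck_cst].
Qed.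

End Hyperplane.

Variables (n : nat) (S : 'M[R]_n.+1).
Hypothesis S_sym : S^T = S.

Definition bil (x y : 'rV[R]_n.+1) : R := \sum_j \sum_k S j k * (x 0 j * y 0 k).

Lemma bilC x y : bil x y = bil y x.
Proof.
rewrite /bil exchange_big; apply: eq_bigr => j _; apply: eq_bigr => k _.
by rewrite -[in LHS]S_sym mxE [x _ _ * _]mulrC.
Qed.

Lemma bilDr x y z : bil x (y + z) = bil x y + bil x z.
Proof.
rewrite /bil -big_split; apply: eq_bigr => j _; rewrite -big_split; apply: eq_bigr => k _.
by rewrite mxE !mulrDr.
Qed.

Lemma bilZr a x y : bil x (a *: y) = a * bil x y.
Proof.
rewrite /bil mulr_sumr; apply: eq_bigr => j _; rewrite mulr_sumr; apply: eq_bigr => k _.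
by rewrite mxE; ring.
Qed.

Lemma bilDl x y z : bil (y + z) x = bil y x + bil z x.
Proof. by rewrite bilC bilDr !(bilC x). Qed.

Lemma bilZl a x y : bil (a *: y) x = a * bil y x.
Proof. by rewrite bilC bilZr (bilC x). Qed.

Lemma isd_bil (E : normedModType R) (f g df dg : E -> 'rV[R]_n.+1) x :
  isd f x df -> isd g x dg ->
  isd (fun y => bil (f y) (g y)) x (fun v => bil (df v) (g x) + bil (f x) (dg v)).
Proof.
move=> /isd_rowP hf /isd_rowP hg.
apply: isd_eq (isd_sum _ (fun j => isd_sum _ (fun k =>
  isdM (isd_cst (S j k) x) (isdM (hf j) (hg k))))) _ _ => // v /=.
rewrite /bil -big_split; apply: eq_bigr => j _; rewrite -big_split; apply: eq_bigr => k _ /=.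
by ring.
Qed.

Lemma Ck_bil (E : normedModType R) d (U : set E) (f g : E -> 'rV[R]_n.+1) : open U ->
  (forall j, Ck d U (fun y => f y 0 j)) -> (forall j, Ck d U (fun y => g y 0 j)) ->
  Ck d U (fun y => bil (f y) (g y)).
Proof.
move=> oU hf hg; apply: (Ck_sum _ oU) => j; apply: (Ck_sum _ oU) => k.
by apply: (CkM oU); [exact: Ck_cst | exact: CkM].
Qed.

Definition quadric : set 'rV[R]_n.+1 := [set x | bil x x = 1].

Lemma quadric_tangent (W : set 'rV[R]_n.+1) x u : open W -> quadric x -> W x ->
  ftangent (quadric `&` W) x u <-> bil x u = 0.
Proof.
move=> oW Qx Wx; split=> [[D [c [D0 sc cA c0 dc]]]|xu].
  have h := isd_bil (smooth_diff sc D0) (smooth_diff sc D0).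
  have [h1 h2] := diff_near_eq (f := fun s => bil (c s) (c s)) (g := fun=> 1) (x := 0 : R)
    (open_near sc.1 D0 (fun s Os => (cA s Os).1)) h.1.
  have [_ h3] := isd_cst (1 : R) (0 : R).
  have := congr1 (fun f => f 1) (etrans (esym h.2) (etrans (esym h2) h3)).
  rewrite dc c0 bilC -mulr2n => /eqP; rewrite mulrn_eq0 /= bilC => /eqP.
  by rewrite bilC.
(* The image of the line s u under inverse stereographic projection from -x. *)
pose kp := bil u u / 4.
pose U := [set s : R | setT s /\ 1 + kp * (s * s) != 0].
have oT : open (setT : set R) by exact: openT.
have Ckid k : Ck k setT (fun s : R => s).
  by apply: Ck_isd_lin => // y; exact: isd_id.
have sq k : Ck k setT (fun s : R => kp * (s * s)).
  by apply: (CkM oT); [exact: Ck_cst | apply: (CkM oT)].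
have oU : open U by apply: open_neq0 => // k; apply: (CkD oT) => //; exact: Ck_cst.
pose c (s : R) := \row_j (((1 - kp * (s * s)) * x 0 j + s * u 0 j) / (1 + kp * (s * s))).
have subT k (f : R -> R) : Ck k setT f -> Ck k U f by apply: Ck_sub => s [].
have sc : smooth U c.
  split=> // k; apply/Ck_rowP => // j; apply: (@Ck_eq _ _ _ _ _ (fun s : R =>
    ((1 - kp * (s * s)) * x 0 j + s * u 0 j) / (1 + kp * (s * s)))) => // [s _|].
    by rewrite mxE.
  apply: (CkM oU).
    apply: subT; apply: (CkD oT); apply: (CkM oT) => //; try exact: Ck_cst.
    by apply: (CkD oT); [exact: Ck_cst | apply: (CkN oT)].
  apply: CkV => // [s []//|]; apply: subT; apply: (CkD oT) => //; exact: Ck_cst.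
exists (U `&` c @^-1` W), c.
have c0 : c 0 = x.
  by apply/rowP => j; rewrite mxE !mulr0 !mul0r subr0 !addr0 mul1r invr1 mulr1.
split => //.
- split; last by rewrite /= c0.
  by split=> //; rewrite !mulr0 addr0 oner_eq0.
- split; first exact: smooth_open.
  by move=> k; apply: Ck_sub (sc.2 k) => s [].
- move=> s [[_ s0] Wcs]; split=> //; rewrite /quadric /=.
  have -> : c s = (1 + kp * (s * s))^-1 *: ((1 - kp * (s * s)) *: x + s *: u).
    by apply/rowP => j; rewrite !mxE mulrC.
  rewrite !(bilZl, bilZr, bilDl, bilDr) (bilC u x) xu (Qx : bil x x = 1).
  (* With this value the numerator (1 - kp s^2)^2 + 4 kp s^2 is the square of the denominator, which
     explains the 4 in [kp]. *)
  have -> : bil u u = 4 * kp by rewrite /kp mulrC divfK.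
  by field.
- have [_ h] : isd c 0 (fun v : R => v *: u); last by rewrite h scale1r.
  apply/isd_rowP => j.
  have hs : isd (fun s : R => kp * (s * s)) 0 (fun=> 0).
    apply: isd_eq (isdM (isd_cst kp (0 : R)) (isdM (isd_id (0 : R)) (isd_id (0 : R)))) _ _ => // v.
    by rewrite !mul0r; ring.
  have n0 : 1 + kp * (0 * 0) != 0 :> R by rewrite !mulr0 addr0 oner_eq0.
  have h1 := isdD (isd_cst (1 : R) (0 : R)) hs.
  have h2 := isdD (isd_cst (1 : R) (0 : R)) (isdN hs).
  apply: isd_eq (isdM (isdD (isdM h2 (isd_cst (x 0 j) (0 : R))) (isdM (isd_id (0 : R)) (isd_cst (u 0 j) (0 : R))))
    (isdV (f := fun s : R => 1 + kp * (s * s)) n0 h1)) _ _ => [s|v]; rewrite mxE //.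
  by rewrite /= !mulr0 !mul0r !oppr0 !addr0 invr1; ring.
Qed.

Lemma fdiffeo_restrict m p (A : set 'rV[R]_m) (B : set 'rV[R]_p) F G W :
  fdiffeo A B F G -> fdiffeo (A `&` F @^-1` W) (B `&` W) F G.
Proof.
move=> [[U AU sF] [[V BV sG] [FB GA]]]; split; first by exists U => // q [/AU].
split; first by exists V => // q [/BV].
split=> [q [/FB [Bq e] Wq]|q [/GA [Aq e] Wq]]; first by split.
by split=> //; split=> //=; rewrite e.
Qed.

Lemma quadric_submanifold (W : set 'rV[R]_n.+1) (x : 'rV[R]_n.+1) : open W ->
  (quadric `&` W) x -> exists (W' : set 'rV[R]_n.+1) (O : set 'rV[R]_n) G H,
     [/\ open W', W' x, open O & fdiffeo O (quadric `&` W `&` W') G H].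
Proof.
move=> oW [Qx Wx]; pose w : 'rV[R]_n.+1 := \row_k \sum_j S j k * x 0 j.
have wE (y : 'rV[R]_n.+1) : \sum_l w 0 l * y 0 l = bil x y.
  rewrite /bil exchange_big; apply: eq_bigr => k _; rewrite mxE mulr_suml.
  by apply: eq_bigr => j _; rewrite mulrA.
(* The covector w = S x takes the value 1 on x, hence is nonzero. The argument works in any
   signature, so it serves det as well as definite and indefinite hermitian forms. *)
have [k wk] : exists k, w 0 k != 0.
  apply/existsP; rewrite -[X in is_true X]negbK; apply/negP => /existsPn h.
  have /eqP := Qx; rewrite -wE big1 ?[0 == 1]eq_sym ?oner_eq0 // => l _.
  by have := h l; rewrite negbK => /eqP ->; rewrite mul0r.
(* H is stereographic projection from -x and G is its inverse. *)
pose kp z := bil (hyp_in w k z) (hyp_in w k z) / 4.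
have oT : open (setT : set 'rV[R]_n) by exact: openT.
have oT1 : open (setT : set 'rV[R]_n.+1) by exact: openT.
have skp d : Ck d setT kp.
  apply: (CkM oT); last exact: Ck_cst.
  by apply: (Ck_bil oT) => j; exact: Ck_hyp_in.
pose U := [set z | setT z /\ 1 + kp z != 0].
have oU : open U by apply: open_neq0 => // d; apply: (CkD oT) => //; exact: Ck_cst.
have subT d (f : 'rV[R]_n -> R) : Ck d setT f -> Ck d U f by apply: Ck_sub => s [].
pose G z : 'rV[R]_n.+1 := \row_j (((1 - kp z) * x 0 j + hyp_in w k z 0 j) / (1 + kp z)).
have sG : smooth U G.
  split=> // d; apply/Ck_rowP => // j; apply: (@Ck_eq _ _ _ _ _ (fun z : 'rV[R]_n =>
    ((1 - kp z) * x 0 j + hyp_in w k z 0 j) / (1 + kp z))) => // [z _|].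
    by rewrite [RHS]mxE.
  apply: (CkM oU).
    apply: subT; apply: (CkD oT); last exact: Ck_hyp_in.
    apply: (CkM oT); last exact: Ck_cst.
    by apply: (CkD oT); [exact: Ck_cst | apply: (CkN oT)].
  by apply: CkV => // [s []//|]; apply: subT; apply: (CkD oT) => //; exact: Ck_cst.
have sbx d : Ck d setT (bil x).
  by apply: (Ck_bil oT1) => j; [exact: Ck_cst | exact: Ck_coord].
pose V := [set y | setT y /\ 1 + bil x y != 0].
have oV : open V by apply: open_neq0 => // d; apply: (CkD oT1) => //; exact: Ck_cst.
have subT1 d (f : 'rV[R]_n.+1 -> R) : Ck d setT f -> Ck d V f by apply: Ck_sub => s [].
pose H y : 'rV[R]_n := hyp_out k ((2 / (1 + bil x y)) *: (y - bil x y *: x)).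
have sH : smooth V H.
  split=> // d; apply/Ck_rowP => // j; apply: (@Ck_eq _ _ _ _ _ (fun y : 'rV[R]_n.+1 =>
    (2 / (1 + bil x y)) * (y 0 (lift k j) - bil x y * x 0 (lift k j)))) => // [y _|].
    by rewrite /H /hyp_out !mxE.
  apply: (CkM oV).
    apply: (CkM oV); first exact: Ck_cst.
    by apply: CkV => // [y []//|]; apply: subT1; apply: (CkD oT1) => //; exact: Ck_cst.
  apply: subT1; apply: (CkD oT1); first exact: Ck_coord.
  by apply: (CkN oT1); apply: (CkM oT1) => //; exact: Ck_cst.
have GE z : G z = (1 + kp z)^-1 *: ((1 - kp z) *: x + hyp_in w k z).
  by apply/rowP => j; rewrite [LHS]mxE mulrC [RHS]mxE [in RHS]mxE [in RHS]mxE.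
have xhyp z : bil x (hyp_in w k z) = 0 by rewrite -wE hyp_in_perp.
have hyp2 z : bil (hyp_in w k z) (hyp_in w k z) = 4 * kp z by rewrite /kp mulrC divfK.
have xG z : U z -> bil x (G z) = (1 - kp z) / (1 + kp z).
  by move=> [_ z0]; rewrite GE bilZr bilDr bilZr xhyp (Qx : bil x x = 1); field.
have dif : fdiffeo U (quadric `&` V) G H.
  split; first by exists U.
  split; first by exists V => // y [].
  split=> [z Uz|y [Qy [_ Vy]]].
    have [_ z0] := Uz; have xGz := xG z Uz.
    have e1 : 1 + bil x (G z) = 2 / (1 + kp z) by rewrite xGz; field.
    split; first split.
    - rewrite /quadric /= GE !(bilZl, bilZr, bilDl, bilDr) (bilC _ x) xhyp hyp2.
      by rewrite (Qx : bil x x = 1); field.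
    - by split=> //; rewrite e1 mulf_neq0 ?invr_neq0 ?pnatr_eq0.
    rewrite /H; set y := (X in hyp_out k X).
    suff -> : y = hyp_in w k z by rewrite hyp_inK.
    rewrite /y e1 xGz [in LHS]GE; apply/rowP => j; rewrite !mxE.
    by field.
  have hH : hyp_in w k (H y) = (2 / (1 + bil x y)) *: (y - bil x y *: x).
    apply: hyp_outK => //; rewrite wE bilZr bilDr -scaleN1r !bilZr (Qx : bil x x = 1).
    by rewrite mulr1 mulN1r subrr mulr0.
  have kH : kp (H y) = (1 - bil x y) / (1 + bil x y).
    rewrite /kp hH !(bilZl, bilZr) -scaleN1r !(bilDl, bilDr, bilZl, bilZr).
    by rewrite (bilC y x) (Qx : bil x x = 1) (Qy : bil y y = 1); field.
  have k1 : 1 + kp (H y) = 2 / (1 + bil x y) by rewrite kH; field.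
  split; first by split=> //; rewrite k1 mulf_neq0 ?invr_neq0 ?pnatr_eq0.
  rewrite GE k1 hH kH; apply/rowP => j; rewrite !mxE; field.
  by [].
exists V, (U `&` G @^-1` W), G, H; split=> //.
- by split=> //; rewrite (Qx : bil x x = 1) (_ : 1 + 1 = 2) ?pnatr_eq0.
- exact: smooth_open.
- by rewrite -setIA (setIC W) setIA; exact: fdiffeo_restrict.
Qed.

End Quadrics.

(** * The same results for an abstract symmetric bilinear form, through its Gram matrix *)

Section BilinearForms.
Context {R : realType} {n : nat} (b : 'rV[R]_n.+1 -> 'rV[R]_n.+1 -> R).
Hypotheses (bC : forall x y, b x y = b y x)
  (bD : forall x y z, b x (y + z) = b x y + b x z)
  (bZ : forall a x y, b x (a *: y) = a * b x y).

Let S : 'M[R]_n.+1 := \matrix_(j, k) b (delta_mx 0 j) (delta_mx 0 k).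

Let S_sym : S^T = S.
Proof. by apply/matrixP => j k; rewrite !mxE bC. Qed.

Let b_sum x (I : Type) (s : seq I) f : b x (\sum_(i <- s) f i) = \sum_(i <- s) b x (f i).
Proof.
elim: s => [|i s IH]; last by rewrite !big_cons bD IH.
by rewrite !big_nil -(scale0r (0 : 'rV[R]_n.+1)) bZ mul0r.
Qed.

Let bilS x y : bil S x y = b x y.
Proof.
rewrite {2}(row_sum_delta x) bC b_sum; apply: eq_bigr => j _.
rewrite bZ bC {2}(row_sum_delta y) b_sum mulr_sumr; apply: eq_bigr => k _.
by rewrite bZ mxE; ring.
Qed.

Let quadricE : quadric S = [set x | b x x = 1].
Proof. by apply/seteqP; split=> x; rewrite /quadric /= bilS. Qed.

Lemma level_tangent (W : set 'rV[R]_n.+1) x u : open W -> b x x = 1 -> W x ->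
  ftangent ([set x | b x x = 1] `&` W) x u <-> b x u = 0.
Proof. by move=> oW xx Wx; rewrite -quadricE -bilS quadric_tangent // quadricE. Qed.

Lemma level_chart (W : set 'rV[R]_n.+1) x : open W -> ([set x | b x x = 1] `&` W) x ->
  exists (W' : set 'rV[R]_n.+1) (O : set 'rV[R]_n) G H,
    [/\ open W', W' x, open O & fdiffeo O ([set x | b x x = 1] `&` W `&` W') G H].
Proof. by move=> oW; rewrite -quadricE; exact: quadric_submanifold. Qed.

Lemma level_submanifold (N : ambient R n.+1) (i : chart N) (W : set 'rV[R]_n.+1) :
  good_chart i -> open W ->
  submanifold n (par N i @` ([set x | b x x = 1] `&` W)).
Proof.
by move=> Ni oW; apply: submanifold_par => // x; exact: level_chart.
Qed.

End BilinearForms.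

(** * Induced CR structures of hypersurfaces *)

Section InducedCR.
Context {R : realType}.
Implicit Types (w : 'rV[R[i]]_(2 + 2)) (a b : R[i]).

Lemma Re_cvec n (X Y : 'rV[R]_n) : Re_vec (cvec X Y) = X.
Proof. by apply/rowP => j; rewrite !mxE. Qed.
Lemma Im_cvec n (X Y : 'rV[R]_n) : Im_vec (cvec X Y) = Y.
Proof. by apply/rowP => j; rewrite !mxE. Qed.
Lemma cvec_ReIm n (w : 'rV[R[i]]_n) : cvec (Re_vec w) (Im_vec w) = w.
Proof. by apply/rowP => j; rewrite !mxE; case: (w 0 j). Qed.

Lemma conj_vecE n (w : 'rV[R[i]]_n) : conj_vec w = cvec (Re_vec w) (- Im_vec w).
Proof. by apply/rowP => j; rewrite !mxE; case: (w 0 j). Qed.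

(** The vector X + i J X, where X = (a, b) and J is multiplication by i on R^4: the general vector
    of type (0,1). It is antilinear in (a, b). *)
Definition crvec a b : 'rV[R[i]]_(2 + 2) := cvec (pt a b) (pt ('i * a) ('i * b)).

Lemma mul_i_eq (x y : R[i]) : x + 'i * y = 0 -> 'i * x = y.
Proof.
by move=> /eqP; rewrite addr_eq0 => /eqP ->; rewrite mulrN mulrA -expr2 sqr_i mulN1r opprK.
Qed.

Lemma T01P w : T01 R w <->
  z1 (Re_vec w) + 'i * z1 (Im_vec w) = 0 /\ z2 (Re_vec w) + 'i * z2 (Im_vec w) = 0.
Proof.
have E (u v x y : R) : (u +i* x) + 'i * (v +i* y) = (u +i* v) + 'i * (x +i* y).
  by apply: cplx_eq; rewrite !ReImE /=; ring.
rewrite /z1 /z2 !cplxE [X in X = 0 /\ _]E [X in _ /\ X = 0]E !mxE.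
have C (z : R[i]) : Re z +i* Im z = z by case: z.
rewrite !C; split=> [[a _ <-]|[e1 e2]].
  by rewrite !row_mxEl !row_mxEr !mxE; split; rewrite mulrA -expr2 sqr_i mulN1r subrr.
exists (lsubmx w) => //; apply/rowP => k; rewrite -(splitK k).
case: (fintype.split k) => j /=; first by rewrite row_mxEl mxE.
by rewrite row_mxEr !mxE; case: (ord2P j) => ->; apply: mul_i_eq.
Qed.

Lemma T01_crvec w : T01 R w -> w = crvec (z1 (Re_vec w)) (z2 (Re_vec w)).
Proof.
by move=> /T01P[/mul_i_eq e1 /mul_i_eq e2]; rewrite /crvec e1 e2 !pt_z cvec_ReIm.
Qed.

Lemma crvec_T01 a b : T01 R (crvec a b).
Proof.
apply/T01P; rewrite Re_cvec Im_cvec !z1_pt !z2_pt.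
by split; rewrite mulrA -expr2 sqr_i mulN1r subrr.
Qed.

Lemma pt_lin (k : R) a b : k *: pt a b = pt (k%:C * a) (k%:C * b).
Proof.
apply/rowP => j; rewrite mxE -(splitK j); case: (fintype.split j) => l /=.
  by rewrite !row_mxEl !mxE; case: ifP => _; rewrite ReM /= mul0r subr0.
by rewrite !row_mxEr !mxE; case: ifP => _; rewrite ImM /= mul0r addr0.
Qed.

Lemma pt_add a b c d : pt a b + pt c d = pt (a + c) (b + d).
Proof.
apply/rowP => j; rewrite mxE -(splitK j); case: (fintype.split j) => l /=.
  by rewrite !row_mxEl !mxE; case: ifP => _; rewrite ReD.
by rewrite !row_mxEr !mxE; case: ifP => _; rewrite ImD.
Qed.

Lemma pt_opp a b : - pt a b = pt (- a) (- b).
Proof.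
apply/rowP => j; rewrite mxE -(splitK j); case: (fintype.split j) => l /=.
  by rewrite !row_mxEl !mxE; case: ifP => _; rewrite ReN.
by rewrite !row_mxEr !mxE; case: ifP => _; rewrite ImN.
Qed.

Lemma z1D (p q : 'rV[R]_(2 + 2)) : z1 (p + q) = z1 p + z1 q.
Proof. by rewrite -{1}(pt_z p) -{1}(pt_z q) pt_add z1_pt. Qed.
Lemma z2D (p q : 'rV[R]_(2 + 2)) : z2 (p + q) = z2 p + z2 q.
Proof. by rewrite -{1}(pt_z p) -{1}(pt_z q) pt_add z2_pt. Qed.
Lemma z1Z k (p : 'rV[R]_(2 + 2)) : z1 (k *: p) = k%:C * z1 p.
Proof. by rewrite -{1}(pt_z p) pt_lin z1_pt. Qed.
Lemma z2Z k (p : 'rV[R]_(2 + 2)) : z2 (k *: p) = k%:C * z2 p.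
Proof. by rewrite -{1}(pt_z p) pt_lin z2_pt. Qed.

Lemma cvec_scale n (X Y : 'rV[R]_n) (c : R[i]) : c *: cvec X Y =
  cvec (Re c *: X - Im c *: Y) (Re c *: Y + Im c *: X).
Proof. by apply/rowP => j; rewrite !mxE; apply: cplx_eq; rewrite !ReImE /=. Qed.

Lemma crvec_scale c a b : c *: crvec a b = crvec (conjc c * a) (conjc c * b).
Proof.
rewrite /crvec cvec_scale !pt_lin !pt_opp !pt_add; case: c => x y /=.
congr cvec; congr pt; apply: cplx_eq; rewrite !ReImE /=; ring.
Qed.

Lemma crvec_eq0 a b : crvec a b = 0 -> a = 0 /\ b = 0.
Proof.
move=> /(congr1 (@Re_vec R _)); rewrite Re_cvec.
have -> : Re_vec 0 = pt 0 0 :> 'rV[R]_(2 + 2).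
  by apply: z_ext; rewrite ?z1_pt ?z2_pt /z1 /z2 cplxE !mxE.
exact: pt_inj.
Qed.

Section Hypersurface.
Context {N : ambient R (2 + 2)} {i : chart N} (Ni : good_chart i).
Variables (A : set 'rV[R]_(2 + 2)) (a b c d : 'rV[R]_(2 + 2) -> R[i]).
Hypothesis A_tangent : forall q u, A q -> ftangent A q u <->
  exists (k : R[i]) (r : R), u = pt (k * a q + r%:C * c q) (k * b q + r%:C * d q).
Hypothesis A_indep : forall q, A q -> a q * d q - b q * c q != 0.

(** A (0,1) vector X + i J X is tangent exactly when X and J X both are. As (c, d) is transverse to
    the complex line through (a, b), this forces X into that line. *)
Lemma induced_crE q : A q ->
  induced_cr (par N i @` A) i q = cline (crvec (a q) (b q)).
Proof.
move=> Aq; apply/seteqP; split=> w /=.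
  move=> [[/(tangent_par Ni) t1 /(tangent_par Ni) t2] Tw].
  rewrite (T01_crvec Tw) Im_cvec in t2; rewrite (T01_crvec Tw).
  have [k [r e1]] := (A_tangent _ Aq).1 t1; rewrite e1 z1_pt z2_pt in t2 *.
  have [k' [r' /pt_inj[e2 e3]]] := (A_tangent _ Aq).1 t2.
  (* Taking the determinant with (a, b) eliminates k and k' and leaves i r = r' for real r and
     r'. *)
  have e4 : ('i * r%:C - r'%:C) * (a q * d q - b q * c q) = 0.
    rewrite -[LHS]/(_); transitivity (('i * (k * b q + r%:C * d q)) * a q -
      ('i * (k * a q + r%:C * c q)) * b q - ((k' * b q + r'%:C * d q) * a q -
      (k' * a q + r'%:C * c q) * b q)); first by ring.
    by rewrite e2 e3 subrr.
  have /eqP := e4; rewrite mulf_eq0 (negbTE (A_indep Aq)) orbF => /eqP e5.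
  have r0 : r = 0 by have := congr1 (@Im R) e5; rewrite !ReImE /= !mul0r; lra.
  by exists (conjc k) => //; rewrite crvec_scale conjcK r0 !mul0r !addr0.
move=> [k _ <-]; rewrite crvec_scale; split; last exact: crvec_T01.
split; apply/(tangent_par Ni); rewrite ?Re_cvec ?Im_cvec; apply/(A_tangent _ Aq).
  by exists (conjc k), 0; rewrite !mul0r !addr0.
by exists ('i * (conjc k)), 0; rewrite !mul0r !addr0 !mulrA.
Qed.

(** The hypothesis on the bracket says that the Levi form does not degenerate: the bracket of the
    frame X, J X has a nonzero component along the transverse direction (c, d). *)
Lemma cr_hypersurface : submanifold 3 (par N i @` A) ->
  smC setT a -> smC setT b ->
  (forall q, A q -> exists (k : R[i]) (r : R), r != 0 /\
    lie_bracket (fun q => pt (a q) (b q)) (fun q => pt ('i * a q) ('i * b q)) q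
      = pt (k * a q + r%:C * c q) (k * b q + r%:C * d q)) ->
  cr_structure (par N i @` A) (induced_cr (par N i @` A)).
Proof.
move=> sA sa sb lieA; apply: cr_structure_par => // p Ap.
have oT : open (setT : set 'rV[R]_(2 + 2)) by exact: openT.
have si : smC setT (fun _ : 'rV[R]_(2 + 2) => 'i : R[i]) by exact: smC_cst.
exists setT, (fun q => pt (a q) (b q)), (fun q => pt ('i * a q) ('i * b q)); split=> //.
- by split=> // k; exact: Ck_pt.
- by split=> // k; apply: Ck_pt => //; exact: smC_M.
move=> q _ Aq; rewrite induced_crE //; split=> //.
- apply/eqP => /crvec_eq0 [a0 b0]; have := A_indep Aq.
  by rewrite a0 b0 !mul0r subrr eqxx.
- move=> w; rewrite -induced_crE // => -[[t1 t2] _].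
  by split; apply/(tangent_par Ni).
- move=> w; rewrite -induced_crE // => -[_ T1] [_ T2].
  move: T2; rewrite conj_vecE (T01_crvec T1) Re_cvec Im_cvec pt_opp => /T01P.
  rewrite Re_cvec Im_cvec !z1_pt !z2_pt => -[].
  have D (x : R[i]) : x + 'i * - ('i * x) = 0 -> x = 0.
    move/eqP; rewrite mulrN mulrA -expr2 sqr_i mulN1r opprK -mulr2n mulrn_eq0 /=.
    by move/eqP.
  move=> /D -> /D ->; rewrite /crvec mulr0; apply/rowP => j.
  by rewrite !mxE; case: (fintype.split j) => l; rewrite !mxE; case: ifP.
- move=> u /(A_tangent _ Aq) [k [r ->]].
  have [k' [r' [r'0 ->]]] := lieA q Aq.
  (* Subtracting r / r' times the bracket cancels the transverse component of u; m is the
     coefficient of what remains in the complex line. *)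
  pose m := k - (r / r')%:C * k'.
  exists (Re m), (Im m), (r / r').
  have me : (Re m)%:C + (Im m)%:C * 'i = m.
    by apply: cplx_eq; rewrite !ReImE /=; ring.
  have re : (r / r')%:C * r'%:C = r%:C.
    by apply: cplx_eq; rewrite !ReImE /= ?mul0r ?mulr0 ?subr0 ?addr0 // divfK.
  rewrite !pt_lin !pt_add !mulrA -!mulrDl me.
  congr pt; rewrite mulrDr !mulrA re /m; ring.
Qed.

End Hypersurface.
End InducedCR.

Lemma lie_isd (R : realType) n (X Y dX dY : 'rV[R]_n -> 'rV[R]_n) q :
  isd X q dX -> isd Y q dY -> lie_bracket X Y q = dY (X q) - dX (Y q).
Proof.
move=> [_ hX] [_ hY].
exact: (congr2 (fun (f g : 'rV[R]_n -> 'rV[R]_n) => f (X q) - g (Y q)) hY hX).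
Qed.

(** * Hermitian quadrics in C^2 *)

Section HermitianQuadric.
Context {R : realType} (h1 h2 : R) (h12 : R[i]).
Hypothesis h_nondeg : h1%:C * h2%:C - h12 * conjc h12 != 0.

(** The pair ([hrow1], [hrow2]) consists of the derivatives in z1 and z2 of the defining function
    [herm p p], where the hermitian matrix has diagonal h1, h2 and off-diagonal entry h12. *)
Definition hrow1 (p : 'rV[R]_(2 + 2)) : R[i] :=
  h1%:C * conjc (z1 p) + conjc h12 * conjc (z2 p).
Definition hrow2 (p : 'rV[R]_(2 + 2)) : R[i] :=
  h12 * conjc (z1 p) + h2%:C * conjc (z2 p).

Definition herm (p q : 'rV[R]_(2 + 2)) : R :=
  Re (hrow1 p * z1 q + hrow2 p * z2 q).

Lemma hermC p q : herm p q = herm q p.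
Proof.
rewrite /herm /hrow1 /hrow2; case: h12 (z1 p) (z2 p) (z1 q) (z2 q).
by move=> ? ? [? ?] [? ?] [? ?] [? ?] /=; ring.
Qed.

Lemma hermD p q r : herm p (q + r) = herm p q + herm p r.
Proof. by rewrite /herm z1D z2D !mulrDr !ReD addrACA. Qed.

Lemma hermZ k p q : herm p (k *: q) = k * herm p q.
Proof.
rewrite /herm z1Z z2Z; case: (hrow1 p) (hrow2 p) (z1 q) (z2 q).
by move=> ? ? [? ?] [? ?] [? ?]; rewrite !ReImE /=; ring.
Qed.

Lemma herm_real p : hrow1 p * z1 p + hrow2 p * z2 p = (herm p p)%:C.
Proof.
apply: cplx_eq => //; rewrite /hrow1 /hrow2; case: h12 (z1 p) (z2 p).
by move=> ? ? [? ?] [? ?] /=; ring.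
Qed.

Variable W : set 'rV[R]_(2 + 2).
Hypothesis oW : open W.

Definition hquad : set 'rV[R]_(2 + 2) := [set p | herm p p = 1] `&` W.

Lemma isdC_hrow1 p : isdC hrow1 p hrow1.
Proof.
apply: isdC_eq (isdC_D (isdC_M (isdC_cst h1%:C p) (isdC_conj (isdC_z1 p)))
  (isdC_M (isdC_cst (conjc h12) p) (isdC_conj (isdC_z2 p)))) _ _ => // v.
by rewrite !mulr0 !addr0.
Qed.

Lemma isdC_hrow2 p : isdC hrow2 p hrow2.
Proof.
apply: isdC_eq (isdC_D (isdC_M (isdC_cst h12 p) (isdC_conj (isdC_z1 p)))
  (isdC_M (isdC_cst h2%:C p) (isdC_conj (isdC_z2 p)))) _ _ => // v.
by rewrite !mulr0 !addr0.
Qed.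

Lemma smC_isdC (E : normedModType R) (f : E -> R[i]) : (forall x, isdC f x f) ->
  smC (setT : set E) f.
Proof. by move=> h k; split; apply: Ck_isd_lin; try exact: openT; move=> x; have [] := h x. Qed.

(** The kernel of ([hrow1], [hrow2]) is the complex line through (- [hrow2], [hrow1]). The field i p
    generates the circle action, which preserves the form, and it is transverse to that line because
    ([hrow1], [hrow2]) takes the value 1 on p. *)
Lemma hquad_tangent p u : hquad p -> ftangent hquad p u <->
  exists (k : R[i]) (r : R),
    u = pt (k * - hrow2 p + r%:C * ('i * z1 p)) (k * hrow1 p + r%:C * ('i * z2 p)).
Proof.
move=> [pp Wp]; have n1 := herm_real p; rewrite (pp : herm p p = 1) in n1.
rewrite /hquad (@level_tangent R 3 herm hermC hermD hermZ) //.
split=> [pu|[k [r ->]]].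
  pose r := Im (hrow1 p * z1 u + hrow2 p * z2 u).
  have e : hrow1 p * z1 u + hrow2 p * z2 u = r%:C * 'i.
    apply: cplx_eq; last by rewrite [RHS]ImM /= mulr1 mul0r addr0.
    by rewrite [LHS]pu ReM /= mulr0 mul0r subr0.
  pose v1 := z1 u - r%:C * ('i * z1 p); pose v2 := z2 u - r%:C * ('i * z2 p).
  have e0 : hrow1 p * v1 + hrow2 p * v2 = 0.
    transitivity (hrow1 p * z1 u + hrow2 p * z2 u -
      r%:C * 'i * (hrow1 p * z1 p + hrow2 p * z2 p)); first by rewrite /v1 /v2; ring.
    by rewrite e n1 mulr1 subrr.
  have e1 : hrow1 p * v1 = - (hrow2 p * v2) by apply/eqP; rewrite -addr_eq0 e0.
  (* Cramer's rule: the covector kills v and takes the value 1 on p, so v is det(p, v) times (-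
     [hrow2], [hrow1]). *)
  exists (z1 p * v2 - z2 p * v1), r; rewrite -[u in LHS]pt_z.
  have f1 : v1 = (z1 p * v2 - z2 p * v1) * - hrow2 p.
    transitivity (v1 * (hrow1 p * z1 p + hrow2 p * z2 p)); first by rewrite n1 mulr1.
    by rewrite mulrDr mulrA [v1 * _]mulrC e1; ring.
  have f2 : v2 = (z1 p * v2 - z2 p * v1) * hrow1 p.
    transitivity (v2 * (hrow1 p * z1 p + hrow2 p * z2 p)); first by rewrite n1 mulr1.
    have -> : (z1 p * v2 - z2 p * v1) * hrow1 p = z1 p * v2 * hrow1 p - z2 p * (hrow1 p * v1).
      by ring.
    by rewrite e1; ring.
  by rewrite -f1 -f2 /v1 /v2 !subrK.
rewrite /herm z1_pt z2_pt.
have -> : hrow1 p * (k * - hrow2 p + r%:C * ('i * z1 p)) +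
  hrow2 p * (k * hrow1 p + r%:C * ('i * z2 p)) =
  r%:C * 'i * (hrow1 p * z1 p + hrow2 p * z2 p) by ring.
by rewrite n1 mulr1 ReM /= mulr0 mul0r subrr.
Qed.

Lemma hquad_indep p : hquad p ->
  - hrow2 p * ('i * z2 p) - hrow1 p * ('i * z1 p) != 0.
Proof.
move=> [pp _]; have n1 := herm_real p; rewrite (pp : herm p p = 1) in n1.
have -> : - hrow2 p * ('i * z2 p) - hrow1 p * ('i * z1 p) =
  - 'i * (hrow1 p * z1 p + hrow2 p * z2 p) by ring.
by rewrite n1 mulr1 oppr_eq0 eq_complex /= oner_eq0 andbF.
Qed.

Lemma hquad_induced q : hquad q ->
  induced_cr (par (C2 R) tt @` hquad) tt q = cline (crvec (- hrow2 q) (hrow1 q)).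
Proof.
exact: (induced_crE good_C2 hquad_tangent hquad_indep).
Qed.

Lemma hquad_cr : cr_structure (par (C2 R) tt @` hquad) (induced_cr (par (C2 R) tt @` hquad)).
Proof.
apply: (cr_hypersurface good_C2 hquad_tangent hquad_indep).
- exact: (@level_submanifold R 3 herm hermC hermD hermZ (C2 R) tt W good_C2 oW).
- by apply: smC_N; [exact: openT | apply: smC_isdC => x; exact: isdC_hrow2].
- by apply: smC_isdC => x; exact: isdC_hrow1.
move=> q [pp _].
pose D := h1 * h2 - (Re h12 * Re h12 + Im h12 * Im h12).
have DE : h1%:C * h2%:C - h12 * conjc h12 = D%:C.
  by rewrite /D; case: h12 => ? ?; apply: cplx_eq => /=; ring.
(* The field X = (- [hrow2], [hrow1]) is an antilinear map, so [X, i X] = 2 i X(X(p)), and X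
   composed with itself is multiplication by -D, where D is the determinant of the form. *)
exists 0, (- 2 * D); split.
  rewrite mulf_neq0 // ?oppr_eq0 ?pnatr_eq0 //.
  by apply: contra h_nondeg => /eqP D0; rewrite DE D0.
have dX := isd_pt (isdC_N (isdC_hrow2 q)) (isdC_hrow1 q).
have ii x := isdC_cst ('i : R[i]) (x : 'rV[R]_(2 + 2)).
have dY := isd_pt (isdC_M (ii q) (isdC_N (isdC_hrow2 q))) (isdC_M (ii q) (isdC_hrow1 q)).
rewrite (lie_isd dX dY) pt_opp pt_add.
congr pt; rewrite /hrow1 /hrow2 !z1_pt !z2_pt /hrow1 /hrow2 /D.
  case: h12 (z1 q) (z2 q) => ? ? [? ?] [? ?].
  by apply: cplx_eq => /=; ring.
case: h12 (z1 q) (z2 q) => ? ? [? ?] [? ?].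
by apply: cplx_eq => /=; ring.
Qed.

End HermitianQuadric.

Section TwoByTwo.
Context {K : comNzRingType}.
Implicit Types (A B : 'M[K]_2).

Lemma mx2_ext A B : A 0 0 = B 0 0 -> A 0 1 = B 0 1 -> A 1 0 = B 1 0 -> A 1 1 = B 1 1 -> A = B.
Proof.
by move=> h00 h01 h10 h11; apply/matrixP => i j; case: (ord2P i) => ->; case: (ord2P j) => ->.
Qed.

Lemma mul2E m n (A : 'M[K]_(m, 2)) (B : 'M[K]_(2, n)) i j :
  (A *m B) i j = A i 0 * B 0 j + A i 1 * B 1 j.
Proof. by rewrite mxE big_ord_recl big_ord1; congr (_ + _ * _); congr (_ _ _); apply: val_inj. Qed.

Lemma mx22E (a b c d : K) : ((mx22 a b c d 0 0 = a) * (mx22 a b c d 0 1 = b) *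
  (mx22 a b c d 1 0 = c) * (mx22 a b c d 1 1 = d))%type.
Proof. by rewrite !mxE. Qed.

Lemma det2E A : \det A = A 0 0 * A 1 1 - A 0 1 * A 1 0.
Proof.
rewrite (expand_det_row _ 0) big_ord_recl big_ord1 /cofactor !det_mx11 !mxE /=.
rewrite expr0 expr1 mul1r mulN1r mulrN.
by congr (_ * A _ _ - A _ _ * A _ _); apply: val_inj.
Qed.

End TwoByTwo.

Lemma isd_linear_row (R : realType) m n (f : 'rV[R]_m -> 'rV[R]_n) x :
  (forall k u v, f (k *: u + v) = k *: f u + f v) -> isd f x f.
Proof.
move=> lf.
have f0 : f 0 = 0 by have := lf (-1) 0 0; rewrite !scaleN1r oppr0 addr0 addNr.
have fs (I : Type) (s : seq I) (a : I -> R) (F : I -> 'rV[R]_m) :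
  f (\sum_(i <- s) a i *: F i) = \sum_(i <- s) a i *: f (F i).
  by elim: s => [|i s IH]; rewrite ?big_nil // !big_cons lf IH.
apply/isd_rowP => j.
have fE y : f y 0 j = \sum_k f (delta_mx 0 k) 0 j * y 0 k.
  by rewrite {1}(row_sum_delta y) fs summxE; apply: eq_bigr => k _; rewrite mxE mulrC.
apply: isd_eq (isd_sum _ (fun k => isdM (isd_cst (f (delta_mx 0 k) 0 j) x) (isd_coord x k))) _ _.
  by move=> y; rewrite fE.
by move=> y; rewrite fE; apply: eq_bigr => k _; rewrite mulr0 addr0.
Qed.

(** * SL_2(R) as a quadric, with its left-invariant CR structures *)

Section SL2.
Context {R : realType}.
Implicit Types (p q u : 'rV[R]_(2 * 2)).

(** The polarisation of det, which makes SL_2(R) a level set of a quadratic form, so that the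
    quadric charts apply. *)
Definition detb p q : R := (vec_mx p 0 0 * vec_mx q 1 1 + vec_mx q 0 0 * vec_mx p 1 1
  - vec_mx p 0 1 * vec_mx q 1 0 - vec_mx q 0 1 * vec_mx p 1 0) / 2.

Lemma detbC p q : detb p q = detb q p.
Proof. by rewrite /detb; ring. Qed.
Lemma detbD p q u : detb p (q + u) = detb p q + detb p u.
Proof. by rewrite /detb linearD !mxE; ring. Qed.
Lemma detbZ k p q : detb p (k *: q) = k * detb p q.
Proof. by rewrite /detb linearZ !mxE; ring. Qed.
Lemma detbE p : detb p p = \det (vec_mx p).
Proof. by rewrite /detb det2E; field. Qed.

Definition sl2W (W : set 'rV[R]_(2 * 2)) : set 'rV[R]_(2 * 2) :=
  [set p | detb p p = 1] `&` W.

Lemma sl2W_det W p : sl2W W p -> \det (vec_mx p) = 1.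
Proof. by case; rewrite /= detbE. Qed.

Lemma SL2_par : SL2 R = par (M2R R) tt @` (sl2W setT).
Proof.
apply/seteqP; split=> [g dg|g [p [dp _] <-]]; last by rewrite /SL2 /= -detbE.
exists (mxvec g); last by rewrite /= mxvecK.
by split=> //; rewrite /= detbE mxvecK.
Qed.

Lemma sl2_tangent W p u : open W -> sl2W W p -> ftangent (sl2W W) p u <-> detb p u = 0.
Proof. by move=> oW [pp Wp]; exact: (@level_tangent R 3 detb detbC detbD detbZ). Qed.

Lemma adj2_mul (g u : 'M[R]_2) : \det g = 1 ->
  u = g *m (mx22 (g 1 1) (- g 0 1) (- g 1 0) (g 0 0) *m u).
Proof.
rewrite det2E => dg; rewrite mulmxA.
suff -> : g *m mx22 (g 1 1) (- g 0 1) (- g 1 0) (g 0 0) = 1%:M by rewrite mul1mx.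
by apply: mx2_ext; rewrite mul2E !mx22E !mxE /= -?dg; ring.
Qed.

Lemma sl2_tangent_mul p u : \det (vec_mx p) = 1 -> detb p u = 0 ->
  exists a b c : R, u = mxvec (vec_mx p *m mx22 a b c (- a)).
Proof.
move=> dp pu; pose g : 'M[R]_2 := vec_mx p; pose v : 'M[R]_2 := vec_mx u.
pose x := mx22 (g 1 1) (- g 0 1) (- g 1 0) (g 0 0) *m v.
exists (x 0 0), (x 0 1), (x 1 0); apply: (can_inj vec_mxK); rewrite mxvecK.
rewrite {1}(adj2_mul (vec_mx u) dp); congr (_ *m _).
apply: mx2_ext; rewrite ?mx22E //.
apply/eqP; rewrite -addr_eq0; apply/eqP.
rewrite /x !mul2E !mx22E /g /v.
transitivity (2 * detb p u); last by rewrite pu mulr0.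
by rewrite /detb; field.
Qed.

(** The left-invariant vector field with value M at the identity, extended linearly to all of
    M_2(R). *)
Definition mulr_vec (M : 'M[R]_2) p : 'rV[R]_(2 * 2) := mxvec (vec_mx p *m M).

Lemma isd_mulr_vec M p : isd (mulr_vec M) p (mulr_vec M).
Proof.
by apply: isd_linear_row => k u v; rewrite /mulr_vec linearP mulmxDl -scalemxAl linearP.
Qed.

Lemma mulr_vecD M N x y p :
  x *: mulr_vec M p + y *: mulr_vec N p = mulr_vec (x *: M + y *: N) p.
Proof. by rewrite /mulr_vec mulmxDr -!scalemxAr linearD !linearZ. Qed.

Lemma mulr_vecB M N p : mulr_vec M p - mulr_vec N p = mulr_vec (M - N) p.
Proof. by rewrite /mulr_vec mulmxBr linearB. Qed.

Lemma mulr_vecA M N p : mulr_vec M p + mulr_vec N p = mulr_vec (M + N) p.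
Proof. by rewrite /mulr_vec mulmxDr linearD. Qed.

Lemma mulr_vecZ a M p : a *: mulr_vec M p = mulr_vec (a *: M) p.
Proof. by rewrite /mulr_vec -scalemxAr linearZ. Qed.

Lemma mulr_vec_comp M N p : mulr_vec M (mulr_vec N p) = mulr_vec (N *m M) p.
Proof. by rewrite /mulr_vec mxvecK mulmxA. Qed.

Lemma mulr_vec_tangent W p a b c : open W -> sl2W W p ->
  ftangent (sl2W W) p (mulr_vec (mx22 a b c (- a)) p).
Proof.
move=> oW sp; apply/(sl2_tangent _ oW sp).
by rewrite /detb /mulr_vec !mxvecK !mul2E !mx22E; ring.
Qed.

(* L_t = Lre t + i Lim t. *)
Definition Lre (t : R) : 'M[R]_2 := mx22 0 t 1 0.
Definition Lim (t : R) : 'M[R]_2 := mx22 ((1 + t) / 2) 0 0 (- ((1 + t) / 2)).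

Lemma V_E t p : V_ t tt p = cline (cvec (mulr_vec (Lre t) p) (mulr_vec (Lim t) p)).
Proof.
congr cline; apply/rowP => k; case/mxvec_indexP: k => i j.
rewrite mxvecE mul2E [RHS]mxE !mxvecE !mul2E.
by case: (ord2P i) => ->; case: (ord2P j) => ->; rewrite !mxE /=; apply: cplx_eq => /=; ring.
Qed.

Lemma V_tangent t W p w : open W -> sl2W W p -> V_ t tt p w ->
  ftangent (sl2W W) p (Re_vec w) /\ ftangent (sl2W W) p (Im_vec w).
Proof.
move=> oW sp; rewrite V_E => -[k _ <-]; rewrite cvec_scale Re_cvec Im_cvec.
have lin x y : x *: mulr_vec (Lre t) p + y *: mulr_vec (Lim t) p = mulr_vec
    (mx22 (y * ((1 + t) / 2)) (x * t) x (- (y * ((1 + t) / 2)))) p.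
  rewrite mulr_vecD; congr mulr_vec.
  by apply: mx2_ext; rewrite !mxE /=; ring.
by split; rewrite -?scaleNr ?[_ + Im k *: _]addrC lin; exact: mulr_vec_tangent.
Qed.

(** For linear fields the bracket is the matrix commutator, and [[Lre], [Lim]] = (1 + t) (0, -t; 1,
    0). Together with [Lre] = (0, t; 1, 0) and the diagonal [Lim] it spans sl_2(R) because t and 1 +
    t are nonzero. *)
Lemma SL2_cr t : t != 0 -> t != -1 -> cr_structure (SL2 R) (V_ t).
Proof.
move=> t0 t1; have oT : open (setT : set 'rV[R]_(2 * 2)) by exact: openT.
have k0 : (1 + t) / 2 != 0.
  by rewrite mulf_neq0 ?invr_neq0 ?pnatr_eq0 // addrC addr_eq0.
rewrite SL2_par; apply: (cr_structure_par good_M2R).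
  exact: (@level_submanifold R 3 detb detbC detbD detbZ _ _ _ good_M2R oT).
move=> p sp; exists setT, (mulr_vec (Lre t)), (mulr_vec (Lim t)).
have sm M : smooth setT (mulr_vec M).
  by split=> // k; apply: Ck_isd_lin => // x; exact: isd_mulr_vec.
split=> // q _ sq; have dq := sl2W_det sq.
have inj (M : 'M[R]_2) : mulr_vec M q = 0 -> M = 0.
  move/(congr1 (@vec_mx R 2 2)); rewrite mxvecK linear0 => e.
  have : vec_mx q \in unitmx by rewrite unitmxE dq unitr1.
  by move=> u; rewrite -(mulKmx u M) e mulmx0.
split.
- apply/eqP => /(congr1 (@Re_vec R _)); rewrite Re_cvec => e.
  have /inj/matrixP/(_ 1 0) : mulr_vec (Lre t) q = 0.
    by rewrite e; apply/rowP => j; rewrite !mxE.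
  by rewrite !mxE => /eqP; rewrite oner_eq0.
- exact: V_E.
- by move=> w; exact: V_tangent.
- move=> w; rewrite V_E => -[[x y] _ ew] [[x' y'] _].
  rewrite conj_vecE -ew !cvec_scale Re_cvec Im_cvec => e.
  have lin a b : a *: mulr_vec (Lre t) q + b *: mulr_vec (Lim t) q = 0 -> a = 0 /\ b = 0.
    rewrite mulr_vecD => /inj e0.
    have := congr1 (fun M : 'M[R]_2 => M 1 0) e0; have := congr1 (fun M : 'M[R]_2 => M 0 0) e0.
    rewrite !mxE /= !mulr0 mulr1 add0r addr0 => /eqP; rewrite mulf_eq0 (negbTE k0) orbF.
    by move/eqP.
  have := congr1 (@Re_vec R _) e; have := congr1 (@Im_vec R _) e.
  rewrite !Re_cvec !Im_cvec /= => e2 e1.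
  have [f1 f2] : x' - x = 0 /\ - y' + y = 0.
    apply: lin; apply/rowP => j; have := congr1 (fun v : 'rV[R]_(2 * 2) => v 0 j) e1.
    by rewrite !mxE; lra.
  have [f3 f4] : y' + y = 0 /\ x' + x = 0.
    apply: lin; apply/rowP => j; have := congr1 (fun v : 'rV[R]_(2 * 2) => v 0 j) e2.
    by rewrite !mxE; lra.
  have -> : x = 0 by lra.
  have -> : y = 0 by lra.
  rewrite !scale0r subrr addr0 /cvec; apply/rowP => j; rewrite !mxE.
  by apply: cplx_eq.
- move=> u /(sl2_tangent _ oT sq) pu.
  have [a [b [c ->]]] := sl2_tangent_mul dq pu.
  exists ((c + b / t) / 2), (a / ((1 + t) / 2)), ((c - b / t) / (4 * ((1 + t) / 2))).
  rewrite (lie_isd (isd_mulr_vec _ _) (isd_mulr_vec _ _)) !mulr_vec_comp mulr_vecD.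
  rewrite mulr_vecB mulr_vecZ mulr_vecA; congr mulr_vec.
  have -> : Lre t *m Lim t - Lim t *m Lre t = mx22 0 (- ((1 + t) * t)) (1 + t) 0.
    by apply: mx2_ext; rewrite [LHS]mxE [X in _ + X = _]mxE !mul2E !mx22E; field.
  have t1' : 1 + t != 0 by rewrite addrC addr_eq0.
  by apply: mx2_ext; rewrite !mxE /=; field; rewrite ?t0 ?t1'.
Qed.

End SL2.

(** * Pushing tangent vectors and CR lines forward *)

Section PushForward.
Context {R : realType}.

Lemma ftangent_map m n (A : set 'rV[R]_m) (B : set 'rV[R]_n) U F p u :
  smooth U F -> U p -> (forall q, A q -> B (F q)) ->
  ftangent A p u -> ftangent B (F p) ('d F p u).
Proof.
move=> sF Up FAB [D [c [D0 sc cA c0 dc]]].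
exists (D `&` c @^-1` U), (fun s => F (c s)); split.
- by split=> //=; rewrite c0.
- exact: smooth_comp.
- by move=> s [Ds _]; apply: FAB; apply: cA.
- by rewrite c0.
- have Uc : U (c 0) by rewrite c0.
  have [_ e] := isd_comp (smooth_diff sc D0) (smooth_diff sF Uc).
  by have := congr1 (fun f : R -> 'rV[R]_n => f 1) e; rewrite dc c0.
Qed.

(** The identity G (F q) = q holds only on A, which need not be open, so it is differentiated along
    a curve contained in A. *)
Lemma diff_inverse m n (A : set 'rV[R]_m) U F W (G : 'rV[R]_n -> 'rV[R]_m) p u :
  smooth U F -> U p -> smooth W G -> W (F p) -> (forall q, A q -> G (F q) = q) ->
  ftangent A p u -> 'd G (F p) ('d F p u) = u.
Proof.
move=> sF Up sG Wp GF [D [c [D0 sc cA c0 dc]]].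
have Uc : U (c 0) by rewrite c0.
have Wc : W (F (c 0)) by rewrite c0.
have h := isd_comp (isd_comp (smooth_diff sc D0) (smooth_diff sF Uc)) (smooth_diff sG Wc).
have [_ e] := diff_near_eq (f := c) (g := fun s => G (F (c s)))
  (open_near sc.1 D0 (fun s Ds => esym (GF _ (cA s Ds)))) (smooth_diff sc D0).1.
have := congr1 (fun f : R -> 'rV[R]_m => f 1) (etrans (esym h.2) e).
by rewrite dc c0.
Qed.

Lemma cline_scale n (k : R[i]) (w : 'rV[R[i]]_n) : k != 0 -> cline (k *: w) = cline w.
Proof.
move=> k0; apply/seteqP; split=> x [c _ <-] /=.
  by exists (c * k) => //; rewrite scalerA.
by exists (c / k) => //; rewrite scalerA divfK.
Qed.

Lemma diffC_scale m n (F : 'rV[R]_m -> 'rV[R]_n) p c w :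
  diffC F p (c *: w) = c *: diffC F p w.
Proof.
rewrite -{1}(cvec_ReIm w) /diffC !cvec_scale Re_cvec Im_cvec.
by rewrite !linearD linearN !linearZ.
Qed.

(** The image of w is tangent and of type (0,1), hence lies in the induced line, and the inverse G
    shows that it is nonzero; two complex lines sharing a nonzero vector agree. Taking B inside a
    larger B' lets a local inverse suffice. *)
Lemma push_cline m (A : set 'rV[R]_m) (N : ambient R (2 + 2)) (i : chart N)
    (B B' : set 'rV[R]_(2 + 2)) F G p w v :
  good_chart i -> fdiffeo A B F G -> A p -> B `<=` B' ->
  ftangent A p (Re_vec w) -> ftangent A p (Im_vec w) -> w != 0 ->
  T01 R (diffC F p w) -> induced_cr (par N i @` B') i (F p) = cline v ->
  induced_cr (par N i @` B') i (F p) = [set diffC F p x | x in cline w].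
Proof.
move=> Ni [[U AU sF] [[W BW sG] [FB GA]]] Ap BB' tR tI w0 Tw Iv.
have Up : U p by exact: AU.
have FAB' q : A q -> B' (F q) by move=> /FB[/BB'].
have : induced_cr (par N i @` B') i (F p) (diffC F p w).
  split=> //; split; apply/(tangent_par Ni).
    by rewrite Re_cvec; apply: (ftangent_map sF Up FAB').
  by rewrite Im_cvec; apply: (ftangent_map sF Up FAB').
rewrite Iv => -[k _ kv].
have Wp : W (F p) by apply: BW; have [] := FB p Ap.
have GF q : A q -> G (F q) = q by move=> /FB[].
have k0 : k != 0.
  apply: contra w0 => /eqP k0; move: kv; rewrite k0 scale0r => e.
  have dR : 'd F p (Re_vec w) = 0.
    by rewrite -[LHS](Re_cvec _ ('d F p (Im_vec w))) -/(diffC F p w) -e; apply/rowP => j; rewrite !mxE.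
  have dI : 'd F p (Im_vec w) = 0.
    by rewrite -[LHS](Im_cvec ('d F p (Re_vec w))) -/(diffC F p w) -e; apply/rowP => j; rewrite !mxE.
  have := diff_inverse sF Up sG Wp GF tR; have := diff_inverse sF Up sG Wp GF tI.
  rewrite dR dI linear0 => eI eR.
  by rewrite -(cvec_ReIm w) -eI -eR; apply/eqP/rowP => j; rewrite !mxE.
rewrite -(cline_scale v k0) kv; apply/seteqP; split=> x.
  by move=> [c _ <-]; exists (c *: w); [exists c | rewrite diffC_scale].
by move=> [_ [c _ <-] <-]; exists c => //; rewrite diffC_scale.
Qed.

End PushForward.

(** * Cauchy-Riemann calculus along a complex vector *)

Section Annihilation.
Context {R : realType} {m : nat}.
Implicit Types (f g : 'rV[R]_m -> R[i]) (p : 'rV[R]_m) (w : 'rV[R[i]]_m).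

(* The complexified derivative of f in the direction w vanishes; this is the
   Cauchy-Riemann condition on f when w is a (0,1) vector. *)
Definition ann f p w := exists2 df, isdC f p df & df (Re_vec w) + 'i * df (Im_vec w) = 0.

Lemma ann_cst a p w : ann (fun=> a) p w.
Proof. by exists (fun=> 0); [exact: isdC_cst | rewrite mulr0 addr0]. Qed.

Lemma ann_D f g p w : ann f p w -> ann g p w -> ann (fun q => f q + g q) p w.
Proof.
move=> [df f1 f2] [dg g1 g2]; exists (fun v => df v + dg v); first exact: isdC_D.
by rewrite mulrDr addrACA f2 g2 addr0.
Qed.

Lemma ann_N f p w : ann f p w -> ann (fun q => - f q) p w.
Proof.
move=> [df f1 f2]; exists (fun v => - df v); first exact: isdC_N.
by rewrite mulrN -opprD f2 oppr0.
Qed.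

Lemma ann_M f g p w : ann f p w -> ann g p w -> ann (fun q => f q * g q) p w.
Proof.
move=> [df f1 f2] [dg g1 g2]; exists (fun v => f p * dg v + g p * df v).
  exact: isdC_M.
transitivity (f p * (dg (Re_vec w) + 'i * dg (Im_vec w)) +
  g p * (df (Re_vec w) + 'i * df (Im_vec w))); first by ring.
by rewrite f2 g2 !mulr0 addr0.
Qed.

Lemma ann_V f p w : f p != 0 -> ann f p w -> ann (fun q => (f q)^-1) p w.
Proof.
move=> fp [df f1 f2]; exists (fun v => - ((f p)^-1 * (f p)^-1 * df v)).
  exact: isdC_V.
transitivity (- ((f p)^-1 * (f p)^-1 * (df (Re_vec w) + 'i * df (Im_vec w)))); first by ring.
by rewrite f2 mulr0 oppr0.
Qed.

Lemma T01_ann f g p w : ann f p w -> ann g p w ->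
  T01 R (diffC (fun q => pt (f q) (g q)) p w).
Proof.
move=> [df f1 f2] [dg g1 g2]; have [_ h] := isd_pt f1 g1; apply/T01P.
have e v : 'd (fun q => pt (f q) (g q)) p v = pt (df v) (dg v).
  exact: (congr1 (fun F => F v) h).
by rewrite Re_cvec Im_cvec !e !z1_pt !z2_pt.
Qed.

End Annihilation.

Ltac known := match goal with H : ?A |- ?B => constr_eq A B; exact H end.

(** Recursion on the arithmetic expression. Inverses are looked up among the hypotheses, since they
    depend on a denominator being nonzero. *)
Ltac smc := first [ known | match goal with
  | |- open _ => first [exact: openT | assumption]
  | |- smC ?U (fun y => ?f y) => change (smC U f); known
  | H : smC _ (fun y => (@?f y)^-1) |- smC _ (fun y => (@?g y)^-1) => exact: H
  | |- smC _ (fun y => @?f y + @?g y) => apply: (@smC_D _ _ _ f g); smc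
  | |- smC _ (fun y => - @?f y) => apply: (@smC_N _ _ _ f); smc
  | |- smC _ (fun y => @?f y * @?g y) => apply: (@smC_M _ _ _ f g); smc
  | |- smC _ (fun y => ?c) => exact: smC_cst
  end ].

Ltac annt := first [ known | match goal with
  | |- ann (fun y => ?f y) ?p ?w => change (ann f p w); known
  | H : ann (fun y => (@?f y)^-1) _ _ |- ann (fun y => (@?g y)^-1) _ _ => exact: H
  | |- ann (fun y => @?f y + @?g y) _ _ => apply: (@ann_D _ _ f g); annt
  | |- ann (fun y => - @?f y) _ _ => apply: (@ann_N _ _ f); annt
  | |- ann (fun y => @?f y * @?g y) _ _ => apply: (@ann_M _ _ f g); annt
  | |- ann (fun y => ?c) _ _ => exact: ann_cst
  end ].

(** * CR functions of V_1 *)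

Section Zeta.
Context {R : realType}.

(* The coordinates of g v0 for v0 = (1, -i); they are CR functions for V_1
   because L_1 v0 = 0. *)
Definition zeta1 (p : 'rV[R]_(2 * 2)) : R[i] := vec_mx p 0 0 +i* (- vec_mx p 0 1).
Definition zeta2 (p : 'rV[R]_(2 * 2)) : R[i] := vec_mx p 1 0 +i* (- vec_mx p 1 1).
Definition of_zeta (x y : R[i]) : 'rV[R]_(2 * 2) :=
  mxvec (mx22 (Re x) (- Im x) (Re y) (- Im y)).

Lemma zeta1K x y : zeta1 (of_zeta x y) = x.
Proof. by rewrite /zeta1 /of_zeta mxvecK !mx22E opprK; case: x. Qed.
Lemma zeta2K x y : zeta2 (of_zeta x y) = y.
Proof. by rewrite /zeta2 /of_zeta mxvecK !mx22E opprK; case: y. Qed.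
Lemma of_zetaK p : of_zeta (zeta1 p) (zeta2 p) = p.
Proof.
apply: (can_inj vec_mxK); rewrite /of_zeta mxvecK.
by apply: mx2_ext; rewrite mx22E /= ?opprK.
Qed.

Lemma isd_entry (p : 'rV[R]_(2 * 2)) i j : isd (fun q : 'rV[R]_(2 * 2) => vec_mx q i j) p (fun v => vec_mx v i j).
Proof. by apply: isd_eq (isd_coord p (mxvec_index i j)) _ _ => q; rewrite mxE. Qed.

Lemma isdC_zeta1 p : isdC zeta1 p zeta1.
Proof. by split; [exact: isd_entry | apply: isdN; exact: isd_entry]. Qed.
Lemma isdC_zeta2 p : isdC zeta2 p zeta2.
Proof. by split; [exact: isd_entry | apply: isdN; exact: isd_entry]. Qed.

Lemma Ck_of_zeta (E : normedModType R) k (U : set E) (f g : E -> R[i]) : open U ->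
  smC U f -> smC U g -> Ck k U (fun y => of_zeta (f y) (g y)).
Proof.
move=> oU hf hg; have [f1 f2] := hf k; have [g1 g2] := hg k; apply/Ck_rowP => // l.
case/mxvec_indexP: l => i j; case: (ord2P i) => ->; case: (ord2P j) => ->.
- by apply: Ck_eq f1 => // y _; rewrite mxvecE mx22E.
- by apply: Ck_eq (CkN oU f2) => // y _; rewrite mxvecE mx22E.
- by apply: Ck_eq g1 => // y _; rewrite mxvecE mx22E.
- by apply: Ck_eq (CkN oU g2) => // y _; rewrite mxvecE mx22E.
Qed.

Lemma ann_zeta p :
  (ann zeta1 p (cvec (mulr_vec (Lre 1) p) (mulr_vec (Lim 1) p))) /\
  (ann zeta2 p (cvec (mulr_vec (Lre 1) p) (mulr_vec (Lim 1) p))).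
Proof.
split; [exists zeta1; first exact: isdC_zeta1 | exists zeta2; first exact: isdC_zeta2];
  rewrite Re_cvec Im_cvec /zeta1 /zeta2 /mulr_vec !mxvecK !mul2E !mx22E;
  by apply: cplx_eq => /=; field.
Qed.

Lemma cvec_eq0 n (X Y : 'rV[R]_n) : cvec X Y = 0 -> X = 0 /\ Y = 0.
Proof.
move=> e; split; [rewrite -(Re_cvec X Y) e | rewrite -(Im_cvec X Y) e];
  by apply/rowP => j; rewrite !mxE.
Qed.

Lemma V_vec_neq0 (t : R) p : \det (vec_mx p) = 1 ->
  cvec (mulr_vec (Lre t) p) (mulr_vec (Lim t) p) != 0.
Proof.
move=> dp; apply/eqP => /cvec_eq0 [/(congr1 (@vec_mx R 2 2)) e _].
move: e; rewrite mxvecK linear0 => /matrixP e; have := e 0 0; have := e 1 0.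
rewrite !mul2E !mx22E !mxE !mulr0 !mulr1 !add0r => e1 e2.
by move: dp; rewrite det2E !mxE e1 e2 mulr0 mul0r subrr => /eqP; rewrite eq_sym oner_eq0.
Qed.

End Zeta.

Section FromSL2.
Context {R : realType}.

(** If both complex components of a diffeomorphism are killed by the generator of V_t, the image of
    that generator is of type (0,1), and [push_cline] identifies the image line with the induced
    structure. *)
Lemma SL2_cr_equiv (t : R) (B : set 'rV[R]_(2 + 2)) (f g : 'rV[R]_(2 * 2) -> R[i]) G :
  t != 0 -> t != -1 ->
  cr_structure (par (C2 R) tt @` B) (induced_cr (par (C2 R) tt @` B)) ->
  (forall q, B q -> exists v, induced_cr (par (C2 R) tt @` B) tt q = cline v) ->
  fdiffeo (sl2W setT) B (fun p => pt (f p) (g p)) G ->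
  (forall p, sl2W setT p -> ann f p (cvec (mulr_vec (Lre t) p) (mulr_vec (Lim t) p)) /\
                  ann g p (cvec (mulr_vec (Lre t) p) (mulr_vec (Lim t) p))) ->
  cr_equivalent (SL2 R) (V_ t) (par (C2 R) tt @` B) (induced_cr (par (C2 R) tt @` B)).
Proof.
move=> t0 t1 crB lB dif an; split=> //; first exact: SL2_cr.
pose F p := pt (f p) (g p).
exists (lift_chart (N1 := M2R R) (N2 := C2 R) (i := tt) (j := tt) F).
rewrite SL2_par; have lF p : lift_chart (N1 := M2R R) (N2 := C2 R) (i := tt) (j := tt) F
  (par (M2R R) tt p) = par (C2 R) tt (F p) by exact: lift_chartE good_M2R _ _.
split; first exact: (diffeo_par good_M2R good_C2 dif (fun p _ => lF p)).
have [[U AU sF] [_ [FB _]]] := dif.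
apply: (pushes_forward_par good_M2R AU sF) => [p _|p sp]; first exact: lF.
have [v Iv] := lB _ (FB p sp).1.
have [a1 a2] := an p sp.
rewrite V_E; apply: (push_cline good_C2 dif sp (@subset_refl _ B) _ _ _ _ Iv).
- rewrite Re_cvec; have := @mulr_vec_tangent R setT p 0 t 1 openT sp.
  by rewrite oppr0.
- rewrite Im_cvec.
  exact: (@mulr_vec_tangent R setT p ((1 + t) / 2) 0 0 openT sp).
- exact: V_vec_neq0 (sl2W_det sp).
- exact: T01_ann.
Qed.

Lemma smC_zeta1 : smC setT (@zeta1 R).
Proof. by apply: smC_isdC => x; exact: isdC_zeta1. Qed.
Lemma smC_zeta2 : smC setT (@zeta2 R).
Proof. by apply: smC_isdC => x; exact: isdC_zeta2. Qed.

End FromSL2.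

(** * The three-dimensional orbits in C^2 *)

Section OrbitC2.
Context {R : realType} (v : 'cV[R[i]]_2).

Let v1 := v 0 0.
Let v2 := v 1 0.
(** The area spanned by the real and imaginary parts of v, equal to Im(conj v1 v2). SL_2(R)
    preserves it. *)
Let d := Re v1 * Im v2 - Im v1 * Re v2.

(** Chosen so that 2 Re(h12 conj z1 z2) = Im(conj z1 z2) / d, which is 1 on the orbit of v. *)
Let h12 : R[i] := 0 +i* (- (2 * d)^-1).

Lemma herm_orbit (p : 'rV[R]_(2 + 2)) : herm 0 0 h12 p p =
  (Re (z1 p) * Im (z2 p) - Im (z1 p) * Re (z2 p)) / d.
Proof.
rewrite /herm /hrow1 /hrow2 /h12 invfM; move: d^-1; case: (z1 p) (z2 p) => ? ? [? ?] /= ?.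
by field.
Qed.

Hypothesis d0 : d != 0.

Lemma orbit_C2_par : orbit_C2 v = par (C2 R) tt @` hquad 0 0 h12 setT.
Proof.
apply/seteqP; split=> z.
  move=> [g dg <-]; rewrite /SL2 /= det2E in dg.
  exists (pt ((g 0 0)%:C * v1 + (g 0 1)%:C * v2) ((g 1 0)%:C * v1 + (g 1 1)%:C * v2)).
    split=> //; rewrite /= herm_orbit z1_pt z2_pt.
    apply: (mulIf d0); rewrite divfK // mul1r -[RHS]mul1r -dg /d.
    by case: v1 v2 => ? ? [? ?] /=; ring.
  rewrite par_C2 z1_pt z2_pt; apply/colP => k; rewrite mul2E !mxE.
  by case: (ord2P k) => ->.
move=> [p [hp _] <-]; rewrite /= herm_orbit in hp.
have {hp} hp : Re (z1 p) * Im (z2 p) - Im (z1 p) * Re (z2 p) = d.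
  by rewrite -[RHS]mul1r -hp divfK.
rewrite par_C2; case: (z1 p) (z2 p) hp => x1 y1 [x2 y2] /= hp.
(* Cramer's rule for the real matrix sending Re v and Im v to the real and imaginary parts of the
   given point. Its determinant is a quotient of equal areas. *)
pose g : 'M[R]_2 := mx22 ((x1 * Im v2 - y1 * Re v2) / d)
  ((y1 * Re v1 - x1 * Im v1) / d)
  ((x2 * Im v2 - y2 * Re v2) / d)
  ((y2 * Re v1 - x2 * Im v1) / d).
exists g.
  rewrite /SL2 /= det2E !mx22E.
  transitivity ((x1 * y2 - y1 * x2) *
      (Re v1 * Im v2 - Im v1 * Re v2) / (d * d)).
    by field.
  by rewrite hp -/d divff // mulf_neq0.
apply/colP => k; rewrite mul2E !mxE.
have := d0; rewrite -/v1 -/v2 /d; case: (v1) (v2) => a b [a' b'] /= d0'.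
by case: (ord2P k) => -> /=; apply: cplx_eq => /=; field.
Qed.

Lemma orbit_C2_nondeg_cr : cr_equivalent (SL2 R) (V_ 1) (orbit_C2 v) (induced_cr (orbit_C2 v)).
Proof.
rewrite orbit_C2_par.
have hn : 0%:C * 0%:C - h12 * conjc h12 != 0.
  rewrite mul0r sub0r oppr_eq0 mulf_neq0 // eq_complex /= eqxx /= ?opprK ?oppr_eq0;
    by rewrite invr_eq0 mulf_neq0 ?pnatr_eq0.
have oT : open (setT : set 'rV[R]_(2 + 2)) by exact: openT.
(* In general this is not the orbit map g -> g v but g -> A g (1, -i), where A is the real matrix
   sending (1, -i) to v. Its components are combinations of [zeta1] and [zeta2], hence CR for V_1.
   As det A = -d and Im(conj z1 z2) = -1 at (1, -i), the image is the level d, the orbit of v. *)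
pose f p := (Re v1)%:C * zeta1 p - (Im v1)%:C * zeta2 p.
pose g p := (Re v2)%:C * zeta1 p - (Im v2)%:C * zeta2 p.
pose G q := of_zeta (((Im v2)%:C * z1 q - (Im v1)%:C * z2 q) * (d^-1)%:C)
  (((Re v2)%:C * z1 q - (Re v1)%:C * z2 q) * (d^-1)%:C).
apply: (@SL2_cr_equiv _ 1 _ f g G).
- exact: oner_neq0.
- by apply/eqP => h; lra.
- exact: hquad_cr.
- by move=> q hq; eexists; exact: hquad_induced hq.
- have oTs n : open (setT : set 'rV[R]_n) by exact: openT.
  split.
    have sz1 := @smC_zeta1 R; have sz2 := @smC_zeta2 R.
    have sf : smC setT f by rewrite /f; smc.
    have sg : smC setT g by rewrite /g; smc.
    by exists setT => //; split=> // k; exact: Ck_pt.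
  split.
    pose A : set 'rV[R]_(2 + 2) := setT; have oA : open A by exact: openT.
    have s1 : smC A (@z1 R) by exact: smC_z1.
    have s2 : smC A (@z2 R) by exact: smC_z2.
    by exists A => //; split=> // k; apply: Ck_of_zeta => //; smc.
  split=> [p /sl2W_det dp|q [hq _]].
    split; last first.
      rewrite /G z1_pt z2_pt /f /g -[RHS]of_zetaK; have := d0; rewrite /d.
      case: (v1) (v2) (zeta1 p) (zeta2 p) => ? ? [? ?] [? ?] [? ?] /= d0'.
      by congr of_zeta; apply: cplx_eq => /=; field.
    split=> //; rewrite /= herm_orbit z1_pt z2_pt.
    apply: (mulIf d0); rewrite divfK // mul1r -[RHS]mul1r -dp det2E /f /g /zeta1 /zeta2 /d.
    case: (v1) (v2) => ? ? [? ?] /=; ring.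
  have FG : pt (f (G q)) (g (G q)) = q.
    rewrite /f /g /G zeta1K zeta2K -[RHS]pt_z; have := d0; rewrite /d.
    case: (v1) (v2) (z1 q) (z2 q) => ? ? [? ?] [? ?] [? ?] /= d0'.
    by congr pt; apply: cplx_eq => /=; field.
  split=> //; split=> //; rewrite /= detbE det2E /G /of_zeta mxvecK !mx22E.
  move: hq; rewrite /= herm_orbit; have := d0; rewrite /d.
  case: (v1) (v2) (z1 q) (z2 q) => a b [a' b'] [x1 y1] [x2 y2] /= d0' e.
  by rewrite -[RHS]e; field.
- by move=> p _; have [a1 a2] := ann_zeta p; split; [rewrite /f | rewrite /g]; annt.
Qed.

End OrbitC2.

(** * Degenerate orbits in C^2 are not 3-manifolds *)

Section Degenerate.
Context {R : realType}.

Lemma no_linear_retract (f : {linear 'rV[R]_3 -> 'rV[R]_2}) (g : {linear 'rV[R]_2 -> 'rV[R]_3}) :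
  ~ forall x, g (f x) = x.
Proof.
move=> gf; have : (3 <= 2)%N; last by [].
apply: (@mulmx1_min _ 3 2 (lin1_mx f) (lin1_mx g)).
by apply/row_matrixP => i; rewrite !rowE mulmx1 mulmxA !mul_rV_lin1 gf.
Qed.

Lemma isd_pt_real (z : R[i]) (x : 'rV[R]_2) :
  isd (fun y : 'rV[R]_2 => pt (z * (y 0 0)%:C) (z * (y 0 1)%:C)) x
      (fun v => pt (z * (v 0 0)%:C) (z * (v 0 1)%:C)).
Proof.
apply: isd_linear_row => k u v; rewrite !mxE pt_lin pt_add.
by congr pt; rewrite rmorphD rmorphM; ring.
Qed.

Lemma isd_real_coord (z : R[i]) (x : 'rV[R]_(2 + 2)) :
  isd (fun p : 'rV[R]_(2 + 2) => \row_j Re ((if j == 0 then z1 p else z2 p) / z) : 'rV[R]_2) x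
      (fun p => \row_j Re ((if j == 0 then z1 p else z2 p) / z)).
Proof.
apply: isd_linear_row => k u v; apply/rowP => j; rewrite !mxE.
have E (a b c : R[i]) : Re ((k%:C * a + b) * c) = k * Re (a * c) + Re (b * c).
  by case: a b c => ? ? [? ?] [? ?] /=; ring.
by case: ifP => _; rewrite ?z1D ?z2D ?z1Z ?z2Z E.
Qed.

(** If Re v and Im v are dependent, then v is z times a real vector and the orbit lies in the real
    plane z R^2. A three-dimensional chart would factor the identity of R^3 near a point through
    R^2, which its differential cannot do. *)
Lemma submanifold3_orbit_C2 (v : 'cV[R[i]]_2) : submanifold 3 (orbit_C2 v) ->
  Re (v 0 0) * Im (v 1 0) - Im (v 0 0) * Re (v 1 0) != 0.
Proof.
move=> sub; apply/eqP => d0.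
have [z [r1 [r2 [z0 e1 e2]]]] : exists z : R[i], exists r1 r2 : R,
    [/\ z != 0, v 0 0 = z * r1%:C & v 1 0 = z * r2%:C].
  move: d0; case: (v 0 0) (v 1 0) => a b [c d] /= d0.
  have [/eqP|n0] := eqVneq (a +i* b) 0.
    rewrite eq_complex /= => /andP[/eqP -> /eqP ->].
    have [/eqP|n1] := eqVneq (c +i* d) 0.
      rewrite eq_complex /= => /andP[/eqP -> /eqP ->].
      exists 1, 0, 0; split; rewrite ?oner_neq0 //; by apply: cplx_eq => /=; ring.
    by exists (c +i* d), 0, 1; split=> //; apply: cplx_eq => /=; ring.
  have := sqnorm_neq0 n0; rewrite /= => m0.
  exists (a +i* b), 1, ((a * c + b * d) / (a * a + b * b)); split=> //.
    by apply: cplx_eq => /=; ring.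
  have ad : a * d = b * c by lra.
  have f1 : c * (a * a + b * b) = a * (a * c + b * d).
    by transitivity (a * a * c + b * (b * c)); [ring | rewrite -ad; ring].
  have f2 : d * (a * a + b * b) = b * (a * c + b * d).
    by transitivity (a * (a * d) + b * b * d); [ring | rewrite ad; ring].
  apply: cplx_eq => /=.
    by rewrite -[LHS](mulfK m0) f1; ring.
  by rewrite -[LHS](mulfK m0) f2; ring.
have vE (g : 'M[R]_2) k : (toC g *m v) k 0 = z * (g k 0 * r1 + g k 1 * r2)%:C.
  by rewrite mul2E !mxE e1 e2 rmorphD !rmorphM; ring.
have Ov : orbit_C2 v v by exists 1%:M; rewrite /SL2 /= ?det1 // /toC map_mx1 mul1mx.
have [W [D [g [oW Wv oD [h [sg sh [gh hg]]]]]]] := sub v Ov.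
have Dh : D (h v) by apply: sh.1.
have [[] [[] [p0 [F [ep [U1 [ U1p sF FE]]]]]]] := sg.2 (h v) Dh.
have [[] [[] [p1 [H [ep1 [U2 [ U2p sH HE]]]]]]] := sh.2 v (conj Ov Wv).
have {}ep : p0 = h v by exact: ep.
have par_v q : D q -> U1 q -> g q = par (C2 R) tt (F q) by move=> Dq U1q; apply: FE.
have Fp : F p0 = p1.
  apply: good_C2.1; rewrite ep1 -par_v ?ep // ; last by rewrite -ep.
  exact: (hg v (conj Ov Wv)).
have oD' : open D by exact: (oD tt).
(* P reads off real coordinates along z and the map I below puts them back, so their composite I P
   is the identity on z R^2. *)
pose P (p : 'rV[R]_(2 + 2)) : 'rV[R]_2 := \row_j Re ((if j == 0 then z1 p else z2 p) / z).
pose I (y : 'rV[R]_2) := pt (z * (y 0 0)%:C) (z * (y 0 1)%:C).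
have IP q : D q -> U1 q -> I (P (F q)) = F q.
  move=> Dq U1q; have [gO _] := sg.1 q Dq; rewrite par_v // in gO.
  case: gO => m _ em; have k0 : z1 (F q) = (toC m *m v) 0 0 by rewrite em par_C2 mxE.
  have k1 : z2 (F q) = (toC m *m v) 1 0 by rewrite em par_C2 mxE.
  have Rr (x : R) : Re (z * x%:C / z) = x by rewrite mulrAC divff // mul1r.
  by rewrite -[RHS]pt_z /I /P !mxE /= k0 k1 !vE !Rr.
have HF : \forall q \near p0, H (I (P (F q))) = q.
  have o3 : open (D `&` (U1 `&` F @^-1` U2)).
    by apply: openI => //; apply: smooth_open => //; exact: sH.1.
  apply: (open_near o3) => [|q [Dq [U1q U2q]]].
    by split; [rewrite ep | split=> //=; rewrite Fp].
  rewrite IP //; transitivity (h (par (C2 R) tt (F q))).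
    by symmetry; apply: HE => //; rewrite -par_v //; exact: sg.1.
  by rewrite -par_v //; exact: gh.
have d1 := isd_comp (smooth_diff sF U1p) (isd_real_coord z (F p0)).
have IPp : I (P (F p0)) = F p0 by apply: IP => //; rewrite ep.
have U2I : U2 (I (P (F p0))) by rewrite IPp Fp.
have d2 := isd_comp (isd_pt_real z (P (F p0))) (smooth_diff sH U2I).
have [_ e12] := diff_near_eq (f := fun q => H (I (P (F q)))) (g := id) HF (isd_comp d1 d2).1.
have hid := (isd_id p0).2.
apply: (@no_linear_retract ('d (fun q => P (F q)) p0) ('d (fun y => H (I y)) (P (F p0)))) => x.
have e3 := congr1 (fun f : 'rV[R]_3 -> 'rV[R]_3 => f x) (etrans (esym e12) hid).
have e4 := congr1 (fun f : 'rV[R]_3 -> 'rV[R]_3 => f x) (isd_comp d1 d2).2.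
have e5 := congr1 (fun f : 'rV[R]_3 -> 'rV[R]_2 => f x) d1.2.
have e6 u := congr1 (fun f : 'rV[R]_2 -> 'rV[R]_3 => f u) d2.2.
move: e3 e4 e5 => /= e3 e4 e5.
by rewrite e5 e6 -e4 e3.
Qed.

End Degenerate.

(** * The complement of a chain, for a line with normalised equation *)

Section Chain.
Context {R : realType}.

Lemma hermS3 (p : 'rV[R]_(2 + 2)) : (herm 1 1 0 p p)%:C =
  z1 p * conjc (z1 p) + z2 p * conjc (z2 p).
Proof.
rewrite /herm /hrow1 /hrow2; case: (z1 p) (z2 p) => ? ? [? ?].
by apply: cplx_eq => /=; ring.
Qed.

Lemma S3_par W : S3 R `&` (par (C2 R) tt @` W) = par (C2 R) tt @` hquad 1 1 0 W.
Proof.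
have E (p : 'rV[R]_(2 + 2)) : S3 R (par (C2 R) tt p) <-> herm 1 1 0 p p = 1.
  rewrite /S3 /= -[_^T]/(par (C2 R) tt p) par_C2 !mxE /= !sqr_normc -hermS3.
  by split=> [/complexI|->].
apply/seteqP; split=> z.
  by move=> [Sz [p Wp e]]; exists p => //; split=> //; apply/E; rewrite e.
by move=> [p [/E Sp Wp] <-]; split=> //; exists p.
Qed.

Lemma hn_S3 : 1%:C * 1%:C - 0 * conjc 0 != 0 :> R[i].
Proof. by rewrite mul0r subr0 mulr1 oner_neq0. Qed.

Section Normalized.
Variables (a b c : R[i]) (s : R).
Hypothesis ab : a * conjc a + b * conjc b = 1.
Hypothesis s0 : s != 0.
Hypothesis sc : c * conjc c + (s * s)%:C = 1.

Definition off_line : set 'rV[R]_(2 + 2) := [set p | setT p /\ a * z1 p + b * z2 p - c != 0].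

Lemma open_off_line : open off_line.
Proof.
have oT : open (setT : set 'rV[R]_(2 + 2)) by exact: openT.
apply: open_neq0C => //; apply: smC_D => //; last exact: smC_cst.
by apply: smC_D => //; apply: smC_M => //; [exact: smC_cst | exact: smC_z1 | exact: smC_cst | exact: smC_z2].
Qed.

Lemma S3_chain_par : S3 R `\` (S3 R `&` complex_line a b c) =
  par (C2 R) tt @` hquad 1 1 0 off_line.
Proof.
rewrite -S3_par; apply/seteqP; split=> z.
  move=> [Sz nz]; split=> //; exists (pt (z 0 0) (z 1 0)).
    by split=> //; rewrite z1_pt z2_pt subr_eq0; apply/eqP => e; apply: nz.
  rewrite par_C2 z1_pt z2_pt; apply/colP => k; rewrite mxE.
  by case: (ord2P k) => ->.
move=> [Sz [p [_ np] ep]]; split=> // -[_]; rewrite /complex_line /= -ep par_C2 !mxE /=.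
by move/eqP; rewrite -subr_eq0 (negbTE np).
Qed.

(* |wp|^2 - |wm|^2 = 4, so (wp, wm) |-> (2 / wp, wm / wp) sends SL2 to the sphere
   minus z1 = 0; xi composes it with the ball automorphism moving that chain to
   z1 = c, and (f, g) with a unitary map moving it to a z1 + b z2 = c. *)
Let wp (p : 'rV[R]_(2 * 2)) := zeta1 p + 'i * zeta2 p.
Let wm (p : 'rV[R]_(2 * 2)) := zeta1 p + - ('i * zeta2 p).
Let den p := wp p + 2%:R * conjc c.
Let xi1 p := (2%:R + c * wp p) * (den p)^-1.
Let xi2 p := s%:C * wm p * (den p)^-1.
Let f p := conjc a * xi1 p + - (b * xi2 p).
Let g p := conjc b * xi1 p + a * xi2 p.

(** Data for the inverse: [et1] and [et2] are unitary coordinates in which the line is [et1] = c,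
    while [vp] and [vm] are the solutions [wp] and [wm] of [xi1] = [et1], [xi2] = [et2]. *)
Let et1 q := a * z1 q + b * z2 q.
Let et2 q := - (conjc b * z1 q) + conjc a * z2 q.
Let vp q := 2%:R * (1 + - (conjc c * et1 q)) * (et1 q + - c)^-1.
Let vm q := 2%:R * s%:C * et2 q * (et1 q + - c)^-1.
Let G q := of_zeta ((vp q + vm q) * 2^-1) ((vp q + - vm q) * (2^-1 * - 'i)).

Lemma wp_wm p : wp p * conjc (wp p) - wm p * conjc (wm p) = (4 * \det (vec_mx p))%:C.
Proof.
rewrite /wp /wm det2E /zeta1 /zeta2; move: (vec_mx p : 'M[R]_2) => m.
by apply: cplx_eq => /=; ring.
Qed.

(** On SL_2(R) one has |wp|^2 = 4 + |wm|^2 >= 4, while |2 conj c|^2 = 4 - 4 s^2 < 4. *)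
Lemma den_neq0 p : \det (vec_mx p) = 1 -> den p != 0.
Proof.
move=> dp; have := wp_wm p; rewrite dp mulr1 /den => e.
apply/eqP => d0; have {}d0 : wp p = - (2%:R * conjc c) by apply/eqP; rewrite -addr_eq0 d0.
move: e; rewrite d0.
have -> : - (2%:R * conjc c) * conjc (- (2%:R * conjc c)) = 4%:R * (c * conjc c) :> R[i].
  by case: c => ? ?; apply: cplx_eq => /=; ring.
have -> : c * conjc c = 1 - (s * s)%:C by rewrite -sc addrK.
case: (wm p) => x y /(congr1 (@Re R)) /=.
have s2 : 0 < s * s by rewrite -expr2 exprn_even_gt0.
by nra.
Qed.

(** On |wp|^2 - |wm|^2 = 4, the relation |c|^2 + s^2 = 1 gives |2 + c wp|^2 + s^2 |wm|^2 = |wp + 2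
    conj c|^2. *)
Lemma xi_unit p : \det (vec_mx p) = 1 ->
  xi1 p * conjc (xi1 p) + xi2 p * conjc (xi2 p) = 1.
Proof.
move=> dp; have d0 := den_neq0 dp; have := wp_wm p; rewrite dp mulr1 => e.
have d0' : conjc (den p) != 0 by rewrite conjc_eq0.
have N : (2%:R + c * wp p) * conjc (2%:R + c * wp p) + s%:C * wm p * conjc (s%:C * wm p)
   = den p * conjc (den p).
  transitivity (4%:R + 2%:R * (c * wp p + conjc (c * wp p)) + (c * conjc c) * (wp p * conjc (wp p))
     + (s * s)%:C * (wm p * conjc (wm p))).
    by case: c (wp p) (wm p) => ? ? [? ?] [? ?]; apply: cplx_eq => /=; ring.
  have -> : c * conjc c = 1 - (s * s)%:C by rewrite -sc addrK.
  have -> : wm p * conjc (wm p) = wp p * conjc (wp p) - 4%:C by rewrite -e; ring.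
  transitivity (wp p * conjc (wp p) + 2%:R * (c * wp p + conjc (c * wp p)) + 4%:R * (c * conjc c)).
    have -> : c * conjc c = 1 - (s * s)%:C by rewrite -sc addrK.
    by case: c (wp p) => ? ? [? ?]; apply: cplx_eq => /=; ring.
  by rewrite /den; case: c (wp p) => ? ? [? ?]; apply: cplx_eq => /=; ring.
have E (x D : R[i]) : conjc (x * D^-1) = conjc x * (conjc D)^-1.
  by rewrite rmorphM fmorphV.
rewrite /xi1 /xi2 !E; transitivity (den p * conjc (den p) / (den p * conjc (den p))).
  by rewrite -{1}N; field; rewrite d0 d0'.
by rewrite divff // mulf_neq0.
Qed.

Lemma et_unit q : et1 q * conjc (et1 q) + et2 q * conjc (et2 q) =
  z1 q * conjc (z1 q) + z2 q * conjc (z2 q).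
Proof.
transitivity ((a * conjc a + b * conjc b) * (z1 q * conjc (z1 q) + z2 q * conjc (z2 q))).
  rewrite /et1 /et2; case: a b (z1 q) (z2 q) => ? ? [? ?] [? ?] [? ?].
  by apply: cplx_eq => /=; ring.
by rewrite ab mul1r.
Qed.

Lemma et1_fg x y : a * (conjc a * x + - (b * y)) + b * (conjc b * x + a * y) = x.
Proof.
transitivity ((a * conjc a + b * conjc b) * x); first by ring.
by rewrite ab mul1r.
Qed.

Lemma et2_fg x y : - (conjc b * (conjc a * x + - (b * y))) + conjc a * (conjc b * x + a * y) = y.
Proof.
transitivity ((a * conjc a + b * conjc b) * y); first by ring.
by rewrite ab mul1r.
Qed.

Lemma fg_et q : conjc a * et1 q + - (b * et2 q) = z1 q /\ conjc b * et1 q + a * et2 q = z2 q.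
Proof.
rewrite /et1 /et2; split.
  transitivity ((a * conjc a + b * conjc b) * z1 q); first by ring.
  by rewrite ab mul1r.
transitivity ((a * conjc a + b * conjc b) * z2 q); first by ring.
by rewrite ab mul1r.
Qed.

Lemma sC0 : s%:C != 0.
Proof. by rewrite eq_complex /= negb_and s0. Qed.

Lemma xi1_off p : \det (vec_mx p) = 1 -> xi1 p - c != 0.
Proof.
move=> dp; have d0 := den_neq0 dp.
have -> : xi1 p - c = 2%:R * (s * s)%:C / den p.
  have -> : (s * s)%:C = 1 - c * conjc c by rewrite -sc addrC addKr.
  by rewrite /xi1; move: d0; rewrite /den => d0; field.
rewrite mulf_neq0 ?invr_neq0 // mulf_neq0 ?pnatr_eq0 //.
by rewrite rmorphM mulf_neq0 ?sC0.
Qed.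

Lemma chain_fdiffeo : fdiffeo (sl2W setT) (hquad 1 1 0 off_line) (fun p => pt (f p) (g p)) G.
Proof.
have sz1 := smC_zeta1 (R := R); have sz2 := smC_zeta2 (R := R).
have oT4 : open (setT : set 'rV[R]_(2 * 2)) by exact: openT.
have sp : smC setT wp by rewrite /wp; smc.
have sm : smC setT wm by rewrite /wm; smc.
have sd : smC setT den by rewrite /den; smc.
pose U := [set p | setT p /\ den p != 0].
have oU : open U by apply: open_neq0C.
have sub (h : 'rV[R]_(2 * 2) -> R[i]) : smC setT h -> smC U h by exact: smC_sub.
have {}sp := sub _ sp; have {}sm := sub _ sm; have {}sd := sub _ sd.
have sdV : smC U (fun p => (den p)^-1) by apply: smC_V => // p [].
have sx1 : smC U xi1 by rewrite /xi1; smc.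
have sx2 : smC U xi2 by rewrite /xi2; smc.
split.
  exists U; first by move=> p /sl2W_det/den_neq0.
  by split=> // k; apply: Ck_pt => //; rewrite /f /g; smc.
have oo := open_off_line.
have s1 : smC off_line (@z1 R) by exact: smC_z1.
have s2 : smC off_line (@z2 R) by exact: smC_z2.
have e1 : smC off_line et1 by rewrite /et1; smc.
have e2 : smC off_line et2 by rewrite /et2; smc.
have ecd : smC off_line (fun q => et1 q + - c) by smc.
have ec : smC off_line (fun q => (et1 q + - c)^-1).
  by apply: smC_V => // q [].
have sv1 : smC off_line vp by rewrite /vp; smc.
have sv2 : smC off_line vm by rewrite /vm; smc.
split.
  exists off_line; first by move=> q [].
  by split=> // k; apply: Ck_of_zeta => //; smc.
have h2 : (2%:R : R[i]) != 0 by rewrite pnatr_eq0.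
split=> [p /sl2W_det dp|q [hq [_ hc]]].
  have d0 := den_neq0 dp; have xc := xi1_off dp.
  have E1 : et1 (pt (f p) (g p)) = xi1 p by rewrite /et1 z1_pt z2_pt et1_fg.
  have E2 : et2 (pt (f p) (g p)) = xi2 p by rewrite /et2 z1_pt z2_pt et2_fg.
  split.
    split; last by split=> //; rewrite -/(et1 _) E1.
    by apply: complexI; rewrite /= hermS3 -et_unit E1 E2 xi_unit.
  have ss : (s * s)%:C = 1 - c * conjc c by rewrite -sc addrC addKr.
  have xcE : xi1 p - c = 2%:R * (s * s)%:C / den p.
    by rewrite ss /xi1; move: d0; rewrite /den => d0'; field.
  have sC := sC0.
  have vpE : vp (pt (f p) (g p)) = wp p.
    rewrite /vp E1 xcE rmorphM.
    have -> : 1 + - (conjc c * xi1 p) = wp p * (s * s)%:C / den p.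
      by rewrite ss /xi1; move: d0; rewrite /den => d0'; field.
    by rewrite rmorphM; field; rewrite d0 sC.
  have vmE : vm (pt (f p) (g p)) = wm p.
    by rewrite /vm E1 E2 xcE rmorphM /xi2; field; rewrite d0 sC.
  rewrite /G vpE vmE -[RHS]of_zetaK /wp /wm.
  have i2 : 'i * 'i = -1 :> R[i] by rewrite -expr2 sqr_i.
  congr of_zeta; first by field.
  transitivity (- ('i * 'i) * zeta2 p); first by field.
  by rewrite i2 opprK mul1r.
have i2 : 'i * 'i = -1 :> R[i] by rewrite -expr2 sqr_i.
have wpG : wp (G q) = vp q.
  rewrite /wp /G zeta1K zeta2K.
  transitivity ((vp q + vm q) / 2%:R - ('i * 'i) * (vp q - vm q) / 2%:R); first by field.
  by rewrite i2; field.
have wmG : wm (G q) = vm q.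
  rewrite /wm /G zeta1K zeta2K.
  transitivity ((vp q + vm q) / 2%:R + ('i * 'i) * (vp q - vm q) / 2%:R); first by field.
  by rewrite i2; field.
have hq' : et1 q * conjc (et1 q) + et2 q * conjc (et2 q) = 1.
  by rewrite et_unit -hermS3 hq.
have hcc : et1 q + - c != 0 by exact: hc.
have ss : (s * s)%:C = 1 - c * conjc c by rewrite -sc addrC addKr.
have sC := sC0.
have dq : \det (vec_mx (G q)) = 1.
  have := wp_wm (G q); rewrite wpG wmG.
  have hcj : conjc (et1 q + - c) != 0 by rewrite conjc_eq0.
  have E (x y : R[i]) : conjc (x * y^-1) = conjc x * (conjc y)^-1 by rewrite rmorphM fmorphV.
  have N : (2%:R * (1 + - (conjc c * et1 q))) * conjc (2%:R * (1 + - (conjc c * et1 q))) -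
    (2%:R * s%:C * et2 q) * conjc (2%:R * s%:C * et2 q) =
    4%:R * ((et1 q + - c) * conjc (et1 q + - c)).
    transitivity (4%:R * (1 - (conjc c * et1 q + conjc (conjc c * et1 q)) +
      (c * conjc c) * (et1 q * conjc (et1 q)) - (s * s)%:C * (et2 q * conjc (et2 q)))).
      by case: c (et1 q) (et2 q) => ? ? [? ?] [? ?]; apply: cplx_eq => /=; ring.
    have -> : et2 q * conjc (et2 q) = 1 - et1 q * conjc (et1 q) by rewrite -hq'; ring.
    rewrite ss; case: c (et1 q) => ? ? [? ?]; apply: cplx_eq => /=; ring.
  have -> : vp q * conjc (vp q) - vm q * conjc (vm q) = 4%:R.
    rewrite /vp /vm !E; transitivity (4%:R * ((et1 q + - c) * conjc (et1 q + - c)) /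
      ((et1 q + - c) * conjc (et1 q + - c))); last by rewrite mulfK // mulf_neq0.
    have hcj' : conjc (et1 q) - conjc c != 0 by rewrite -rmorphB.
    by rewrite -{1}N; field; rewrite hcc hcj'.
  move=> /(congr1 (@Re R)) /= e.
  have n4 : (4 : R) != 0 by rewrite pnatr_eq0.
  apply: (mulfI n4); rewrite mulr1 -e; ring.
have d0 := den_neq0 dq.
have s2n : 1 - c * conjc c != 0 by rewrite -ss rmorphM mulf_neq0.
have x1 : xi1 (G q) = et1 q.
  move: d0; rewrite /xi1 /den wpG /vp => d0.
  have D : 2%:R * (1 + - (conjc c * et1 q)) * (et1 q + - c)^-1 + 2%:R * conjc c =
    2%:R * (1 - c * conjc c) / (et1 q + - c) by field.
  by rewrite D; field; rewrite s2n hcc.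
have x2 : xi2 (G q) = et2 q.
  move: d0; rewrite /xi2 /den wpG wmG /vp /vm => d0.
  have D : 2%:R * (1 + - (conjc c * et1 q)) * (et1 q + - c)^-1 + 2%:R * conjc c =
    2%:R * (s * s)%:C / (et1 q + - c) by rewrite ss; field.
  by rewrite D rmorphM; field; rewrite sC hcc.
split; first by split=> //; rewrite /= detbE.
by have [f1 f2] := fg_et q; rewrite /f /g x1 x2 f1 f2 pt_z.
Qed.

Lemma chain_cr : cr_equivalent (SL2 R) (V_ 1)
  (par (C2 R) tt @` hquad 1 1 0 off_line) (induced_cr (par (C2 R) tt @` hquad 1 1 0 off_line)).
Proof.
apply: (SL2_cr_equiv _ _ _ _ chain_fdiffeo).
- exact: oner_neq0.
- by apply/eqP => h; lra.
- by apply: hquad_cr; [exact: hn_S3 | exact: open_off_line].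
- by move=> q hq; eexists; apply: hquad_induced hq; exact: open_off_line.
move=> p /sl2W_det dp; have [a1 a2] := ann_zeta p.
have d0 := den_neq0 dp.
set w := cvec _ _ in a1 a2 *.
have awp : ann wp p w by rewrite /wp; annt.
have awm : ann wm p w by rewrite /wm; annt.
have ad0 : ann den p w by rewrite /den; annt.
have ad : ann (fun q => (den q)^-1) p w by exact: (ann_V d0 ad0).
have ax1 : ann xi1 p w by rewrite /xi1; annt.
have ax2 : ann xi2 p w by rewrite /xi2; annt.
by split; [rewrite /f | rewrite /g]; annt.
Qed.

End Normalized.
End Chain.

(** * Normalising the equation of a chain *)

Section ChainComplement.
Context {R : realType}.

Lemma submanifold1_not_point (x : C2 R) : ~ submanifold 1 [set x].
Proof.
move=> /(_ x erefl) [W [D [g [oW Wx oD [h [sg sh [gh hg]]]]]]].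
have xW : ([set x] `&` W) x by split.
have Dh : D (h x) by exact: sh.1.
have oD' : open D by exact: (oD tt).
have : nbhs (h x : 'rV[R]_1) D by apply: open_nbhs_nbhs.
move=> /nbhs_ballP [e /= e0 eD].
pose y : 'rV[R]_1 := h x + const_mx (e / 2).
have Dy : D y.
  apply: eD; split=> // i j; rewrite /ball /= !mxE opprD addrA subrr sub0r normrN.
  by rewrite gtr0_norm ?divr_gt0 // ltr_pdivrMr // ltr_pMr // ltr1n.
have [gy _] := sg.1 y Dy.
have := gh y Dy; rewrite (gy : g y = x) => /(congr1 (fun v : 'rV[R]_1 => v 0 0)).
rewrite /y !mxE => /eqP; rewrite -subr_eq0 opprD addrA subrr sub0r oppr_eq0.
by rewrite gt_eqF // divr_gt0.
Qed.

(** After division by the norm of (a0, b0), |c| is the distance from the origin to the line. If |c|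
    >= 1, all points of K would coincide with the foot of the perpendicular, so the nonempty K would
    be a single point and not a curve. Hence |c| < 1, and s is the radius of the chain. *)
Lemma chain_equiv (K : set (C2 R)) : is_chain K ->
  cr_equivalent (SL2 R) (V_ 1) (S3 R `\` K) (induced_cr (S3 R `\` K)).
Proof.
move=> [[a0 [b0 [c0 [ab0 KE]]]] Kn K1].
pose m := Re a0 ^+ 2 + Im a0 ^+ 2 + (Re b0 ^+ 2 + Im b0 ^+ 2).
have m0 : 0 < m.
  rewrite lt_def !addr_ge0 ?sqr_ge0 // andbT; apply: contra ab0.
  rewrite !paddr_eq0 ?addr_ge0 ?sqr_ge0 // !sqrf_eq0 => /andP[/andP[e1 e2] /andP[e3 e4]].
  by apply/eqP; congr pair; apply: cplx_eq; apply/eqP.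
pose n := Num.sqrt m.
have n0 : n%:C != 0 by rewrite eq_complex /= negb_and gt_eqF // sqrtr_gt0.
have nn : n * n = m by rewrite -expr2 sqr_sqrtr // ltW.
pose a := a0 / n%:C; pose b := b0 / n%:C; pose c := c0 / n%:C.
have ab : a * conjc a + b * conjc b = 1.
  have E (x : R[i]) : (x / n%:C) * conjc (x / n%:C) = x * conjc x / (n * n)%:C.
    have cn : conjc (n%:C)^-1 = (n%:C)^-1.
      by rewrite fmorphV; congr (_^-1); apply: cplx_eq => //=; rewrite oppr0.
    by rewrite conjcM cn [(n * n)%:C]rmorphM; field.
  rewrite !E -mulrDl; have -> : a0 * conjc a0 + b0 * conjc b0 = (n * n)%:C.
    rewrite nn /m; case: a0 b0 {ab0 KE m m0 n n0 nn a b c E} => ? ? [? ?].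
    by apply: cplx_eq => /=; ring.
  by rewrite divff // rmorphM mulf_eq0 negb_or n0.
have KE' : K = S3 R `&` complex_line a b c.
  rewrite KE; congr (_ `&` _); apply/seteqP; split=> z; rewrite /complex_line /= /a /b /c.
    by move=> <-; field.
  move=> e; apply: (mulIf (invr_neq0 n0)); rewrite -e; ring.
have [z Kz] := Kn.
have [Sz Lz] : S3 R z /\ complex_line a b c z by rewrite KE' in Kz.
(* The coordinate along the line in a unitary frame adapted to (a, b); on K it satisfies |c|^2 +
   |e2|^2 = 1. *)
pose e2 (z : C2 R) : R[i] := - (conjc b * (z : 'cV_2) 0 0) + conjc a * (z : 'cV_2) 1 0.
have norm_e (y : C2 R) : S3 R y -> complex_line a b c y -> c * conjc c + e2 y * conjc (e2 y) = 1.
  rewrite /S3 /complex_line /= !sqr_normc => <- <-.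
  rewrite -[RHS]mul1r -ab /e2.
  move: (y 0 0) (y 1 0) => u v; move: a b {KE' Sz Lz e2 ab} => a' b'.
  by rewrite !rmorphD !rmorphN !rmorphM /= !conjcK; ring.
have uniq_pt (y : C2 R) : complex_line a b c y -> e2 y = 0 -> y = \col_k (if k == 0 then conjc a * c else conjc b * c).
  rewrite /complex_line /= /e2 => ly ey; apply/colP => k; rewrite mxE.
  have y0 : y 0 0 = conjc a * c.
    transitivity ((a * conjc a + b * conjc b) * y 0 0 ); first by rewrite ab mul1r.
    transitivity (conjc a * (a * y 0 0 + b * y 1 0) - b * (- (conjc b * y 0 0) + conjc a * y 1 0)); first by ring.
    by rewrite ly ey mulr0 subr0.
  have y1 : y 1 0 = conjc b * c.
    transitivity ((a * conjc a + b * conjc b) * y 1 0 ); first by rewrite ab mul1r.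
    transitivity (conjc b * (a * y 0 0 + b * y 1 0) + a * (- (conjc b * y 0 0) + conjc a * y 1 0)); first by ring.
    by rewrite ly ey mulr0 addr0.
  by case: (ord2P k) => ->.
pose nc := Re c * Re c + Im c * Im c.
have ncE : c * conjc c = nc%:C by rewrite /nc; case: (c) => ? ?; apply: cplx_eq => /=; ring.
have ne2 y : e2 y * conjc (e2 y) = (Re (e2 y) * Re (e2 y) + Im (e2 y) * Im (e2 y))%:C.
  by case: (e2 y) => ? ?; apply: cplx_eq => /=; ring.
have nc1 : nc < 1.
  rewrite ltNge; apply/negP => nc1.
  have e20 y : K y -> e2 y = 0.
    rewrite KE' => -[Sy Ly]; have := norm_e y Sy Ly; rewrite ncE ne2 -rmorphD => /complexI e.
    apply/eqP; apply: contraT => /sqnorm_neq0 h.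
    have : 0 < Re (e2 y) * Re (e2 y) + Im (e2 y) * Im (e2 y).
      by rewrite lt_def h -!expr2 addr_ge0 ?sqr_ge0.
    by lra.
  have Kpt y : K y -> y = \col_k (if k == 0 then conjc a * c else conjc b * c).
    by move=> Ky; apply: uniq_pt (e20 y Ky); move: Ky; rewrite KE' => -[].
  apply: (@submanifold1_not_point z); rewrite (_ : [set z] = K) //.
  by apply/seteqP; split=> y /=; [move=> -> | move=> Ky; rewrite (Kpt y Ky) (Kpt z Kz)].
pose s := Num.sqrt (1 - nc).
have ss : s * s = 1 - nc by rewrite -expr2 sqr_sqrtr // subr_ge0 ltW.
have s0 : s != 0 by rewrite gt_eqF // sqrtr_gt0 subr_gt0.
have sc : c * conjc c + (s * s)%:C = 1 by rewrite ncE ss -rmorphD addrC subrK.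
by rewrite KE' S3_chain_par; exact: (chain_cr ab s0 sc).
Qed.

End ChainComplement.

(** * The adjoint action and the orbit map in coordinates *)

Section Adjoint.
Context {K : comNzRingType}.
Implicit Types (p q r s l b c : K).

(* The entries of g (l, b; c, -l) adj(g), for g = (p, q; r, s). *)
Definition ada p q r s l b c := (p * s + q * r) * l + q * s * c - p * r * b.
Definition adb p q r s l b c := p * p * b - 2%:R * (p * q * l) - q * q * c.
Definition adc p q r s l b c := s * s * c + 2%:R * (r * s * l) - r * r * b.

End Adjoint.

Section AdjointOrbit.
Context {R : realType}.
Variable t : R.
Hypotheses (t0 : t != 0) (t1 : 1 + t != 0).

Let k := (1 + t) / 2.
Let l : R[i] := 0 +i* k.

Lemma L_sl2 : L_ t = sl2 l t%:C 1.
Proof. by []. Qed.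

Lemma conj_sl2 (g : 'M[R]_2) (x y z : R[i]) : \det g = 1 ->
  toC g *m sl2 x y z *m invmx (toC g) =
  sl2 (ada (g 0 0)%:C (g 0 1)%:C (g 1 0)%:C (g 1 1)%:C x y z)
      (adb (g 0 0)%:C (g 0 1)%:C (g 1 0)%:C (g 1 1)%:C x y z)
      (adc (g 0 0)%:C (g 0 1)%:C (g 1 0)%:C (g 1 1)%:C x y z).
Proof.
move=> dg; have u : toC g \in unitmx by rewrite unitmxE det_map_mx dg rmorph1 unitr1.
suff E : toC g *m sl2 x y z = sl2
    (ada (g 0 0)%:C (g 0 1)%:C (g 1 0)%:C (g 1 1)%:C x y z)
    (adb (g 0 0)%:C (g 0 1)%:C (g 1 0)%:C (g 1 1)%:C x y z)
    (adc (g 0 0)%:C (g 0 1)%:C (g 1 0)%:C (g 1 1)%:C x y z) *m toC g.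
  by rewrite E mulmxK.
have d1 : (g 0 0)%:C * (g 1 1)%:C - (g 0 1)%:C * (g 1 0)%:C = 1.
  by rewrite -!rmorphM -rmorphB -det2E dg rmorph1.
apply: mx2_ext; rewrite !mul2E !mx22E /toC ![map_mx _ _ _ _]mxE /ada /adb /adc.
- transitivity (((g 0 0)%:C * (g 1 1)%:C - (g 0 1)%:C * (g 1 0)%:C) * ((g 0 0)%:C * x + (g 0 1)%:C * z)); last by ring.
  by rewrite d1 mul1r.
- transitivity (((g 0 0)%:C * (g 1 1)%:C - (g 0 1)%:C * (g 1 0)%:C) * ((g 0 0)%:C * y - (g 0 1)%:C * x)); last by ring.
  by rewrite d1; ring.
- transitivity (((g 0 0)%:C * (g 1 1)%:C - (g 0 1)%:C * (g 1 0)%:C) * ((g 1 0)%:C * x + (g 1 1)%:C * z)); last by ring.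
  by rewrite d1; ring.
- transitivity (((g 0 0)%:C * (g 1 1)%:C - (g 0 1)%:C * (g 1 0)%:C) * ((g 1 0)%:C * y - (g 1 1)%:C * x)); last by ring.
  by rewrite d1; ring.
Qed.

Definition ent i j (p : 'rV[R]_(2 * 2)) : R[i] := (vec_mx p i j)%:C.

Definition Ma p := ada (ent 0 0 p) (ent 0 1 p) (ent 1 0 p) (ent 1 1 p) l t%:C 1.
Definition Mb p := adb (ent 0 0 p) (ent 0 1 p) (ent 1 0 p) (ent 1 1 p) l t%:C 1.
Definition Mc p := adc (ent 0 0 p) (ent 0 1 p) (ent 1 0 p) (ent 1 1 p) l t%:C 1.

(** With (r, s) the second row of g, the real and imaginary parts are s^2 - t r^2 and (1 + t) r s.
    They vanish together only for r = s = 0, so the whole orbit lies in the chart [proj_chart]. *)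
Lemma Mc_neq0 p : \det (vec_mx p) = 1 -> Mc p != 0.
Proof.
move=> dp; apply/eqP => e.
have eR := congr1 (@Re R) e; have eI := congr1 (@Im R) e.
move: eR eI dp; rewrite /Mc /adc /ent /l det2E.
move: (vec_mx p 0 0) (vec_mx p 0 1) (vec_mx p 1 0) (vec_mx p 1 1) => x y r s /= eR eI d.
have rs : (1 + t) * (r * s) = 0 by move: eI; rewrite /k => eI; lra.
move/eqP: rs; rewrite mulf_eq0 (negbTE t1) /= mulf_eq0 => /orP[] /eqP h.
  have : s * s = 0 by move: eR; rewrite h; lra.
  by move/eqP; rewrite mulf_eq0 orbb => /eqP s0; move: d; rewrite h s0; lra.
have : t * (r * r) = 0 by move: eR; rewrite h; lra.
move/eqP; rewrite mulf_eq0 (negbTE t0) /= mulf_eq0 orbb => /eqP r0.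
by move: d; rewrite h r0; lra.
Qed.

Definition Fa p := Ma p * (Mc p)^-1.
Definition Fb p := Mb p * (Mc p)^-1.
Definition F p := pt (Fa p) (Fb p).

Definition orb : set 'rV[R]_(2 + 2) := F @` sl2W setT.

Lemma orbit_map p : \det (vec_mx p) = 1 ->
  <[toC (vec_mx p) *m L_ t *m invmx (toC (vec_mx p))]>%VS = par (Psl2C R) proj_chart (F p).
Proof. by move=> dp; rewrite L_sl2 conj_sl2 // sl2_line //; exact: Mc_neq0. Qed.

Lemma orbit_P_par : orbit_P (L_ t) = par (Psl2C R) proj_chart @` orb.
Proof.
apply/seteqP; split=> x.
  move=> [g]; rewrite SL2_par => -[p sp <-] <-; exists (F p); first by exists p.
  by symmetry; apply: orbit_map; exact: sl2W_det sp.
move=> [q [p sp <-] <-]; exists (vec_mx p); first by rewrite SL2_par; exists p.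
by apply: orbit_map; exact: sl2W_det sp.
Qed.

Lemma isdC_ent i j p : isdC (ent i j) p (ent i j).
Proof. by apply: isdC_real; exact: isd_entry. Qed.

Lemma smC_ent i j : smC setT (ent i j).
Proof. by apply: smC_isdC => x; exact: isdC_ent. Qed.

Definition Fdom : set 'rV[R]_(2 * 2) := [set p | setT p /\ Mc p != 0].

Lemma smC_Mc : smC setT Mc.
Proof.
have h00 := smC_ent 0 0; have h01 := smC_ent 0 1; have h10 := smC_ent 1 0; have h11 := smC_ent 1 1.
by rewrite /Mc /adc; smc.
Qed.

Lemma open_Fdom : open Fdom.
Proof. by apply: open_neq0C; [exact: openT | exact: smC_Mc]. Qed.

Lemma smooth_F : smooth Fdom F.
Proof.
have oF := open_Fdom; split=> // d.
have sub (h : 'rV[R]_(2 * 2) -> R[i]) : smC setT h -> smC Fdom h by exact: smC_sub.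
have h00 := sub _ (smC_ent 0 0); have h01 := sub _ (smC_ent 0 1).
have h10 := sub _ (smC_ent 1 0); have h11 := sub _ (smC_ent 1 1).
have hM : smC Fdom Mc by rewrite /Mc /adc; smc.
have hi : smC Fdom (fun p => (Mc p)^-1) by apply: smC_V => // p [].
by apply: Ck_pt => //; [rewrite /Fa /Ma /ada | rewrite /Fb /Mb /adb]; smc.
Qed.

Lemma sl2W_Fdom W : sl2W W `<=` Fdom.
Proof. by move=> p /sl2W_det/Mc_neq0. Qed.

(* The derivative at g of g L adj(g) in the direction g xi is g [xi, L] adj(g). *)
Lemma isdC_adj p :
  [/\ isdC Ma p (fun v => (ent 0 0 p * ent 1 1 v + ent 1 1 p * ent 0 0 v
        + (ent 0 1 p * ent 1 0 v + ent 1 0 p * ent 0 1 v)) * l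
        + (ent 0 1 p * ent 1 1 v + ent 1 1 p * ent 0 1 v)
        - (ent 0 0 p * ent 1 0 v + ent 1 0 p * ent 0 0 v) * t%:C),
      isdC Mb p (fun v => 2%:R * (ent 0 0 p * ent 0 0 v) * t%:C
        - 2%:R * (ent 0 0 p * ent 0 1 v + ent 0 1 p * ent 0 0 v) * l
        - 2%:R * (ent 0 1 p * ent 0 1 v)) &
      isdC Mc p (fun v => 2%:R * (ent 1 1 p * ent 1 1 v)
        + 2%:R * (ent 1 0 p * ent 1 1 v + ent 1 1 p * ent 1 0 v) * l
        - 2%:R * (ent 1 0 p * ent 1 0 v) * t%:C)].
Proof.
have D i j := isdC_ent i j p; have C (c : R[i]) := isdC_cst c p.
rewrite /Ma /Mb /Mc /ada /adb /adc; split.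
- apply: isdC_eq (isdC_D (isdC_D (isdC_M (isdC_D (isdC_M (D 0 0) (D 1 1)) (isdC_M (D 0 1) (D 1 0))) (C l))
    (isdC_M (isdC_M (D 0 1) (D 1 1)) (C 1)))
    (isdC_N (isdC_M (isdC_M (D 0 0) (D 1 0)) (C t%:C)))) _ _ => // v.
  by ring.
- apply: isdC_eq (isdC_D (isdC_D (isdC_M (isdC_M (D 0 0) (D 0 0)) (C t%:C))
    (isdC_N (isdC_M (C 2%:R) (isdC_M (isdC_M (D 0 0) (D 0 1)) (C l)))))
    (isdC_N (isdC_M (isdC_M (D 0 1) (D 0 1)) (C 1)))) _ _ => // v.
  by ring.
- apply: isdC_eq (isdC_D (isdC_D (isdC_M (isdC_M (D 1 1) (D 1 1)) (C 1))
    (isdC_M (C 2%:R) (isdC_M (isdC_M (D 1 0) (D 1 1)) (C l))))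
    (isdC_N (isdC_M (isdC_M (D 1 0) (D 1 0)) (C t%:C)))) _ _ => // v.
  by ring.
Qed.

End AdjointOrbit.

Section AdjointComm.
Context {K : comNzRingType}.
Implicit Types (p q r s : K).

(** Conjugation carries commutators to commutators; the factor d appears because the adjugate
    replaces the inverse. *)
Lemma ad_comm p q r s a b c a' b' c' (d := p * s - q * r) :
  let A := ada p q r s a b c in let B := adb p q r s a b c in let C := adc p q r s a b c in
  let A' := ada p q r s a' b' c' in let B' := adb p q r s a' b' c' in
  let C' := adc p q r s a' b' c' in
  let x := b * c' - b' * c in let y := 2%:R * (a * b' - a' * b) in
  let z := 2%:R * (c * a' - c' * a) in
  [/\ ada p q r s x y z * d = B * C' - B' * C,
      adb p q r s x y z * d = 2%:R * (A * B' - A' * B) &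
      adc p q r s x y z * d = 2%:R * (C * A' - C' * A)].
Proof. by rewrite /= /ada /adb /adc /d; split; ring. Qed.

(** Invariance of the trace form tr(M M'), again up to powers of the determinant. *)
Lemma ad_form p q r s a b c a' b' c' (d := p * s - q * r) :
  2%:R * (ada p q r s a b c * ada p q r s a' b' c') +
  adb p q r s a b c * adc p q r s a' b' c' + adc p q r s a b c * adb p q r s a' b' c' =
  d * d * (2%:R * (a * a') + b * c' + c * b').
Proof. by rewrite /ada /adb /adc /d; ring. Qed.

End AdjointComm.

(** * The frame of the orbit's tangent spaces in the projective chart *)

Section OrbitField.
Context {R : realType}.
Implicit Types (q : 'rV[R]_(2 + 2)).

(* In the chart L = (z1, z2; 1, -z1) of P(sl2), (Ka, Kb; Kc, -Ka) is the matrix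
   K = [conj L, L]; (fa, fb) and (Ta, Tb) are the tangent vectors of the chart
   given by K and by -i [K, L]; Qf = - det L and Hf is the hermitian form
   tr(L conj L) / 2. *)
Definition Ka q : R[i] := conjc (z2 q) + - z2 q.
Definition Kb q : R[i] := 2%:R * (conjc (z1 q) * z2 q + - (z1 q * conjc (z2 q))).
Definition Kc q : R[i] := 2%:R * (z1 q + - conjc (z1 q)).
Definition fa q : R[i] := Ka q + - (z1 q * Kc q).
Definition fb q : R[i] := Kb q + - (z2 q * Kc q).
Definition Ta q : R[i] := - 'i%C * (Kb q - z2 q * Kc q - 2%:R * z1 q * (Kc q * z1 q - Ka q)).
Definition Tb q : R[i] := - 'i%C *
  (4%:R * (Ka q * z2 q) - 2%:R * (z1 q * Kb q) - 2%:R * (z1 q * z2 q * Kc q)).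
Definition Qf q : R[i] := z1 q * z1 q + z2 q.
Definition Hf q : R[i] := z1 q * conjc (z1 q) + (z2 q + conjc (z2 q)) / 2%:R.

(** The factor Qf conj(Qf) - Hf^2 is the Gram determinant of L and conj L for the form tr(X Y) / 2,
    so independence of the two vectors reduces to invariants of the orbit. *)
Lemma fT_det q : fa q * Tb q - fb q * Ta q =
  16%:R * 'i%C * (Qf q * conjc (Qf q) - Hf q * Hf q) * Qf q.
Proof.
rewrite /fa /fb /Ta /Tb /Ka /Kb /Kc /Qf /Hf rmorphD rmorphM /=.
move: (z1 q) (z2 q) (conjc (z1 q)) (conjc (z2 q)) => a b a' b'.
by field.
Qed.

Lemma isdC_K q : [/\ isdC Ka q (fun v => conjc (z2 v) - z2 v),
  isdC Kb q (fun v => 2%:R * (conjc (z1 q) * z2 v + z2 q * conjc (z1 v)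
    - (z1 q * conjc (z2 v) + conjc (z2 q) * z1 v))) &
  isdC Kc q (fun v => 2%:R * (z1 v - conjc (z1 v)))].
Proof.
have D1 := isdC_z1 q; have D2 := isdC_z2 q.
have C1 := isdC_conj D1; have C2 := isdC_conj D2; have C := isdC_cst (2%:R : R[i]) q.
split.
- by apply: isdC_eq (isdC_D C2 (isdC_N D2)) _ _.
- apply: isdC_eq (isdC_M C (isdC_D (isdC_M C1 D2) (isdC_N (isdC_M D1 C2)))) _ _ => // v.
  by ring.
- by apply: isdC_eq (isdC_M C (isdC_D D1 (isdC_N C1))) _ _ => // v; ring.
Qed.

Lemma smC_f U : open U -> smC U fa /\ smC U fb.
Proof.
move=> oU; have s1 : smC U (@z1 R) by exact: smC_z1.
have s2 : smC U (@z2 R) by exact: smC_z2.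
have c1 : smC U (fun q => conjc (z1 q)) by exact: smC_conj.
have c2 : smC U (fun q => conjc (z2 q)) by exact: smC_conj.
by rewrite /fa /fb /Ka /Kb /Kc; split; smc.
Qed.

(** The frame is given by one formula on the whole chart, where the identity holds at every point;
    the transverse coefficient of the bracket is the constant 2. *)
Lemma orbit_lie q :
  lie_bracket (fun q => pt (fa q) (fb q)) (fun q => pt ('i%C * fa q) ('i%C * fb q)) q =
  pt (2%:R * 'i%C * Kc q * fa q + 2%:C * Ta q) (2%:R * 'i%C * Kc q * fb q + 2%:C * Tb q).
Proof.
have [DKa DKb DKc] := isdC_K q; have D1 := isdC_z1 q; have D2 := isdC_z2 q.
have Ci := isdC_cst ('i%C : R[i]) q.
have Da := isdC_D DKa (isdC_N (isdC_M D1 DKc)).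
have Db := isdC_D DKb (isdC_N (isdC_M D2 DKc)).
have dX := isd_pt Da Db; have dY := isd_pt (isdC_M Ci Da) (isdC_M Ci Db).
rewrite (lie_isd dX dY) pt_opp pt_add !z1_pt !z2_pt.
have two : 2%:C = 2%:R :> R[i] by apply: cplx_eq => /=; ring.
have i2 : 'i%C * 'i%C = -1 :> R[i] by rewrite -expr2 sqr_i.
have ci : conjc 'i%C = - 'i%C :> R[i] by apply: cplx_eq => /=; rewrite ?oppr0.
have cf : conjc (Ka q + - (z1 q * Kc q)) = - Ka q + conjc (z1 q) * Kc q.
  rewrite /Ka /Kc; case: (z1 q) (z2 q) => ? ? [? ?]; apply: cplx_eq => /=; ring.
have cg : conjc (Kb q + - (z2 q * Kc q)) = - Kb q + conjc (z2 q) * Kc q.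
  rewrite /Kb /Kc; case: (z1 q) (z2 q) => ? ? [? ?]; apply: cplx_eq => /=; ring.
rewrite !conjcM cf cg ci two /fa /fb /Ta /Tb.
rewrite /Ka /Kb /Kc; move: (z1 q) (z2 q) (conjc (z1 q)) (conjc (z2 q)) => a b a' b'.
by congr pt; ring.
Qed.

End OrbitField.

(** The number is - det L_t = - ((1 - t) / 2)^2. *)
Lemma disc_neq0 (R : realType) (t : R) : 1 - t != 0 ->
  t%:C - ((1 + t) / 2 * ((1 + t) / 2))%:C != 0 :> R[i].
Proof.
move=> t2; have -> : t%:C - ((1 + t) / 2 * ((1 + t) / 2))%:C =
    (- ((1 - t) / 2 * ((1 - t) / 2)))%:C :> R[i].
  by rewrite -rmorphB; congr (_%:C); field.
by rewrite eq_complex /= negb_and oppr_eq0 !mulf_neq0 // invr_neq0 // pnatr_eq0.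
Qed.

(** * Invariants and differential of the orbit map *)

Section OrbitTangent.
Context {R : realType} (t : R).
Hypotheses (t0 : t != 0) (t1 : 1 + t != 0).

Let k := (1 + t) / 2.
Let l : R[i] := 0 +i* k.

(* The conjugates of the entries of g L adj(g). *)
Definition Na (p : 'rV[R]_(2 * 2)) := ada (ent 0 0 p) (ent 0 1 p) (ent 1 0 p) (ent 1 1 p) (- l) t%:C 1.
Definition Nb (p : 'rV[R]_(2 * 2)) := adb (ent 0 0 p) (ent 0 1 p) (ent 1 0 p) (ent 1 1 p) (- l) t%:C 1.
Definition Nc (p : 'rV[R]_(2 * 2)) := adc (ent 0 0 p) (ent 0 1 p) (ent 1 0 p) (ent 1 1 p) (- l) t%:C 1.

Lemma conj_M p : [/\ conjc (Ma t p) = Na p, conjc (Mb t p) = Nb p & conjc (Mc t p) = Nc p].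
Proof.
have cE i j : conjc (ent i j p) = ent i j p by apply: cplx_eq => //=; rewrite oppr0.
have cl : conjc l = - l by apply: cplx_eq => //=; rewrite oppr0.
have ct : conjc t%:C = t%:C by rewrite conjc_real.
by rewrite /Ma /Mb /Mc /Na /Nb /Nc /ada /adb /adc; split;
  rewrite !(conjcD, conjcM, conjcN, cE, ct, conjc1, conjc_nat, cl).
Qed.

Variable p : 'rV[R]_(2 * 2).
Hypothesis dp : \det (vec_mx p) = 1.

Lemma det_ent : ent 0 0 p * ent 1 1 p - ent 0 1 p * ent 1 0 p = 1.
Proof. by rewrite /ent -!rmorphM -rmorphB -det2E dp rmorph1. Qed.

Lemma Nc_neq0 : Nc p != 0.
Proof. by have [_ _ <-] := conj_M p; rewrite conjc_eq0 Mc_neq0. Qed.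

Lemma z_F : [/\ z1 (F t p) = Ma t p / Mc t p, z2 (F t p) = Mb t p / Mc t p,
  conjc (z1 (F t p)) = Na p / Nc p & conjc (z2 (F t p)) = Nb p / Nc p].
Proof.
have [ca cb cc] := conj_M p; rewrite /F z1_pt z2_pt /Fa /Fb; split=> //.
  by rewrite -ca -cc rmorphM fmorphV.
by rewrite -cb -cc rmorphM fmorphV.
Qed.

Lemma K_F : [/\ Ka (F t p) = (Nb p * Mc t p - Mb t p * Nc p) / (Mc t p * Nc p),
  Kb (F t p) = 2%:R * (Na p * Mb t p - Ma t p * Nb p) / (Mc t p * Nc p) &
  Kc (F t p) = 2%:R * (Nc p * Ma t p - Mc t p * Na p) / (Mc t p * Nc p)].
Proof.
have n0 := Nc_neq0; have m0 := Mc_neq0 t0 t1 dp; have [e1 e2 e3 e4] := z_F.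
rewrite /Ka /Kb /Kc e3 e4 e1 e2.
by split; field; rewrite m0 n0.
Qed.

(** By invariance of the trace form the value on g L adj(g) is the one on L_t; dividing by the
    square of the lower left entry passes to the chart. [H_F] is the same computation for L and conj
    L. *)
Lemma Q_F : Qf (F t p) = (t%:C - (k * k)%:C) / (Mc t p * Mc t p).
Proof.
have m0 := Mc_neq0 t0 t1 dp; have [e1 e2 _ _] := z_F; rewrite /Qf e1 e2.
have f := ad_form (ent 0 0 p) (ent 0 1 p) (ent 1 0 p) (ent 1 1 p) l t%:C 1 l t%:C 1.
rewrite det_ent -/(Ma t p) -/(Mb t p) -/(Mc t p) in f.
have ll : l * l = - (k * k)%:C by apply: cplx_eq => /=; ring.
have f' : Ma t p * Ma t p + Mb t p * Mc t p = t%:C - (k * k)%:C.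
  have h2 : (2%:R : R[i]) != 0 by rewrite pnatr_eq0.
  apply: (mulfI h2); transitivity (2%:R * (Ma t p * Ma t p) + Mb t p * Mc t p + Mc t p * Mb t p).
    by ring.
  by rewrite f ll; ring.
by rewrite -f'; field.
Qed.

Lemma H_F : Hf (F t p) = (t%:C + (k * k)%:C) / (Mc t p * Nc p).
Proof.
have n0 := Nc_neq0; have m0 := Mc_neq0 t0 t1 dp; have [e1 e2 e3 e4] := z_F.
rewrite /Hf e3 e4 e1 e2.
have f := ad_form (ent 0 0 p) (ent 0 1 p) (ent 1 0 p) (ent 1 1 p) l t%:C 1 (- l) t%:C 1.
rewrite det_ent -/(Ma t p) -/(Mb t p) -/(Mc t p) -/(Na p) -/(Nb p) -/(Nc p) in f.
have ll : l * - l = (k * k)%:C by apply: cplx_eq => /=; ring.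
transitivity ((2%:R * (Ma t p * Na p) + Mb t p * Nc p + Mc t p * Nb p) / (2%:R * (Mc t p * Nc p))).
  by field; rewrite m0 n0.
by rewrite f ll; field; rewrite m0 n0.
Qed.

(** The Gram determinant of L_t and its conjugate is (t - k^2)^2 - (t + k^2)^2 = - 4 t k^2. *)
Lemma fT_indep : 1 - t != 0 -> fa (F t p) * Tb (F t p) - fb (F t p) * Ta (F t p) != 0.
Proof.
move=> t2; have n0 := Nc_neq0; have m0 := Mc_neq0 t0 t1 dp.
have cQ : conjc (Qf (F t p)) = (t%:C - (k * k)%:C) / (Nc p * Nc p).
  have [_ _ cc] := conj_M p.
  rewrite Q_F conjcM conjc_inv conjcM cc; congr (_ * _).
  by apply: cplx_eq => /=; ring.
rewrite fT_det cQ Q_F H_F.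
have -> : 16%:R * 'i%C * ((t%:C - (k * k)%:C) / (Mc t p * Mc t p) * ((t%:C - (k * k)%:C) / (Nc p * Nc p)) -
  (t%:C + (k * k)%:C) / (Mc t p * Nc p) * ((t%:C + (k * k)%:C) / (Mc t p * Nc p))) *
  ((t%:C - (k * k)%:C) / (Mc t p * Mc t p)) =
  - (64%:R * 'i%C * (t%:C * (k * k)%:C) * (t%:C - (k * k)%:C)) / (Mc t p * Mc t p * Nc p * Nc p * Mc t p * Mc t p).
  by field; rewrite m0 n0.
have i0 : 'i%C != 0 :> R[i] by rewrite eq_complex /= oner_eq0 andbF.
have tk : t%:C - (k * k)%:C != 0 :> R[i] by exact: disc_neq0.
have kk : (k * k)%:C != 0 :> R[i].
  by rewrite eq_complex /= negb_and !mulf_neq0 // invr_neq0 // pnatr_eq0.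
have tC : t%:C != 0 :> R[i] by rewrite eq_complex /= negb_and t0.
by rewrite mulf_neq0 ?invr_neq0 ?oppr_eq0 ?mulf_neq0 // pnatr_eq0.
Qed.

(* (na, nb; nc, -na) is [xi, L] for xi = (x, y; z, -x). *)
Lemma dF_mul (x y z : R) (na := y%:C - t%:C * z%:C)
  (nb := 2%:R * (x%:C * t%:C - l * y%:C)) (nc := 2%:R * (z%:C * l - x%:C))
  (ad := fun h : R[i] -> R[i] -> R[i] -> R[i] -> R[i] -> R[i] -> R[i] -> R[i] =>
     h (ent 0 0 p) (ent 0 1 p) (ent 1 0 p) (ent 1 1 p) na nb nc) :
  'd (F t) p (mulr_vec (mx22 x y z (- x)) p) =
  pt ((ad ada - Ma t p / Mc t p * ad adc) / Mc t p)
     ((ad adb - Mb t p / Mc t p * ad adc) / Mc t p).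
Proof.
have m0 := Mc_neq0 t0 t1 dp; have [DA DB DC] := isdC_adj t p.
have [_ h] := isd_pt (isdC_M DA (isdC_V m0 DC)) (isdC_M DB (isdC_V m0 DC)).
have := congr1 (fun G => G (mulr_vec (mx22 x y z (- x)) p)) h.
rewrite -[X in X = _ -> _]/('d (F t) p (mulr_vec (mx22 x y z (- x)) p)) => ->.
have E i : ent i 0 (mulr_vec (mx22 x y z (- x)) p) = ent i 0 p * x%:C + ent i 1 p * z%:C /\
  ent i 1 (mulr_vec (mx22 x y z (- x)) p) = ent i 0 p * y%:C - ent i 1 p * x%:C.
  rewrite /ent /mulr_vec mxvecK !mul2E !mx22E -!rmorphM -rmorphD -rmorphB.
  by split=> //; rewrite mulrN.
have [e00 e01] := E 0; have [e10 e11] := E 1; rewrite e00 e01 e10 e11.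
have d1 := det_ent.
change (0 +i* ((1 + t) / 2)) with l.
rewrite /ad /ada /adb /adc /na /nb /nc; move: m0 {h E e00 e01 e10 e11 d1 DA DB DC ad na nb nc}.
move: (Ma t p) (Mb t p) (Mc t p) (ent 0 0 p) (ent 0 1 p) (ent 1 0 p) (ent 1 1 p).
move: x%:C y%:C z%:C t%:C (l) => X Y Z T' l' A B C p1 p2 p3 p4 m0.
by congr pt; field.
Qed.

Let PM1 := Nb p * Mc t p - Mb t p * Nc p.
Let PM2 := 2%:R * (Na p * Mb t p - Ma t p * Nb p).
Let PM3 := 2%:R * (Nc p * Ma t p - Mc t p * Na p).
Let adp (h : R[i] -> R[i] -> R[i] -> R[i] -> R[i] -> R[i] -> R[i] -> R[i]) :=
  h (ent 0 0 p) (ent 0 1 p) (ent 1 0 p) (ent 1 1 p).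

(** The matrix (0, - 4 l t; 4 l, 0) is [conj L_t, L_t], and conjugation by g takes it to the
    commutator of the conjugated matrices. *)
Lemma ad_PM : [/\ adp ada 0 (- (4%:R * l * t%:C)) (4%:R * l) = PM1,
  adp adb 0 (- (4%:R * l * t%:C)) (4%:R * l) = PM2 &
  adp adc 0 (- (4%:R * l * t%:C)) (4%:R * l) = PM3].
Proof.
have [] := ad_comm (ent 0 0 p) (ent 0 1 p) (ent 1 0 p) (ent 1 1 p) (- l) t%:C 1 l t%:C 1.
rewrite det_ent !mulr1 /adp.
have -> : t%:C - t%:C = 0 by rewrite subrr.
have -> : 2%:R * (- l * t%:C - l * t%:C) = - (4%:R * l * t%:C) by ring.
have -> : 2%:R * (1 * l - 1 * - l) = 4%:R * l by ring.
by move=> -> -> ->.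
Qed.

Lemma adp_scale h c x y z : h = ada \/ h = adb \/ h = adc ->
  adp h (c * x) (c * y) (c * z) = c * adp h x y z.
Proof. by move=> [|[]] ->; rewrite /adp /ada /adb /adc; ring. Qed.

Lemma aff_fa c : ((c * PM1 - Ma t p / Mc t p * (c * PM3)) / Mc t p = c * Nc p * fa (F t p)) *
  ((c * PM2 - Mb t p / Mc t p * (c * PM3)) / Mc t p = c * Nc p * fb (F t p)).
Proof.
have n0 := Nc_neq0; have m0 := Mc_neq0 t0 t1 dp.
have [e1 e2 _ _] := z_F; have [k1 k2 k3] := K_F.
rewrite /fa /fb k1 k2 k3 e1 e2 /PM1 /PM2 /PM3.
by split; field; rewrite m0 n0.
Qed.

(** With [Lre] = (L + conj L) / 2 and [Lim] = (L - conj L) / (2 i) one gets [[Lre], L] = [conj L, L]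
    / 2 and [[Lim], L] = i [conj L, L] / 2. Hence [dF_im] is i times [dF_re], which is the CR
    property of the orbit map. *)
Lemma dF_re : 'd (F t) p (mulr_vec (Lre t) p) =
  pt (2^-1 * Nc p * fa (F t p)) (2^-1 * Nc p * fb (F t p)).
Proof.
rewrite /Lre -[X in mx22 _ _ _ X]oppr0 dF_mul.
have -> : t%:C - t%:C * 1%:C = 2^-1 * 0 by rewrite mulr0 mulr1 subrr.
have -> : 2%:R * (0%:C * t%:C - l * t%:C) = 2^-1 * - (4%:R * l * t%:C) by field.
have -> : 2%:R * (1%:C * l - 0%:C) = 2^-1 * (4%:R * l) by field.
have [e1 e2 e3] := ad_PM.
rewrite -/(adp ada) -/(adp adb) -/(adp adc) !adp_scale; [|tauto..].
by rewrite e1 e2 e3 !aff_fa.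
Qed.

Lemma dF_im : 'd (F t) p (mulr_vec (Lim t) p) =
  pt ('i%C * (2^-1 * Nc p * fa (F t p))) ('i%C * (2^-1 * Nc p * fb (F t p))).
Proof.
rewrite /Lim dF_mul.
have -> : 0%:C - t%:C * 0%:C = ('i%C * 2^-1) * 0 :> R[i] by rewrite !mulr0 subrr.
have li : l = 'i%C * k%:C by apply: cplx_eq => /=; ring.
have i2 : 'i%C * 'i%C = -1 :> R[i] by rewrite -expr2 sqr_i.
have -> : 2%:R * (((1 + t) / 2)%:C * t%:C - l * 0%:C) = ('i%C * 2^-1) * - (4%:R * l * t%:C).
  transitivity (- ('i%C * 'i%C) * (2%:R * k%:C * t%:C)); first by rewrite i2 /k; ring.
  by rewrite li; field.
have -> : 2%:R * (0%:C * l - ((1 + t) / 2)%:C) = ('i%C * 2^-1) * (4%:R * l).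
  transitivity ('i%C * 'i%C * (2%:R * k%:C)); first by rewrite i2 /k; ring.
  by rewrite li; field.
have [e1 e2 e3] := ad_PM.
rewrite -/(adp ada) -/(adp adb) -/(adp adc) !adp_scale; [|tauto..].
by rewrite e1 e2 e3 !aff_fa !mulrA.
Qed.

(** The direction is [[Lre], [Lim]] = - i [conj L, L] / 2. Its commutator with L is half of - i
    [[conj L, L], L], so it maps to a positive multiple of ([Ta], [Tb]), Mc Nc being |Mc|^2. *)
Lemma dF_comm : 'd (F t) p (mulr_vec (mx22 0 (- (t * (1 + t))) (1 + t) 0) p) =
  pt (2^-1 * (Mc t p * Nc p) * Ta (F t p)) (2^-1 * (Mc t p * Nc p) * Tb (F t p)).
Proof.
rewrite -[X in mx22 _ _ _ X]oppr0 dF_mul.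
have li : l = 'i%C * k%:C by apply: cplx_eq => /=; ring.
have i2 : 'i%C * 'i%C = -1 :> R[i] by rewrite -expr2 sqr_i.
have k2 : (1 + t)%:C = 2%:R * k%:C by apply: cplx_eq => /=; rewrite /k; field.
have k3 : (- (t * (1 + t)))%:C = - (t%:C * (2%:R * k%:C)).
  by rewrite -k2 -rmorphM -rmorphN.
have -> : (- (t * (1 + t)))%:C - t%:C * (1 + t)%:C = (- 'i%C * 2^-1) * - (8%:R * l * t%:C).
  transitivity ('i%C * 'i%C * (4%:R * k%:C * t%:C)).
    by rewrite i2 k3 ?k2; ring.
  by rewrite li; field.
have -> : 2%:R * (0%:C * t%:C - l * (- (t * (1 + t)))%:C) = (- 'i%C * 2^-1) * (8%:R * l * l * t%:C).
  transitivity (- ('i%C * 'i%C) * (4%:R * k%:C * l * t%:C)).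
    by rewrite i2 k3 ?k2; ring.
  by rewrite {2}li; field.
have -> : 2%:R * ((1 + t)%:C * l - 0%:C) = (- 'i%C * 2^-1) * (8%:R * l * l).
  transitivity (- ('i%C * 'i%C) * (4%:R * k%:C * l)).
    by rewrite i2 k2; ring.
  by rewrite {2}li; field.
rewrite -/(adp ada) -/(adp adb) -/(adp adc) !adp_scale; [|tauto..].
have [e1 e2 e3] := ad_PM.
have [] := ad_comm (ent 0 0 p) (ent 0 1 p) (ent 1 0 p) (ent 1 1 p)
  0 (- (4%:R * l * t%:C)) (4%:R * l) l t%:C 1.
rewrite det_ent !mulr1 -/(adp ada) -/(adp adb) -/(adp adc) e1 e2 e3.
rewrite /adp -/(Ma t p) -/(Mb t p) -/(Mc t p) -/(adp ada) -/(adp adb) -/(adp adc).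
have -> : - (4%:R * l * t%:C) - t%:C * (4%:R * l) = - (8%:R * l * t%:C) by ring.
have -> : 2%:R * (0 * t%:C - l * - (4%:R * l * t%:C)) = 8%:R * l * l * t%:C by ring.
have -> : 2%:R * (4%:R * l * l - 1 * 0) = 8%:R * l * l by ring.
move=> -> -> ->.
have n0 := Nc_neq0; have m0 := Mc_neq0 t0 t1 dp.
have [f1 f2 _ _] := z_F; have [g1 g2 g3] := K_F.
rewrite /Ta /Tb g1 g2 g3 f1 f2 /PM1 /PM2 /PM3.
by congr pt; field; rewrite m0 n0.
Qed.

End OrbitTangent.

(** * A smooth complex square root on the right half-plane *)

Section ComplexSqrt.
Context {R : realType}.

(** The real part sqrt((|w| + Re w) / 2) of the principal root, positive for Re w > 0, so that
    dividing by it in [sqC] keeps the root smooth there. *)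
Definition sqre (w : R[i]) : R := Num.sqrt ((Num.sqrt (Re w * Re w +
  Im w * Im w) + Re w) / 2).
Definition sqC (w : R[i]) : R[i] := sqre w +i* (Im w / (2 * sqre w)).

Lemma sqre_gt0 w : 0 < Re w -> 0 < sqre w.
Proof. by move=> h; rewrite sqrtr_gt0 divr_gt0 // ltr_wpDl ?sqrtr_ge0. Qed.

Lemma sqC_sqr w : 0 < Re w -> sqC w * sqC w = w.
Proof.
move=> h; have u0 := sqre_gt0 h; have un : sqre w != 0 by rewrite gt_eqF.
set n := Num.sqrt (Re w * Re w + Im w * Im w).
have nn : n * n = Re w * Re w + Im w * Im w.
  by rewrite -expr2 sqr_sqrtr // addr_ge0 // -expr2 sqr_ge0.
have uu : sqre w * sqre w = (n + Re w) / 2.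
  by rewrite -expr2 sqr_sqrtr // divr_ge0 // addr_ge0 ?sqrtr_ge0 // ltW.
rewrite /sqC; apply: cplx_eq => /=; last by field.
have vv : Im w / (2 * sqre w) * (Im w / (2 * sqre w)) = (n - Re w) / 2.
  transitivity (Im w * Im w / (4 * (sqre w * sqre w))); first by field.
  have -> : Im w * Im w = (n - Re w) * (n + Re w).
    by rewrite -[LHS](addKr (Re w * Re w)) -nn; ring.
  have n1 : n + Re w != 0 by rewrite gt_eqF // ltr_wpDl ?sqrtr_ge0.
  by rewrite uu; field.
by rewrite vv uu; field.
Qed.

Lemma sqC1 : sqC 1 = 1.
Proof.
rewrite /sqC /sqre /= mulr0 mulr1 addr0 sqrtr1 mul0r.
by rewrite (_ : (1 + 1) / 2 = 1) ?sqrtr1 //; field.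
Qed.

Lemma smC_sqC (E : normedModType R) (U : set E) (f : E -> R[i]) : open U ->
  (forall x, U x -> 0 < Re (f x)) -> smC U f -> smC U (fun x => sqC (f x)).
Proof.
move=> oU f0 sf d; have [f1 f2] := sf d.
have un : Ck d U (fun x => sqre (f x)).
  apply: (Ck_sqrt oU) => [x Ux|].
    by rewrite divr_gt0 // ltr_wpDl ?sqrtr_ge0 ?f0.
  apply: (CkM oU); last exact: Ck_cst.
  apply: (CkD oU) => //; apply: (Ck_sqrt oU) => [x Ux|].
    rewrite lt_def sqnorm_neq0 -?expr2 ?addr_ge0 ?sqr_ge0 //.
    by apply/eqP => e; have := f0 x Ux; rewrite e ltxx.
  by apply: (CkD oU); apply: (CkM oU).
split=> //; apply: (CkM oU) => //; apply: (CkV oU) => [x Ux|].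
  by rewrite mulf_neq0 ?pnatr_eq0 // gt_eqF // sqre_gt0 // f0.
by apply: (CkM oU) => //; exact: Ck_cst.
Qed.

End ComplexSqrt.

(** * Smooth local sections of the orbit map *)

Section LocalSection.
Context {R : realType} (t : R).
Hypotheses (t0 : t != 0) (t1 : 1 + t != 0).

Let k := (1 + t) / 2.

Section Algebra.
Variables (xa xb xc ya yb yc m1 m2 : R).

(* With X = (xa, xb; xc, -xa) and Y = (ya, yb; yc, -ya), the vector
   e = (Y + k) m is an eigenvector of Y, and the matrix with columns e and X e
   conjugates (0, t; 1, 0) to X and diag(k, -k) to Y. *)
Definition ev1 := (ya + k) * m1 + yb * m2.
Definition ev2 := yc * m1 + (k - ya) * m2.
Definition fv1 := xa * ev1 + xb * ev2.
Definition fv2 := xc * ev1 - xa * ev2.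
Definition dv := ev1 * fv2 - fv1 * ev2.

Lemma ad_section : xa * xa + xb * xc = t -> ya * ya + yb * yc = k * k ->
  2 * (xa * ya) + xb * yc + yb * xc = 0 ->
  [/\ fv1 * fv2 - t * (ev1 * ev2) = dv * xa,
      t * (ev1 * ev1) - fv1 * fv1 = dv * xb,
      fv2 * fv2 - t * (ev2 * ev2) = dv * xc,
      k * (ev1 * fv2 + fv1 * ev2) = dv * ya &
      - (2 * k * (ev1 * fv1)) = dv * yb /\ 2 * k * (ev2 * fv2) = dv * yc].
Proof.
move=> r1 r2 r3.
have E1 : ya * ev1 + yb * ev2 = k * ev1.
  transitivity ((ya * ya + yb * yc) * m1 + k * (ya * m1 + yb * m2)); rewrite /ev1 /ev2; first by ring.
  by rewrite r2; ring.
have E2 : yc * ev1 - ya * ev2 = k * ev2.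
  transitivity ((ya * ya + yb * yc) * m2 + k * (yc * m1 - ya * m2)); rewrite /ev1 /ev2; first by ring.
  by rewrite r2; ring.
have F1 : ya * fv1 + yb * fv2 = - k * fv1.
  transitivity ((2 * (xa * ya) + xb * yc + yb * xc) * ev1 - (xa * (ya * ev1 + yb * ev2) + xb * (yc * ev1 - ya * ev2))).
    by rewrite /fv1 /fv2; ring.
  by rewrite r3 E1 E2 /fv1; ring.
have F2 : yc * fv1 - ya * fv2 = - k * fv2.
  transitivity ((2 * (xa * ya) + xb * yc + yb * xc) * ev2 - (xc * (ya * ev1 + yb * ev2) - xa * (yc * ev1 - ya * ev2))).
    by rewrite /fv1 /fv2; ring.
  by rewrite r3 E1 E2 /fv2; ring.
split; [| | | |split].
- by rewrite -r1 /dv /fv1 /fv2; ring.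
- by rewrite -r1 /dv /fv1 /fv2; ring.
- by rewrite -r1 /dv /fv1 /fv2; ring.
- rewrite /dv; transitivity ((ya * ev1 + yb * ev2) * fv2 - (ya * fv1 + yb * fv2) * ev2); last by ring.
  by rewrite E1 F1; ring.
- rewrite /dv; transitivity (ev1 * (ya * fv1 + yb * fv2) - fv1 * (ya * ev1 + yb * ev2)); last by ring.
  by rewrite E1 F1; ring.
- rewrite /dv; transitivity (fv2 * (yc * ev1 - ya * ev2) - ev2 * (yc * fv1 - ya * fv2)); last by ring.
  by rewrite E2 F2; ring.
Qed.

End Algebra.

Section Formula.
Variables (mu : R[i]) (m1 m2 : R) (q : 'rV[R]_(2 + 2)).

Let xa := Re (mu * z1 q).
Let xb := Re (mu * z2 q).
Let xc := Re mu.
Let ya := Im (mu * z1 q).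
Let yb := Im (mu * z2 q).
Let yc := Im mu.

Definition sec_det : R := dv xa xb xc ya yb yc m1 m2.

(** Dividing by the square root of the determinant brings the matrix into SL_2(R), which is why
    [sec_det] has to be positive and not only nonzero. *)
Definition sec : 'rV[R]_(2 * 2) :=
  mxvec (mx22 (ev1 ya yb m1 m2 / Num.sqrt sec_det) (fv1 xa xb ya yb yc m1 m2 / Num.sqrt sec_det)
    (ev2 ya yc m1 m2 / Num.sqrt sec_det) (fv2 xa xc ya yb yc m1 m2 / Num.sqrt sec_det)).

End Formula.

(** For X + i Y = mu (z1, z2; 1, -z1), the first hypothesis gives X^2 - Y^2 = t - k^2 and X Y + Y X
    = 0 as its real and imaginary parts, and the second gives X^2 + Y^2 = t + k^2. *)
Lemma sec_rel mu q : mu * mu * Qf q = t%:C - (k * k)%:C ->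
  mu * conjc mu * Hf q = t%:C + (k * k)%:C ->
  let xa := Re (mu * z1 q) in let xb := Re (mu * z2 q) in
  let xc := Re mu in let ya := Im (mu * z1 q) in
  let yb := Im (mu * z2 q) in let yc := Im mu in
  [/\ xa * xa + xb * xc = t, ya * ya + yb * yc = k * k &
      2 * (xa * ya) + xb * yc + yb * xc = 0].
Proof.
move=> hQ hH /=.
have {}hQ : (mu * z1 q) * (mu * z1 q) + (mu * z2 q) * mu = (t - k * k)%:C.
  by rewrite rmorphB -hQ /Qf; ring.
have {}hH : (mu * z1 q) * conjc (mu * z1 q) + ((mu * z2 q) * conjc mu + mu * conjc (mu * z2 q)) / 2%:R
    = (t + k * k)%:C.
  by rewrite rmorphD -hH /Hf !rmorphM /=; field.
move: hQ hH; case: mu (mu * z1 q) (mu * z2 q) => c c' [a a'] [b b'] /= hQ hH.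
have := congr1 (@Re R) hQ; have := congr1 (@Im R) hQ.
have {hH} : a * a + a' * a' + (b * c + b' * c') = t + k * k.
  have := congr1 (fun z => Re z) hH.
  have -> : (a +i* a') * (a -i* a') + ((b +i* b') * (c -i* c') + (c +i* c') * (b -i* b')) / 2%:R =
    (a * a + a' * a' + (b * c + b' * c'))%:C.
    have h2 : (2%:R : R[i]) != 0 by rewrite pnatr_eq0.
    apply: (mulIf h2); rewrite mulrDl divfK //.
    by apply: cplx_eq => /=; ring.
  by [].
by move=> /= h1 h2 h3; split; lra.
Qed.

Lemma sec_correct mu m1 m2 q : mu != 0 ->
  mu * mu * Qf q = t%:C - (k * k)%:C -> mu * conjc mu * Hf q = t%:C + (k * k)%:C ->
  0 < sec_det mu m1 m2 q ->
  \det (vec_mx (sec mu m1 m2 q)) = 1 /\ F t (sec mu m1 m2 q) = q.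
Proof.
move=> mu0 hQ hH; have [r1 r2 r3] := sec_rel hQ hH.
rewrite /sec /sec_det; set d := dv _ _ _ _ _ _ _ _ => d0.
have s0 : Num.sqrt d != 0 by rewrite gt_eqF // sqrtr_gt0.
have ss : Num.sqrt d * Num.sqrt d = d by rewrite -expr2 sqr_sqrtr // ltW.
have [] := ad_section m1 m2 r1 r2 r3; rewrite -/d.
set e1 := ev1 _ _ _ _; set e2 := ev2 _ _ _ _; set f1 := fv1 _ _ _ _ _ _ _.
set f2 := fv2 _ _ _ _ _ _ _ => h1 h2 h3 h4 [h5 h6].
have dE : d = e1 * f2 - f1 * e2 by [].
set s := Num.sqrt d in s0 ss *.
split.
  rewrite det2E mxvecK !mx22E; transitivity ((e1 * f2 - f1 * e2) / (s * s)); first by field.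
  by rewrite -dE ss divff // gt_eqF.
have eqn (x y : R) : y = d * x -> y / (s * s) = x.
  by move=> ->; rewrite ss mulrC mulKf // gt_eqF.
set p := mxvec _.
have [MA MB MC] : [/\ Ma t p = mu * z1 q, Mb t p = mu * z2 q & Mc t p = mu].
  have [g1 [g2 [g3 [g4 [g5 g6]]]]] := (eqn _ _ h1, (eqn _ _ h2, (eqn _ _ h3, (eqn _ _ h4, (eqn _ _ h5, eqn _ _ h6))))).
  rewrite /Ma /Mb /Mc /ada /adb /adc /ent /p mxvecK !mx22E.
  split; apply: cplx_eq; rewrite -?g1 -?g2 -?g3 -?g4 -?g5 -?g6 /= /k;
    move: s0; clearbody s e1 e2 f1 f2; move=> s0; by field.
rewrite /F /Fa /Fb MA MB MC -[RHS]pt_z.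
by congr pt; rewrite mulrAC divff // mul1r.
Qed.

Lemma Ck_mx22 (E : normedModType R) d (U : set E) (a b c e : E -> R) : open U ->
  Ck d U a -> Ck d U b -> Ck d U c -> Ck d U e ->
  Ck d U (fun y => mxvec (mx22 (a y) (b y) (c y) (e y)) : 'rV[R]_(2 * 2)).
Proof.
move=> oU ha hb hc he; apply/Ck_rowP => // i.
case/mxvec_indexP: i => i j; case: (ord2P i) => ->; case: (ord2P j) => ->.
- by apply: Ck_eq ha => // y _; rewrite mxvecE mx22E.
- by apply: Ck_eq hb => // y _; rewrite mxvecE mx22E.
- by apply: Ck_eq hc => // y _; rewrite mxvecE mx22E.
- by apply: Ck_eq he => // y _; rewrite mxvecE mx22E.
Qed.

(** The invariant [Qf] gives back the scale mu of the matrix on the line up to sign. Continuing mu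
    from its value at the base point fixes the sign smoothly, and then the formula [sec] applies as
    long as its determinant stays positive. *)
Lemma local_section p0 : \det (vec_mx p0) = 1 -> 1 - t != 0 ->
  exists (O : set 'rV[R]_(2 + 2)) (s : 'rV[R]_(2 + 2) -> 'rV[R]_(2 * 2)),
    [/\ O (F t p0), smooth O s & forall q, O q -> orb t q ->
       \det (vec_mx (s q)) = 1 /\ F t (s q) = q].
Proof.
move=> dp0 t2; pose Q0 := Qf (F t p0); pose M0 := Mc t p0.
have M00 : M0 != 0 by exact: Mc_neq0.
have tk : t%:C - (k * k)%:C != 0 :> R[i] by exact: disc_neq0.
have QM p : \det (vec_mx p) = 1 -> Qf (F t p) * (Mc t p * Mc t p) = t%:C - (k * k)%:C.
  by move=> dp; rewrite (Q_F t0 t1 dp) divfK // mulf_neq0 // Mc_neq0.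
have Qn0 p : \det (vec_mx p) = 1 -> Qf (F t p) != 0.
  by move=> dp; apply: contra tk => /eqP e; rewrite -(QM p dp) e mul0r.
have oT : open (setT : set 'rV[R]_(2 + 2)) by exact: openT.
have s1 := smC_z1 oT; have s2 := smC_z2 oT.
have sQ : smC setT (@Qf R) by apply: smC_D => //; apply: smC_M.
pose U1 := [set q : 'rV[R]_(2 + 2) | setT q /\ Qf q != 0].
have oU1 : open U1 by exact: open_neq0C.
have sr : smC U1 (fun q => Q0 * (Qf q)^-1).
  apply: (smC_M oU1); first exact: smC_cst.
  by apply: (smC_V oU1) => [q []//|]; apply: smC_sub sQ.
pose U2 := [set q | U1 q /\ 0 < Re (Q0 * (Qf q)^-1)].
have oU2 : open U2 by apply: open_ngt0 => // d; have [] := sr d.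
(* The root is taken of Q0 / Qf, equal to 1 at the base point, so the principal branch applies
   nearby and mu takes the value M0 there. *)
pose mu q := M0 * sqC (Q0 * (Qf q)^-1).
have smu : smC U2 mu.
  apply: (smC_M oU2); first exact: smC_cst.
  by apply: (smC_sqC oU2) => [q []//|]; apply: smC_sub sr => q [].
have sm1 : smC U2 (fun q => mu q * z1 q).
  by apply: (smC_M oU2) => //; apply: smC_sub s1.
have sm2 : smC U2 (fun q => mu q * z2 q).
  by apply: (smC_M oU2) => //; apply: smC_sub s2.
(* The first column of p0 is a k-eigenvector of Y at the base point, so Y + k multiplies it by 2 k
   and does not kill it. *)
pose m1 : R := vec_mx p0 0 0; pose m2 : R := vec_mx p0 1 0.
have C d (c : R) : Ck d U2 (fun=> c) by exact: Ck_cst.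
have ce1 d : Ck d U2 (fun q => ev1 (Im (mu q * z1 q)) (Im (mu q * z2 q)) m1 m2).
  apply: (CkD oU2); apply: (CkM oU2) => //; last exact: (sm2 d).2.
  by apply: (CkD oU2) => //; exact: (sm1 d).2.
have ce2 d : Ck d U2 (fun q => ev2 (Im (mu q * z1 q)) (Im (mu q)) m1 m2).
  apply: (CkD oU2); apply: (CkM oU2) => //; first exact: (smu d).2.
  by apply: (CkD oU2) => //; apply: (CkN oU2); exact: (sm1 d).2.
have cf1 d : Ck d U2 (fun q => fv1 (Re (mu q * z1 q)) (Re (mu q * z2 q))
   (Im (mu q * z1 q)) (Im (mu q * z2 q)) (Im (mu q)) m1 m2).
  by apply: (CkD oU2); apply: (CkM oU2) => //; [exact: (sm1 d).1 | exact: (sm2 d).1].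
have cf2 d : Ck d U2 (fun q => fv2 (Re (mu q * z1 q)) (Re (mu q))
   (Im (mu q * z1 q)) (Im (mu q * z2 q)) (Im (mu q)) m1 m2).
  apply: (CkD oU2); first by apply: (CkM oU2) => //; exact: (smu d).1.
  by apply: (CkN oU2); apply: (CkM oU2) => //; exact: (sm1 d).1.
have cdet d : Ck d U2 (fun q => sec_det (mu q) m1 m2 q).
  by apply: (CkD oU2); [|apply: (CkN oU2)]; apply: (CkM oU2).
pose O := [set q | U2 q /\ 0 < sec_det (mu q) m1 m2 q].
have oO : open O by exact: open_ngt0.
exists O, (fun q => sec (mu q) m1 m2 q).
have mu2 q : U2 q -> mu q * mu q * Qf q = t%:C - (k * k)%:C.
  move=> [[_ q0] q1]; rewrite -(QM p0 dp0) /mu.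
  transitivity (M0 * M0 * (sqC (Q0 / Qf q) * sqC (Q0 / Qf q)) * Qf q); first by ring.
  by rewrite sqC_sqr // /Q0 /M0; field.
split.
- have U2F : U2 (F t p0).
    by split; [split=> //; exact: Qn0 | rewrite divff ?Qn0 //=].
  split=> //; have mu0 : mu (F t p0) = M0 by rewrite /mu divff ?Qn0 // sqC1 mulr1.
  rewrite mu0; have [e1 e2 _ _] := z_F t p0.
  have d1 : m1 * vec_mx p0 1 1 - vec_mx p0 0 1 * m2 = 1 by rewrite -dp0 det2E.
  rewrite /sec_det e1 e2 ![M0 * (_ / _)]mulrC !divfK //.
  (* Kept as a variable so that the determinant becomes a polynomial identity in the entries of p0;
     at D = 1 it is 4 k^2 > 0. *)
  pose D := m1 * vec_mx p0 1 1 - vec_mx p0 0 1 * m2.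
  suff -> : dv (Re (Ma t p0)) (Re (Mb t p0)) (Re M0)
     (Im (Ma t p0)) (Im (Mb t p0)) (Im M0) m1 m2 =
     k * k * ((1 + D) * (1 + D)) * (D * D).
    rewrite /D d1 !mulr1 (_ : 1 + 1 = 2) // -!expr2 -exprMn exprn_even_gt0 //=.
    by rewrite !mulf_neq0 // ?invr_neq0 ?pnatr_eq0.
  rewrite /M0 /Ma /Mb /Mc /ada /adb /adc /ent /dv /fv1 /fv2 /ev1 /ev2 /D.
  rewrite -/m1 -/m2 /=; move: (m1) (m2) (vec_mx p0 0 1) (vec_mx p0 1 1) => m1' m2' m3' m4'.
  by rewrite -/k; ring.
- split=> // d.
  have subO (h : 'rV[R]_(2 + 2) -> R) : Ck d U2 h -> Ck d O h by apply: Ck_sub => q [].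
  have cs : Ck d O (fun q => (Num.sqrt (sec_det (mu q) m1 m2 q))^-1).
    apply: (CkV oO) => [q [_ h]|]; first by rewrite gt_eqF // sqrtr_gt0.
    by apply: (Ck_sqrt oO) => [q []//|]; exact: subO.
  by apply: Ck_mx22 => //; apply: (CkM oO) cs; apply: subO.
- move=> q [U2q dq] [p sp pq]; have dp := sl2W_det sp.
  have mu2q := mu2 q U2q; have [[_ q0] _] := U2q.
  have mun0 : mu q != 0.
    by apply: contra tk => /eqP e; rewrite -mu2q e !mul0r.
  apply: sec_correct => //.
  have m2E : mu q * mu q = Mc t p * Mc t p.
    by apply: (mulIf q0); rewrite mu2q -(QM p dp) pq mulrC.
  (* On the orbit mu and [Mc] agree up to sign, which disappears from the product with the
     conjugate; the normalisation of [Hf] thus carries over. *)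
  have -> : mu q * conjc (mu q) = Mc t p * conjc (Mc t p).
    have /eqP : (mu q - Mc t p) * (mu q + Mc t p) = 0.
      by transitivity (mu q * mu q - Mc t p * Mc t p); [ring | rewrite m2E subrr].
    rewrite mulf_eq0 subr_eq0 addr_eq0 => /orP[] /eqP -> //.
    by rewrite rmorphN mulrNN.
  have [_ _ ->] := conj_M t p.
  by rewrite -pq (H_F t0 t1 dp) mulrC divfK // mulf_neq0 ?Mc_neq0 // Nc_neq0.
Qed.

End LocalSection.

(** * Composition of flat diffeomorphisms and right translations of SL_2(R) *)

Section FdiffeoOps.
Context {R : realType}.

Lemma fdiffeo_comp m n p (A : set 'rV[R]_m) (B : set 'rV[R]_n) (C : set 'rV[R]_p) F1 G1 F2 G2 :
  fdiffeo A B F1 G1 -> fdiffeo B C F2 G2 ->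
  fdiffeo A C (fun x => F2 (F1 x)) (fun y => G1 (G2 y)).
Proof.
move=> [[U1 AU1 sF1] [[V1 BV1 sG1] [FB1 GA1]]] [[U2 BU2 sF2] [[V2 CV2 sG2] [FB2 GA2]]].
split; first exists (U1 `&` F1 @^-1` U2).
- by move=> x Ax; split; [exact: AU1 | apply: BU2; have [] := FB1 x Ax].
- exact: smooth_comp.
split; first exists (V2 `&` G2 @^-1` V1).
- by move=> x Cx; split; [exact: CV2 | apply: BV1; have [] := GA2 x Cx].
- exact: smooth_comp.
split=> [x Ax|y Cy].
  have [B1 e1] := FB1 x Ax; have [C2 e2] := FB2 _ B1.
  by rewrite e2 e1.
have [B1 e1] := GA2 y Cy; have [A1 e2] := GA1 _ B1.
by rewrite e2 e1.
Qed.

Lemma sl2W_setI (U : set 'rV[R]_(2 * 2)) : sl2W setT `&` U = sl2W U.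
Proof. by apply/seteqP; split=> p; [case=> -[] | case]. Qed.

Lemma SL2_setI (U : set 'rV[R]_(2 * 2)) :
  SL2 R `&` (par (M2R R) tt @` U) = par (M2R R) tt @` sl2W U.
Proof. by rewrite SL2_par (par_setI good_M2R) sl2W_setI. Qed.

Lemma detb_mulr_vec (A B : 'M[R]_2) p : \det (vec_mx p) = 1 ->
  detb (mulr_vec A p) (mulr_vec B p) = detb (mxvec A) (mxvec B).
Proof.
rewrite det2E => dp; transitivity ((vec_mx p 0 0 * vec_mx p 1 1 - vec_mx p 0 1 * vec_mx p 1 0) *
  detb (mxvec A) (mxvec B)); last by rewrite dp mul1r.
by rewrite /detb /mulr_vec !mxvecK !mul2E; field.
Qed.

Lemma det_mulr_vec (A : 'M[R]_2) p : \det (vec_mx (mulr_vec A p)) = \det (vec_mx p) * \det A.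
Proof. by rewrite /mulr_vec mxvecK det_mulmx. Qed.

Lemma sl2WT (p : 'rV[R]_(2 * 2)) : \det (vec_mx p) = 1 -> sl2W setT p.
Proof. by move=> dp; split=> //; rewrite /= detbE. Qed.

Lemma Ck_entry (E : normedModType R) d (U : set E) (f : E -> 'rV[R]_(2 * 2)) i j : open U ->
  Ck d U f -> Ck d U (fun x => vec_mx (f x) i j).
Proof.
move=> oU /(Ck_rowP _ _ oU) /(_ (mxvec_index i j)) h.
by apply: Ck_eq h => // x _; rewrite mxE.
Qed.

Lemma Ck_detb (E : normedModType R) d (U : set E) (f g : E -> 'rV[R]_(2 * 2)) : open U ->
  Ck d U f -> Ck d U g -> Ck d U (fun x => detb (f x) (g x)).
Proof.
move=> oU hf hg; have Hf i j := Ck_entry i j oU hf; have Hg i j := Ck_entry i j oU hg.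
apply: (CkM oU); last exact: Ck_cst.
apply: (CkD oU); last by apply: (CkN oU); exact: (CkM oU).
apply: (CkD oU); last by apply: (CkN oU); exact: (CkM oU).
by apply: (CkD oU); exact: (CkM oU).
Qed.

Lemma smooth_id n : smooth (setT : set 'rV[R]_n) id.
Proof. by split=> [|k]; [exact: openT | apply: Ck_isd_lin => [|x]; [exact: openT | exact: isd_id]]. Qed.

Lemma smooth_mulr_vec M : smooth setT (mulr_vec M : 'rV[R]_(2 * 2) -> 'rV[R]_(2 * 2)).
Proof. by split=> [|k]; [exact: openT | apply: Ck_isd_lin => [|x]; [exact: openT | exact: isd_mulr_vec]]. Qed.

End FdiffeoOps.

(** * The orbit map as a covering, given the right translations preserving it *)

Section OrbitCover.
Context {R : realType} (t : R).
Hypotheses (t0 : t != 0) (t1 : 1 + t != 0) (t2 : 1 - t != 0).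

Section DeckGroup.
(** The elements of SL_2(R) that fix the line [L_t], enumerated without repetition and acting by
    right translation. Both signs of t share the covering argument through the four hypotheses. *)
Variables (d : nat) (gam : 'I_d -> 'M[R]_2).
Hypothesis gam_det : forall i, \det (gam i) = 1.
Hypothesis gam_F : forall i p, \det (vec_mx p) = 1 -> F t (mulr_vec (gam i) p) = F t p.
Hypothesis gam_fib : forall p q, \det (vec_mx p) = 1 -> \det (vec_mx q) = 1 ->
  F t p = F t q -> exists i, q = mulr_vec (gam i) p.
Hypothesis gam_sep : forall i j, i != j -> detb (mxvec (gam i)) (mxvec (gam j)) <= 0.

Section Sheets.
Variables (O : set 'rV[R]_(2 + 2)) (s : 'rV[R]_(2 + 2) -> 'rV[R]_(2 * 2)).
Hypothesis sO : smooth O s.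
Hypothesis s_sec : forall q, O q -> orb t q -> \det (vec_mx (s q)) = 1 /\ F t (s q) = q.

(* det polarizes to detb, and on a fibre detb is 1 on the diagonal and at most 0
   off it, so the threshold 1/2 separates the sheets. *)
Definition sheet i : set 'rV[R]_(2 * 2) :=
  [set p | (Fdom t p /\ O (F t p)) /\ 0 < detb (mulr_vec (gam i) (s (F t p))) p - 1 / 2].

Lemma open_sheet i : open (sheet i).
Proof.
have oO : open O := sO.1.
have sF := smooth_F t; have sFs := smooth_comp sF sO.
have oV : open (Fdom t `&` F t @^-1` O) := sFs.1.
apply: (open_ngt0 oV) => k.
apply: (CkD oV); last exact: Ck_cst.
apply: (Ck_detb oV).
  have h := smooth_comp sFs (smooth_mulr_vec (gam i)).
  by apply: Ck_sub (h.2 k) => p Vp; split.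
by apply: Ck_sub ((@smooth_id R _).2 k).
Qed.

Lemma sheetP i p : sl2W (sheet i) p <->
  [/\ \det (vec_mx p) = 1, O (F t p) & p = mulr_vec (gam i) (s (F t p))].
Proof.
split=> [sp|[dp Op e]].
  have dp := sl2W_det sp; have [_ [[_ Op] lt]] := sp; split=> //.
  have [ds Fs] := s_sec Op (ex_intro2 _ _ p (sl2WT dp) erefl).
  have [j e] := gam_fib ds dp Fs; have [-> //|ij] := eqVneq i j.
  have := gam_sep ij; rewrite -(detb_mulr_vec _ _ ds) -e.
  by move=> le; have : 0 < 0 :> R by [apply: lt_le_trans lt _; lra]; rewrite ltxx.
split; first by rewrite /= detbE.
split; first by split=> //; exact: (sl2W_Fdom t0 t1 (sl2WT dp)).
by rewrite -e detbE dp; lra.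
Qed.

Lemma sheet_fdiffeo i :
  fdiffeo (sl2W (sheet i)) (orb t `&` O) (F t) (fun q => mulr_vec (gam i) (s q)).
Proof.
split; first by exists (Fdom t); [exact: sl2W_Fdom | exact: smooth_F].
split.
  exists (O `&` s @^-1` setT); first by move=> q [_ Oq].
  by apply: (smooth_comp sO); exact: smooth_mulr_vec.
split=> [p /sheetP[dp Op e]|q [oq Oq]].
  by rewrite -e; split=> //; split=> //; exists p => //; exact: sl2WT.
have [ds Fs] := s_sec Oq oq.
have Fg : F t (mulr_vec (gam i) (s q)) = q by rewrite gam_F.
split=> //; apply/sheetP; rewrite Fg; split=> //.
by rewrite det_mulr_vec ds gam_det mulr1.
Qed.

Lemma sheet_cover p : \det (vec_mx p) = 1 -> O (F t p) -> exists i, sl2W (sheet i) p.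
Proof.
move=> dp Op; have [ds Fs] := s_sec Op (ex_intro2 _ _ p (sl2WT dp) erefl).
by have [i e] := gam_fib ds dp Fs; exists i; apply/sheetP.
Qed.

Lemma sheet_disj i j p : sl2W (sheet i) p -> sl2W (sheet j) p -> i = j.
Proof.
move=> /sheetP[dp Op ei] /sheetP[_ _ ej].
have [ds _] := s_sec Op (ex_intro2 _ _ p (sl2WT dp) erefl).
apply/eqP; apply: contraT => /gam_sep; rewrite -(detb_mulr_vec _ _ ds) -ei -ej detbE dp.
by rewrite ler10.
Qed.

End Sheets.

Lemma orbit_local p0 : \det (vec_mx p0) = 1 ->
  exists (i : 'I_d) (O : set 'rV[R]_(2 + 2)) (s : 'rV[R]_(2 + 2) -> 'rV[R]_(2 * 2)),
  [/\ O (F t p0), smooth O s, (forall q, O q -> orb t q -> \det (vec_mx (s q)) = 1 /\ F t (s q) = q)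
   & sl2W (sheet O s i) p0].
Proof.
move=> dp; have [ O [s [Op sO sec]]] := local_section t0 t1 dp t2.
by have [i ip] := sheet_cover sec dp Op; exists i, O, s.
Qed.

Lemma ftangent_open n (A W : set 'rV[R]_n) p u : open W -> W p ->
  ftangent A p u -> ftangent (A `&` W) p u.
Proof.
move=> oW Wp [D [c [D0 sc cA c0 dc]]]; exists (D `&` c @^-1` W), c; split=> //.
- by split=> //=; rewrite c0.
- split; first exact: smooth_open.
  by move=> k; apply: Ck_sub (sc.2 k) => x [].
- by move=> x [Dx Wx]; split=> //; exact: cA.
Qed.

Lemma dF_comb (p : 'rV[R]_(2 * 2)) (a b c : R) : \det (vec_mx p) = 1 ->
  'd (F t) p (mulr_vec (a *: Lre t + b *: Lim t + c *: mx22 0 (- (t * (1 + t))) (1 + t) 0) p) =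
  pt ((a%:C + b%:C * 'i%C) * (2^-1 * Nc t p) * fa (F t p) + c%:C * (2^-1 * (Mc t p * Nc t p) * Ta (F t p)))
     ((a%:C + b%:C * 'i%C) * (2^-1 * Nc t p) * fb (F t p) + c%:C * (2^-1 * (Mc t p * Nc t p) * Tb (F t p))).
Proof.
move=> dp; rewrite -!mulr_vecA -!mulr_vecZ.
have lin u v w : 'd (F t) p (a *: u + b *: v + c *: w) =
  a *: 'd (F t) p u + b *: 'd (F t) p v + c *: 'd (F t) p w by rewrite !linearD !linearZ.
rewrite lin (dF_re t0 t1 dp) (dF_im t0 t1 dp) (dF_comm t0 t1 dp) !pt_lin !pt_add.
by congr pt; ring.
Qed.

Lemma Mc_Nc p : Mc t p * Nc t p =
  (Re (Mc t p) * Re (Mc t p) + Im (Mc t p) * Im (Mc t p))%:C.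
Proof.
have [_ _ <-] := conj_M t p; case: (Mc t p) => x y.
by apply: cplx_eq => /=; ring.
Qed.

(** A curve in the orbit lifts to SL_2(R) through a local section. Its velocity there is p xi, and
    xi is expanded in the frame [Lre], [Lim], [[Lre], [Lim]], whose images under the differential
    are multiples of f, i f and T. Conversely such vectors are images of tangent vectors of
    SL_2(R). *)
Lemma orb_tangent (q u : 'rV[R]_(2 + 2)) : orb t q -> ftangent (orb t) q u <->
  exists (k : R[i]) (r : R), u = pt (k * fa q + r%:C * Ta q) (k * fb q + r%:C * Tb q).
Proof.
move=> [p sp <-]; have dp := sl2W_det sp; split=> [tu|[k [r ->]]].
  have [i [ O [s [Op sO sec ip]]]] := orbit_local dp.
  have dif := sheet_fdiffeo sO sec i; have [[U AU sF] [[W BW sG] [FB GA]]] := dif.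
  pose G q := mulr_vec (gam i) (s q); have Gp : G (F t p) = p by have [] := FB p ip.
  have oq : orb t (F t p) by exists p.
  have Wq : W (F t p) by apply: BW.
  have tu' : ftangent (orb t `&` O) (F t p) u by apply: ftangent_open => //; exact: sO.1.
  have tv : ftangent (sl2W (sheet O s i)) (G (F t p)) ('d G (F t p) u).
    exact: (ftangent_map sG Wq (fun y h => (GA y h).1) tu').
  have UG : U (G (F t p)) by rewrite Gp; exact: AU.
  have e : 'd (F t) (G (F t p)) ('d G (F t p) u) = u.
    exact: (diff_inverse sG Wq sF UG (fun y h => (GA y h).2) tu').
  rewrite Gp in tv e.
  have pv := (sl2_tangent _ (@open_sheet O s sO i) ip).1 tv.
  have [a [b [c ev]]] := sl2_tangent_mul dp pv.
  have uE : u = 'd (F t) p (mulr_vec (mx22 a b c (- a)) p).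
    exact: etrans (esym e) (congr1 ('d (F t) p) ev).
  have xiE : mx22 a b c (- a) = ((c + b / t) / 2) *: Lre t + (a / ((1 + t) / 2)) *: Lim t +
    ((c - b / t) / (2 * (1 + t))) *: mx22 0 (- (t * (1 + t))) (1 + t) 0.
    by apply: mx2_ext; rewrite !mxE /=; field; rewrite ?t0 ?t1.
  rewrite uE xiE dF_comb //.
  set A := _ + _ * 'i%C; set C := _ / (2 * (1 + t)).
  exists (A * (2^-1 * Nc t p)).
  exists (C / 2 * (Re (Mc t p) * Re (Mc t p) + Im (Mc t p) * Im (Mc t p))).
  have h2 : (2%:R : R[i]) != 0 by rewrite pnatr_eq0.
  have h (x y : R) : (x / 2 * y)%:C = x%:C * (2^-1 * y%:C).
    apply: (mulIf h2); rewrite mulrAC [RHS]mulrAC -!mulrA mulVKf // -(rmorph_nat (real_complex R)) -!rmorphM.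
    by congr (_%:C); field.
  by rewrite h -Mc_Nc; congr pt; ring.
have n0 := Nc_neq0 t0 t1 dp; have m0 := Mc_neq0 t0 t1 dp.
set n := Re (Mc t p) * Re (Mc t p) + Im (Mc t p) * Im (Mc t p).
have nE : Mc t p * Nc t p = n%:C by exact: Mc_Nc.
have nn : n != 0 by exact: sqnorm_neq0.
(* The factors 2 / Nc here and 2 / |Mc|^2 below undo those of [dF_comb], so that the prescribed k
   and r come out. *)
pose z := 2%:R * k / Nc t p.
have := dF_comb (Re z) (Im z) (2 * r / n) dp.
have ReIm (w : R[i]) : (Re w)%:C + (Im w)%:C * 'i%C = w.
  by case: w => x y; apply: cplx_eq => /=; ring.
rewrite ReIm.
have -> : z * (2^-1 * Nc t p) = k by rewrite /z; field.
have E (x : R[i]) : (2 * r / n)%:C * (2^-1 * (Mc t p * Nc t p) * x) = r%:C * x.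
  have nC : n%:C != 0 :> R[i] by rewrite -nE mulf_neq0.
  have -> : (2 * r / n)%:C = 2%:R * r%:C / n%:C.
    by apply: (mulIf nC); rewrite divfK // -rmorphM divfK // rmorphM rmorph_nat.
  by rewrite nE; field.
rewrite !E => <-.
have Fp : Fdom t p by exact: (sl2W_Fdom t0 t1 sp).
apply: (ftangent_map (smooth_F t) Fp (A := sl2W setT)) => [x sx|]; first by exists x.
set m := _ + _ *: mx22 _ _ _ _.
have -> : m = mx22 (m 0 0) (m 0 1) (m 1 0) (- m 0 0).
  by apply: mx2_ext; rewrite ?mx22E // /m !mxE /=; ring.
by apply: mulr_vec_tangent sp; exact: openT.
Qed.

(** A chart of the quadric SL_2(R) inside one sheet, followed by the orbit map, is a chart of the
    orbit. *)
Lemma orb_submanifold : submanifold 3 (par (Psl2C R) proj_chart @` orb t).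
Proof.
apply: (submanifold_par good_Psl2C) => q [p sp <-]; have dp := sl2W_det sp.
have [i [ O [s [Op sO sec ip]]]] := orbit_local dp.
have dif := sheet_fdiffeo sO sec i.
have [W' [D [G [H [oW' W'p oD dGH]]]]] :=
  @level_chart R 3 detb detbC detbD detbZ _ p (@open_sheet O s sO i) ip.
have sGs := smooth_comp sO (smooth_mulr_vec (gam i)).
have [[_ _ _] [_ [FB _]]] := dif.
exists (O `&` s @^-1` setT `&` (fun q => mulr_vec (gam i) (s q)) @^-1` W'), D,
  (fun x => F t (G x)), (fun y => H (mulr_vec (gam i) (s y))); split=> //.
- by apply: smooth_open => //; exact: sGs.
- by split; [split | have [_ e] := FB p ip; rewrite /= e].
have := fdiffeo_comp dGH (fdiffeo_sym (fdiffeo_restrict W' (fdiffeo_sym dif))).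
congr (fdiffeo _ _ _ _); apply/seteqP; split=> y /=; first by move=> [[? ?] ?].
by move=> [? [[? _] ?]].
Qed.

Lemma orb_cr : cr_structure (orbit_P (L_ t)) (induced_cr (orbit_P (L_ t))).
Proof.
rewrite (orbit_P_par t0 t1); have [s1 s2] := @smC_f R _ openT.
apply: (cr_hypersurface good_Psl2C orb_tangent _ orb_submanifold s1 s2).
  by move=> q [p /sl2W_det dp <-]; exact: fT_indep.
move=> q _; exists (2%:R * 'i%C * Kc q), 2; split; first by rewrite pnatr_eq0.
exact: orbit_lie.
Qed.

Lemma orb_induced q : orb t q ->
  induced_cr (par (Psl2C R) proj_chart @` orb t) proj_chart q = cline (crvec (fa q) (fb q)).
Proof.
move=> oq; apply: (induced_crE good_Psl2C orb_tangent _ oq).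
by move=> q' [p /sl2W_det dp <-]; exact: fT_indep.
Qed.

Let f : M2R R -> Psl2C R := lift_chart (N1 := M2R R) (N2 := Psl2C R) (i := tt) (j := proj_chart) (F t).

Let fE p : f (par (M2R R) tt p) = par (Psl2C R) proj_chart (F t p).
Proof. exact: (lift_chartE good_M2R). Qed.

Lemma orb_push p : \det (vec_mx p) = 1 ->
  induced_cr (par (Psl2C R) proj_chart @` orb t) proj_chart (F t p) =
  [set diffC (F t) p w | w in V_ t tt p].
Proof.
move=> dp; have [i [ O [s [Op sO sec ip]]]] := orbit_local dp.
have dif := sheet_fdiffeo sO sec i.
have oi := @open_sheet O s sO i.
rewrite V_E; apply: (push_cline good_Psl2C dif ip _ _ _ _ _ (orb_induced _)).
- by move=> q [].
- rewrite Re_cvec; have := mulr_vec_tangent 0 t 1 oi ip.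
  by rewrite oppr0.
- rewrite Im_cvec; exact: (mulr_vec_tangent ((1 + t) / 2) 0 0 oi ip).
- exact: V_vec_neq0.
- rewrite /diffC Re_cvec Im_cvec (dF_re t0 t1 dp) (dF_im t0 t1 dp).
  exact: crvec_T01.
- by exists p => //; exact: sl2WT.
Qed.

Lemma orb_cover : cr_cover d (SL2 R) (V_ t) (orbit_P (L_ t)) (induced_cr (orbit_P (L_ t))).
Proof.
have oP := orbit_P_par t0 t1.
have tm1 : t != -1 by apply: contra t1 => /eqP ->; rewrite subrr.
split; [exact: SL2_cr | exact: orb_cr |].
exists f; rewrite oP; split; last first.
  rewrite SL2_par => x [p sp <-]; have dp := sl2W_det sp.
  have [i [ O [s [Op sO sec ip]]]] := orbit_local dp.
  have dif := sheet_fdiffeo sO sec i; have oi := @open_sheet O s sO i.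
  exists (par (M2R R) tt @` sheet O s i), (par (Psl2C R) proj_chart @` O); split.
  - exact: good_M2R.2.
  - by apply: good_Psl2C.2; exact: sO.1.
  - by exists p => //; case: ip.
  rewrite -SL2_par SL2_setI (par_setI good_Psl2C); split.
    exact: (diffeo_par good_M2R good_Psl2C dif (fun p _ => fE p)).
  apply: (pushes_forward_par good_M2R (U := Fdom t) (F := F t)).
  - exact: sl2W_Fdom.
  - exact: smooth_F.
  - by move=> q _; exact: fE.
  - by move=> q /sl2W_det; exact: orb_push.
split.
  rewrite SL2_par; apply: (continuous_map_par good_M2R (U := Fdom t) (F := F t)).
  - exact: sl2W_Fdom.
  - exact: smooth_F.
  - by move=> p sp; exists p.
  - by move=> q _; exact: fE.
move=> y [q [p sp <-] <-]; have dp := sl2W_det sp.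
have [i [ O [s [Op sO sec ip]]]] := orbit_local dp.
exists (par (Psl2C R) proj_chart @` O), (fun i => par (M2R R) tt @` sheet O s i); split.
- by split; [apply: good_Psl2C.2; exact: sO.1 | exists (F t p)].
- by move=> j; apply: good_M2R.2; exact: open_sheet.
- apply/seteqP; split=> x.
    rewrite SL2_par => -[[p' sp' <-]]; rewrite /= fE => /(par_img good_Psl2C) Op'.
    have [j jp] := sheet_cover sec (sl2W_det sp') Op'.
    by exists j => //; rewrite -SL2_par SL2_setI; exists p'.
  move=> [j _]; rewrite SL2_setI => -[p' sp' <-].
  have [dp' Op' _] := (sheetP sec j p').1 sp'.
  split; first by rewrite SL2_par; exists p' => //; exact: sl2WT.
  by rewrite /= fE; exists (F t p').
- move=> j j' _ _ [x []]; rewrite !SL2_setI => -[p1 h1 <-] [p2 h2 /good_M2R.1 e].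
  by rewrite e in h2; exact: sheet_disj h1 h2.
- move=> j; rewrite SL2_setI (par_setI good_Psl2C).
  exact: (homeo_par good_M2R good_Psl2C (sheet_fdiffeo sO sec j) (fun p _ => fE p)).
Qed.

End DeckGroup.

End OrbitCover.

(** * Fibres of the orbit map and the groups of order 2 and 4 *)

Section AdComp.
Context {K : comNzRingType}.

Lemma ad_mul (p q r s h1 h2 h3 h4 l b c : K) :
  let P := p * h1 + q * h3 in let Q := p * h2 + q * h4 in
  let U := r * h1 + s * h3 in let V := r * h2 + s * h4 in
  let l' := ada h1 h2 h3 h4 l b c in let b' := adb h1 h2 h3 h4 l b c in
  let c' := adc h1 h2 h3 h4 l b c in
  [/\ ada P Q U V l b c = ada p q r s l' b' c',
      adb P Q U V l b c = adb p q r s l' b' c' &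
      adc P Q U V l b c = adc p q r s l' b' c'].
Proof. by rewrite /= /ada /adb /adc; split; ring. Qed.

Lemma ad_inv (p q r s x y z : K) : p * s - q * r = 1 ->
  [/\ ada s (- q) (- r) p (ada p q r s x y z) (adb p q r s x y z) (adc p q r s x y z) = x,
      adb s (- q) (- r) p (ada p q r s x y z) (adb p q r s x y z) (adc p q r s x y z) = y &
      adc s (- q) (- r) p (ada p q r s x y z) (adb p q r s x y z) (adc p q r s x y z) = z].
Proof.
move=> d1; have dd a : a = (p * s - q * r) * (p * s - q * r) * a by rewrite d1 !mul1r.
by split; rewrite [RHS]dd /ada /adb /adc; ring.
Qed.

Lemma ad_lin (p q r s e x y z : K) :
  [/\ ada p q r s (e * x) (e * y) (e * z) = e * ada p q r s x y z,
      adb p q r s (e * x) (e * y) (e * z) = e * adb p q r s x y z &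
      adc p q r s (e * x) (e * y) (e * z) = e * adc p q r s x y z].
Proof. by rewrite /ada /adb /adc; split; ring. Qed.

End AdComp.

Section DeckGroups.
Context {R : realType} (t : R).
Hypotheses (t0 : t != 0) (t1 : 1 + t != 0) (t2 : 1 - t != 0).

Let k := (1 + t) / 2.
Let l : R[i] := 0 +i* k.

Lemma F_proportional c p q : c != 0 -> Ma t q = c * Ma t p -> Mb t q = c * Mb t p ->
  Mc t q = c * Mc t p -> F t q = F t p.
Proof.
by move=> c0 ea eb ec; rewrite /F /Fa /Fb ea eb ec invfM; congr pt;
  rewrite mulrACA divff // mul1r.
Qed.

(** Equal lines give proportional matrices, and the common nonzero value of the quadratic invariant
    makes the factor a square root of 1. *)
Lemma M_sign (p q : 'rV[R]_(2 * 2)) : \det (vec_mx p) = 1 -> \det (vec_mx q) = 1 -> F t p = F t q ->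
  exists2 e : R[i], e = 1 \/ e = -1 &
  [/\ Ma t q = e * Ma t p, Mb t q = e * Mb t p & Mc t q = e * Mc t p].
Proof.
move=> dp dq pq; have mp := Mc_neq0 t0 t1 dp; have mq := Mc_neq0 t0 t1 dq.
have tk : t%:C - (k * k)%:C != 0 :> R[i] by exact: disc_neq0.
have sq : Mc t q * Mc t q = Mc t p * Mc t p.
  have := Q_F t0 t1 dp; rewrite pq (Q_F t0 t1 dq) => /(mulfI tk) /invr_inj //.
have [/pt_inj [eA eB]] : pt (Fa t p) (Fb t p) = pt (Fa t q) (Fb t q) by exact: pq.
have EA : Ma t q = Mc t q / Mc t p * Ma t p.
  by rewrite -[Ma t q](divfK mq) -/(Fa t q) -eA /Fa; field.
have EB : Mb t q = Mc t q / Mc t p * Mb t p.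
  by rewrite -[Mb t q](divfK mq) -/(Fb t q) -eB /Fb; field.
exists (Mc t q / Mc t p); last by split=> //; rewrite divfK.
have /eqP : (Mc t q / Mc t p - 1) * (Mc t q / Mc t p + 1) = 0.
  transitivity (Mc t q * Mc t q / (Mc t p * Mc t p) - 1); first by field.
  by rewrite sq divff ?subrr // mulf_neq0.
by rewrite mulf_eq0 subr_eq0 addr_eq0 => /orP[] /eqP; [left | right].
Qed.

(** For h = p^-1 q conjugation sends L_t to e L_t with e = 1 or e = -1. Comparing entries of h = (a,
    b; c, d) gives a b = c d = 0 and a d + b c = e, while a d - b c = 1. So e = 1 makes h diagonal
    and e = -1 makes it antidiagonal with b^2 = t. *)
Lemma fiber (p q : 'rV[R]_(2 * 2)) : \det (vec_mx p) = 1 -> \det (vec_mx q) = 1 -> F t p = F t q ->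
  exists h1 h2 h3 h4 : R, q = mulr_vec (mx22 h1 h2 h3 h4) p /\
  ([/\ h2 = 0, h3 = 0, h4 = h1 & h1 * h1 = 1] \/
   [/\ h1 = 0, h4 = 0, h2 * h2 = t & h2 * h3 = -1]).
Proof.
move=> dp dq pq; have [e e1 [EA EB EC]] := M_sign dp dq pq.
pose g : 'M[R]_2 := vec_mx p; pose h := mx22 (g 1 1) (- g 0 1) (- g 1 0) (g 0 0) *m vec_mx q.
have qE : q = mulr_vec h p.
  by apply: (can_inj vec_mxK); rewrite /mulr_vec mxvecK -adj2_mul.
exists (h 0 0), (h 0 1), (h 1 0), (h 1 1).
have -> : mx22 (h 0 0) (h 0 1) (h 1 0) (h 1 1) = h by apply: mx2_ext; rewrite mx22E.
split=> //; have dh : \det h = 1 by have := dq; rewrite qE det_mulr_vec dp mul1r.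
rewrite det2E in dh.
have entE i j : ent i j q = ent i 0 p * (h 0 j)%:C + ent i 1 p * (h 1 j)%:C.
  by rewrite qE /ent /mulr_vec mxvecK mul2E rmorphD !rmorphM.
have d1 := det_ent dp.
have [A1 A2 A3] : [/\ ada (h 0 0)%:C (h 0 1)%:C (h 1 0)%:C (h 1 1)%:C l t%:C 1 = e * l,
  adb (h 0 0)%:C (h 0 1)%:C (h 1 0)%:C (h 1 1)%:C l t%:C 1 = e * t%:C &
  adc (h 0 0)%:C (h 0 1)%:C (h 1 0)%:C (h 1 1)%:C l t%:C 1 = e * 1].
  have [] := ad_mul (ent 0 0 p) (ent 0 1 p) (ent 1 0 p) (ent 1 1 p)
    (h 0 0)%:C (h 0 1)%:C (h 1 0)%:C (h 1 1)%:C l t%:C 1.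
  rewrite -!entE -/(Ma t q) -/(Mb t q) -/(Mc t q) EA EB EC => M1 M2 M3.
  have [] := ad_inv (ada (h 0 0)%:C (h 0 1)%:C (h 1 0)%:C (h 1 1)%:C l t%:C 1)
    (adb (h 0 0)%:C (h 0 1)%:C (h 1 0)%:C (h 1 1)%:C l t%:C 1)
    (adc (h 0 0)%:C (h 0 1)%:C (h 1 0)%:C (h 1 1)%:C l t%:C 1) d1.
  rewrite -M1 -M2 -M3; have [-> -> ->] := ad_lin (ent 1 1 p) (- ent 0 1 p) (- ent 1 0 p) (ent 0 0 p) e (Ma t p) (Mb t p) (Mc t p).
  have [-> -> ->] := ad_inv l t%:C 1 d1.
  by move=> -> -> ->.
move: A1 A2 A3 dh; move: (h 0 0) (h 0 1) (h 1 0) (h 1 1) => a b c d A1 A2 A3 dh.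
have eE : e = (Re e)%:C by case: e1 => ->; apply: cplx_eq => //=; rewrite oppr0.
have er : Re e = 1 \/ Re e = -1 by case: e1 => ->; [left | right].
move: A1 A2 A3; rewrite eE; move: (Re e) er => x er.
rewrite /ada /adb /adc /l => A1 A2 A3.
have := congr1 (@Im R) A1; have := congr1 (@Re R) A2; have := congr1 (@Im R) A2.
have := congr1 (@Re R) A3; have := congr1 (@Im R) A3.
have kn0 : k != 0 by rewrite mulf_neq0 // invr_neq0 // pnatr_eq0.
move=> /= i3 r3 i2 r2 i1.
have {i3} cd : c * d = 0 by apply: (mulIf kn0); lra.
have {i2} ab : a * b = 0 by apply: (mulIf kn0); lra.
have {i1} adbc : a * d + b * c = x by apply: (mulIf kn0); lra.
have {}r3 : d * d - t * (c * c) = x by lra.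
have {}r2 : a * a * t - b * b = x * t by lra.
case: er adbc r3 r2 => -> adbc r3 r2; [left | right].
  have ad1 : a * d = 1 by lra.
  have a0 : a != 0 by apply/eqP => a0; move: ad1; rewrite a0; lra.
  have d0 : d != 0 by apply/eqP => d0; move: ad1; rewrite d0; lra.
  have b0 : b = 0 by apply/eqP; move/eqP: ab; rewrite mulf_eq0 (negbTE a0).
  have c0 : c = 0 by apply/eqP; move/eqP: cd; rewrite mulf_eq0 (negbTE d0) orbF.
  have aa : a * a = 1 by apply: (mulIf t0); move: r2; rewrite b0; lra.
  by split=> //; apply: (mulfI a0); rewrite ad1 aa.
have bc1 : b * c = -1 by lra.
have b0 : b != 0 by apply/eqP => b0; move: bc1; rewrite b0; lra.
have c0 : c != 0 by apply/eqP => c0; move: bc1; rewrite c0; lra.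
have a0 : a = 0 by apply/eqP; move/eqP: ab; rewrite mulf_eq0 (negbTE b0) orbF.
have d0 : d = 0 by apply/eqP; move/eqP: cd; rewrite mulf_eq0 (negbTE c0).
by split=> //; move: r2; rewrite a0; lra.
Qed.

Lemma F_opp (M : 'M[R]_2) p : F t (mulr_vec (- M) p) = F t (mulr_vec M p).
Proof.
apply: (@F_proportional 1); rewrite ?oner_neq0 // mul1r;
  rewrite /Ma /Mb /Mc /ada /adb /adc /ent /mulr_vec !mxvecK mulmxN !(mxE, rmorphN) /=; ring.
Qed.

Lemma mulr_vec1 (p : 'rV[R]_(2 * 2)) : mulr_vec 1%:M p = p.
Proof. by rewrite /mulr_vec mulmx1 vec_mxK. Qed.

Definition gam2 (i : 'I_2) : 'M[R]_2 := if i == 0 then 1%:M else - 1%:M.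

Lemma gam2_det i : \det (gam2 i) = 1.
Proof. by rewrite /gam2; case: ifP => _; rewrite det2E !mxE /=; ring. Qed.

Lemma gam2_F i p : F t (mulr_vec (gam2 i) p) = F t p.
Proof. by rewrite /gam2; case: ifP => _; rewrite ?F_opp mulr_vec1. Qed.

Lemma gam2_sep i j : i != j -> detb (mxvec (gam2 i)) (mxvec (gam2 j)) <= 0.
Proof.
by rewrite /gam2; case: (ord2P i) => ->; case: (ord2P j) => -> //= _;
  rewrite /detb !mxvecK !mxE /=; lra.
Qed.

Lemma gam2_fib (p q : 'rV[R]_(2 * 2)) : t < 0 -> \det (vec_mx p) = 1 -> \det (vec_mx q) = 1 ->
  F t p = F t q -> exists i, q = mulr_vec (gam2 i) p.
Proof.
move=> tn dp dq pq; have [h1 [h2 [h3 [h4 [-> [[-> -> -> hh]|[_ _ hh _]]]]]]] := fiber dp dq pq.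
  have /eqP : (h1 - 1) * (h1 + 1) = 0 by transitivity (h1 * h1 - 1); [ring | rewrite hh subrr].
  rewrite mulf_eq0 subr_eq0 addr_eq0 => /orP[] /eqP ->; [exists 0 | exists 1];
    by congr mulr_vec; apply: mx2_ext; rewrite !mxE /= ?oppr0.
by have := sqr_ge0 h2; rewrite expr2 hh leNgt tn.
Qed.

(** Conjugation by this matrix sends L_t to - L_t. Its square is -1, so it generates a cyclic group
    of order 4. *)
Definition deck : 'M[R]_2 := mx22 0 (- Num.sqrt t) (Num.sqrt t)^-1 0.

Definition gam4 (i : 'I_4) : 'M[R]_2 :=
  match val i with 0 => 1%:M | 1 => - 1%:M | 2 => deck | _ => - deck end.

Lemma ord4P (i : 'I_4) : [\/ i = @Ordinal 4 0 isT, i = @Ordinal 4 1 isT,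
  i = @Ordinal 4 2 isT | i = @Ordinal 4 3 isT].
Proof.
by case: i => [[|[|[|[|//]]]] h]; [apply: Or41 | apply: Or42 | apply: Or43 | apply: Or44];
  apply: val_inj.
Qed.

Section Positive.
Hypothesis tp : 0 < t.

Let s0 : Num.sqrt t != 0.
Proof. by rewrite gt_eqF // sqrtr_gt0. Qed.

Let ss : Num.sqrt t * Num.sqrt t = t.
Proof. by rewrite -expr2 sqr_sqrtr // ltW. Qed.

Lemma F_deck p : F t (mulr_vec deck p) = F t p.
Proof.
have n1 : (-1 : R[i]) != 0 by rewrite oppr_eq0 oner_neq0.
have sC : (Num.sqrt t)%:C != 0 :> R[i] by rewrite eq_complex /= negb_and s0.
have E i : ent i 0 (mulr_vec deck p) = ent i 1 p / (Num.sqrt t)%:C /\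
  ent i 1 (mulr_vec deck p) = - (ent i 0 p * (Num.sqrt t)%:C).
  rewrite /ent /mulr_vec mxvecK !mul2E !mx22E !mulr0 add0r addr0 mulrN rmorphN !rmorphM.
  by rewrite fmorphV.
have [e00 e01] := E 0; have [e10 e11] := E 1.
have tC : t%:C = (Num.sqrt t)%:C * (Num.sqrt t)%:C by rewrite -rmorphM ss.
by apply: (F_proportional n1); rewrite /Ma /Mb /Mc e00 e01 e10 e11 /ada /adb /adc tC; field.
Qed.

Lemma gam4_det i : \det (gam4 i) = 1.
Proof.
by have [->|->|->|->] := ord4P i; rewrite /gam4 det2E !mxE /= ?mulr0 ?mul0r; field.
Qed.

Lemma gam4_F i p : F t (mulr_vec (gam4 i) p) = F t p.
Proof.
by have [->|->|->|->] := ord4P i; rewrite /gam4 /= ?F_opp ?F_deck ?mulr_vec1.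
Qed.

(** The pairing is -1 between opposite elements and 0 between a scalar and a multiple of [deck],
    which has trace 0. *)
Lemma gam4_sep i j : i != j -> detb (mxvec (gam4 i)) (mxvec (gam4 j)) <= 0.
Proof.
have si := divff s0; rewrite /gam4 /deck /detb.
by have [->|->|->|->] := ord4P i; have [->|->|->|->] := ord4P j; rewrite ?eqxx // => _;
  rewrite /= !mxvecK !mxE /=; move: (Num.sqrt t) (Num.sqrt t)^-1 si => u v si; lra.
Qed.

Lemma gam4_fib (p q : 'rV[R]_(2 * 2)) : \det (vec_mx p) = 1 -> \det (vec_mx q) = 1 ->
  F t p = F t q -> exists i, q = mulr_vec (gam4 i) p.
Proof.
move=> dp dq pq; have [h1 [h2 [h3 [h4 [-> [[-> -> -> hh]|[-> -> hh h23]]]]]]] := fiber dp dq pq.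
  have /eqP : (h1 - 1) * (h1 + 1) = 0 by transitivity (h1 * h1 - 1); [ring | rewrite hh subrr].
  rewrite mulf_eq0 subr_eq0 addr_eq0 => /orP[] /eqP ->;
    [exists (@Ordinal 4 0 isT) | exists (@Ordinal 4 1 isT)];
    by congr mulr_vec; apply: mx2_ext; rewrite !mxE /= ?oppr0.
have /eqP : (h2 + Num.sqrt t) * (h2 - Num.sqrt t) = 0.
  by transitivity (h2 * h2 - Num.sqrt t * Num.sqrt t); [ring | rewrite hh ss subrr].
rewrite mulf_eq0 subr_eq0 addr_eq0 => /orP[] /eqP h2E; rewrite h2E in h23 *;
    [exists (@Ordinal 4 2 isT) | exists (@Ordinal 4 3 isT)];
  congr mulr_vec; apply: mx2_ext; rewrite !mxE /= ?oppr0 ?opprK //;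
  by apply: (mulfI s0); rewrite ?mulrN divff //; lra.
Qed.

End Positive.

End DeckGroups.

(** * The spherical hyperbolic orbit and the sphere minus its real points *)

Section SphericalHyperbolic.
Context {R : realType} (t : R).
Hypotheses (tn : t < 0) (tm : -1 < t).

Let k := (1 + t) / 2.
Hypothesis tk : t + k * k = 0.

Let t0 : t != 0. Proof. by rewrite lt_eqF. Qed.
Let t1 : 1 + t != 0. Proof. by rewrite gt_eqF // -ltrBlDl sub0r. Qed.
Let t2 : 1 - t != 0. Proof. by rewrite gt_eqF // subr_gt0 (lt_trans tn). Qed.
Let k0 : k != 0. Proof. by rewrite /k mulf_neq0 // invr_neq0 // pnatr_eq0. Qed.

(** The two invariants determine the orbit globally because t < 0. Then X^2 = t makes det(e, X e) a
    definite quadratic form in e, with the sign of the lower left entry Re mu. Choosing the sign of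
    mu makes it positive, and [sec] yields a preimage. *)
Lemma orb_null (q : 'rV[R]_(2 + 2)) : orb t q <-> Hf q = 0 /\ Qf q != 0.
Proof.
have tkC : t%:C + (k * k)%:C = 0 :> R[i] by rewrite -rmorphD tk rmorph0.
have tq : t%:C - (k * k)%:C != 0 :> R[i].
  have kk : k * k = - t by apply/eqP; rewrite -addr_eq0 addrC tk.
  rewrite -rmorphB kk opprK.
  have : t + t != 0 by rewrite -mulr2n mulrn_eq0.
  by rewrite -(inj_eq (@complexI R)) rmorph0.
split=> [[p /sl2W_det dp <-]|[H0 Q0]].
  rewrite (H_F t0 t1 dp) tkC mul0r; split=> //.
  rewrite (Q_F t0 t1 dp) mulf_neq0 // invr_neq0 // mulf_neq0 //; exact: Mc_neq0.
(* Membership in the orbit is a pointwise question, so any square root serves; its sign is chosen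
   below. *)
pose nu := sqrtc ((t%:C - (k * k)%:C) / Qf q).
have nu2 : nu * nu = (t%:C - (k * k)%:C) / Qf q by rewrite -expr2 sqr_sqrtc.
have rel mu : mu * mu = nu * nu -> mu * mu * Qf q = t%:C - (k * k)%:C /\
    mu * conjc mu * Hf q = t%:C + (k * k)%:C.
  by move=> ->; rewrite nu2 divfK // H0 mulr0 tkC.
(* If Re mu = 0, the relation xa^2 + xb xc = t would make a square negative. *)
have Re0 mu : mu * mu = nu * nu -> Re mu != 0.
  move=> /rel [hQ hH]; have [r1 _ _] := sec_rel hQ hH; apply/eqP => e.
  have := sqr_ge0 (Re (mu * z1 q)); rewrite expr2.
  by move: r1; rewrite e mulr0 addr0 => ->; rewrite leNgt tn.
have [mu mu2 mup] : exists2 mu, mu * mu = nu * nu & 0 < Re mu.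
  have := Re0 nu erefl; rewrite neq_lt => /orP[] h; last by exists nu.
  exists (- nu); first by rewrite mulrNN.
  by move: h; case: (nu) => ? ? /=; rewrite oppr_gt0.
have [hQ hH] := rel mu mu2.
have mu0 : mu != 0 by apply/eqP => e; move: mup; rewrite e ltxx.
have [r1 r2 r3] := sec_rel hQ hH.
suff [m1 [m2 dpos]] : exists m1 m2, 0 < sec_det t mu m1 m2 q.
  have [ds Fs] := sec_correct mu0 hQ hH dpos.
  by exists (sec t mu m1 m2 q) => //; exact: sl2WT.
rewrite /sec_det /dv.
set xa := Re (mu * z1 q) in r1 r2 r3 *; set xb := Re (mu * z2 q) in r1 r2 r3 *.
set ya := Im (mu * z1 q) in r1 r2 r3 *; set yb := Im (mu * z2 q) in r1 r2 r3 *.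
set xc := Re mu in mup r1 r2 r3 *; set yc := Im mu in r1 r2 r3 *.
(* Completing the square: xc det(e, X e) = (xc e1 - xa e2)^2 - t e2^2, with xc > 0 and t < 0. *)
have pos (e1 e2 : R) : (e1 != 0) || (e2 != 0) ->
    0 < e1 * (xc * e1 - xa * e2) - (xa * e1 + xb * e2) * e2.
  move=> e0; rewrite -(pmulr_rgt0 _ mup).
  have -> : xc * (e1 * (xc * e1 - xa * e2) - (xa * e1 + xb * e2) * e2) =
    (xc * e1 - xa * e2) ^+ 2 - (xa * xa + xb * xc) * e2 ^+ 2 by ring.
  rewrite r1; have := sqr_ge0 (xc * e1 - xa * e2); have := sqr_ge0 e2.
  have [e20|e20] := eqVneq e2 0.
    rewrite e20 eqxx orbF in e0 *; rewrite mulr0 subr0 expr0n /= mulr0 subr0 => _ _.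
    by rewrite exprn_even_gt0 //= mulf_neq0 // gt_eqF.
  have p2 : 0 < e2 ^+ 2 by rewrite exprn_even_gt0.
  by move=> _ s; rewrite subr_gt0 (lt_le_trans _ s) // nmulr_rlt0.
(* One of the two basis vectors is a valid seed m, since Y + k has trace 2 k and so cannot kill
   both. *)
have [e0|] := boolP ((ev1 t ya yb 1 0 != 0) || (ev2 t ya yc 1 0 != 0)).
  by exists 1, 0; exact: pos.
rewrite negb_or !negbK => /andP[/eqP e1 /eqP e2]; exists 0, 1; apply: pos.
move: e1 e2; rewrite /ev1 /ev2 -/k !mulr1 !mulr0 addr0 => e1 e2.
apply/orP; right; rewrite add0r; apply/eqP => e3.
have : k + k = (ya + k) + (k - ya) by ring.
by rewrite e1 e3 addr0 -mulr2n => /eqP; rewrite mulrn_eq0 (negbTE k0).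
Qed.

(** The sum of squares turns the negation of a conjunction into one inequation, from which openness
    is immediate. *)
Definition nonreal : set 'rV[R]_(2 + 2) := [set q | setT q /\
  Im (z1 q) * Im (z1 q) + Im (z2 q) * Im (z2 q) != 0].

Lemma open_nonreal : open nonreal.
Proof.
have oT : open (setT : set 'rV[R]_(2 + 2)) by exact: openT.
by apply: open_neq0 => // d; apply: (CkD oT); apply: (CkM oT);
  first [exact: (smC_z1 oT d).2 | exact: (smC_z2 oT d).2].
Qed.

Lemma nonrealP q : nonreal q <-> ~ (Im (z1 q) = 0 /\ Im (z2 q) = 0).
Proof.
split=> [[_ h] [e1 e2]|h]; first by move: h; rewrite e1 e2 !mulr0 addr0 eqxx.
split=> //; apply/eqP => e; apply: h.
have [] := sqr_ge0 (Im (z1 q)); have [] := sqr_ge0 (Im (z2 q)).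
move=> h1 h2; have /eqP : Im (z1 q) ^+ 2 + Im (z2 q) ^+ 2 = 0 by rewrite !expr2.
by rewrite paddr_eq0 // !sqrf_eq0 => /andP[/eqP -> /eqP ->].
Qed.

Lemma S3_nonreal_par : S3 R `\` real_plane R = par (C2 R) tt @` hquad 1 1 0 nonreal.
Proof.
rewrite -S3_par; apply/seteqP; split=> z.
  move=> [Sz nz]; split=> //; exists (pt (z 0 0) (z 1 0)).
    apply/nonrealP; rewrite z1_pt z2_pt => -[e1 e2]; apply: nz => j.
    by case: (ord2P j) => ->.
  rewrite par_C2 z1_pt z2_pt; apply/colP => j; rewrite mxE.
  by case: (ord2P j) => ->.
move=> [Sz [p /nonrealP np ep]]; split=> // rz; apply: np.
have := rz 0; have := rz 1; rewrite -ep par_C2 !mxE /= => -> ->; by [].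
Qed.

(* At t + k^2 = 0 the orbit is {Hf = 0, Qf != 0}; this projective map sends
   Hf = 0 to S^3 and the conic Qf = 0 to z1^2 + z2^2 = 1, whose points on S^3
   are the real ones. *)
Let Pa (q : 'rV[R]_(2 + 2)) : R[i] := 2%:R * z1 q * (z2 q + - 1)^-1.
Let Pb (q : 'rV[R]_(2 + 2)) : R[i] := (z2 q + 1) * (z2 q + - 1)^-1.
Let Ra (q : 'rV[R]_(2 + 2)) : R[i] := z1 q * (z2 q + - 1)^-1.
Let Dom : set 'rV[R]_(2 + 2) := [set q | setT q /\ z2 q + - 1 != 0].

Let smooth_frac f : smC setT f -> smooth Dom (fun q => pt (f q * (z2 q + - 1)^-1) (Pb q)).
Proof.
move=> sf; pose A : set 'rV[R]_(2 + 2) := setT; have oT : open A by exact: openT.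
have s2 : smC A (@z2 R) by exact: smC_z2.
have sd : smC A (fun q => z2 q + - 1) by smc.
have oD : open Dom by exact: open_neq0C.
have sub (h : 'rV[R]_(2 + 2) -> R[i]) : smC A h -> smC Dom h by exact: smC_sub.
have {}s2 := sub _ s2; have {}sd := sub _ sd; have {}sf := sub _ sf.
have si : smC Dom (fun q => (z2 q + - 1)^-1) by apply: smC_V => // q [].
by split=> // d; apply: Ck_pt => //; rewrite /Pb; smc.
Qed.

Lemma Hf_real (q : 'rV[R]_(2 + 2)) : Hf q = (Re (z1 q) * Re (z1 q) +
  Im (z1 q) * Im (z1 q) + Re (z2 q))%:C.
Proof.
have h2 : (2%:R : R[i]) != 0 by rewrite pnatr_eq0.
apply: (mulIf h2); rewrite /Hf mulrDl divfK //.
by case: (z1 q) (z2 q) => ? ? [? ?]; apply: cplx_eq => /=; ring.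
Qed.

(** At z2 = 1 the hermitian invariant would be |z1|^2 + 1 > 0. *)
Lemma orb_dom (q : 'rV[R]_(2 + 2)) : orb t q -> z2 q + - 1 != 0.
Proof.
move=> /orb_null [H0 _]; apply/eqP => e.
have {}e : z2 q = 1 by apply/eqP; rewrite -subr_eq0 e.
move: H0; rewrite Hf_real e /= => /(congr1 (@Re R)) /=.
have := sqr_ge0 (Re (z1 q)); have := sqr_ge0 (Im (z1 q)); rewrite !expr2; lra.
Qed.

(** The second component z2 -> (z2 + 1) / (z2 - 1) is an involution, so the inverse map has the same
    second component and differs only by the factor 2 in the first. *)
Lemma null_sphere_fdiffeo : fdiffeo (orb t) (hquad 1 1 0 nonreal)
  (fun q => pt (Pa q) (Pb q)) (fun q => pt (Ra q) (Pb q)).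
Proof.
have s1 : smC (setT : set 'rV[R]_(2 + 2)) (@z1 R) by apply: smC_z1; exact: openT.
have n2 : (2%:R : R[i]) != 0 by rewrite pnatr_eq0.
have cN1 : conjc (- 1) = - 1 :> R[i] by rewrite rmorphN1.
have domO := orb_dom.
have domS q : hquad 1 1 0 nonreal q -> z2 q + - 1 != 0.
  move=> [hq /nonrealP nq]; apply/eqP => e; apply: nq.
  have {}e : z2 q = 1 by apply/eqP; rewrite -subr_eq0 e.
  have := hermS3 q; rewrite hq e => /(congr1 (@Re R)).
  case: (z1 q) => x y /= h; split=> //.
  have /eqP : x ^+ 2 + y ^+ 2 = 0 by rewrite !expr2; lra.
  by rewrite paddr_eq0 ?sqr_ge0 // !sqrf_eq0 => /andP[_ /eqP].
have cneq (u : R[i]) : u + - 1 != 0 -> conjc u + - 1 != 0.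
  by rewrite -conjc_eq0 conjcD cN1.
split.
  exists Dom; first by move=> q /domO.
  by apply: smooth_frac; apply: smC_M => //; [exact: openT | exact: smC_cst].
split.
  exists Dom; first by move=> q /domS.
  exact: smooth_frac.
split=> q hq.
  have d := domO q hq; have d' := cneq _ d; have [H0 Q0] := (orb_null q).1 hq.
  have bK : Pb q + - 1 = 2%:R / (z2 q + - 1) by rewrite /Pb; field.
  split; last first.
    rewrite -[RHS]pt_z /Ra /Pb !z1_pt !z2_pt -/(Pb q) bK /Pa.
    by congr pt; [field | rewrite /Pb; field]; rewrite d.
  have S : Pa q * conjc (Pa q) + Pb q * conjc (Pb q) = 1.
    rewrite /Pa /Pb !(conjcM, conjcD, conjc_inv, conjc1, cN1, conjc_nat).
    transitivity (1 + 4%:R * Hf q / ((z2 q + - 1) * (conjc (z2 q) + - 1))).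
      by rewrite /Hf; field; rewrite d d'.
    by rewrite H0 mulr0 mul0r addr0.
  split; first by apply: complexI; rewrite /= hermS3 z1_pt z2_pt S.
  apply/nonrealP; rewrite z1_pt z2_pt => -[i1 i2].
  have cr (u : R[i]) : Im u = 0 -> conjc u = u by case: u => x y /= ->; rewrite oppr0.
  (* At a real image point conjugation drops out, and the equation of the sphere becomes z1^2 + z2^2
     = 1, whose pullback is Qf = 0. *)
  move: S; rewrite (cr _ i1) (cr _ i2) => S.
  have : 4%:R * Qf q / ((z2 q + - 1) * (z2 q + - 1)) = 0.
    transitivity (Pa q * Pa q + Pb q * Pb q - 1); last by rewrite S subrr.
    by rewrite /Pa /Pb /Qf; field.
  by apply/eqP; rewrite !mulf_neq0 ?invr_neq0 ?mulf_neq0 // pnatr_eq0.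
have d := domS q hq; have d' := cneq _ d; have [hq1 /nonrealP nq] := hq.
have S : z1 q * conjc (z1 q) + z2 q * conjc (z2 q) = 1 by rewrite -hermS3 hq1.
have bK : Pb q + - 1 = 2%:R / (z2 q + - 1) by rewrite /Pb; field.
split; last first.
  rewrite -[RHS]pt_z /Pa /Pb !z1_pt !z2_pt -/(Pb q) bK /Ra.
  by congr pt; [field | rewrite /Pb; field]; rewrite d.
apply/orb_null; split.
  rewrite /Hf z1_pt z2_pt /Ra /Pb !(conjcM, conjcD, conjc_inv, conjc1, cN1, conjc_nat).
  transitivity ((z1 q * conjc (z1 q) + z2 q * conjc (z2 q) - 1) / ((z2 q + - 1) * (conjc (z2 q) + - 1))).
    by field; rewrite d d'.
  by rewrite S subrr mul0r.
have -> : Qf (pt (Ra q) (Pb q)) = (z1 q * z1 q + z2 q * z2 q - 1) / ((z2 q + - 1) * (z2 q + - 1)).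
  by rewrite /Qf z1_pt z2_pt /Ra /Pb; field.
rewrite mulf_neq0 ?invr_neq0 ?mulf_neq0 //; apply/eqP => e; apply: nq.
move: S e; case: (z1 q) (z2 q) => x1 y1 [x2 y2] S e.
have S' := congr1 (@Re R) S; have e' := congr1 (@Re R) e.
move: S' e' => /= S' e'.
have /eqP : y1 ^+ 2 + y2 ^+ 2 = 0 by rewrite !expr2; lra.
by rewrite paddr_eq0 ?sqr_ge0 // !sqrf_eq0 => /andP[/eqP -> /eqP ->].
Qed.

Lemma null_orbit_equiv : cr_equivalent (orbit_P (L_ t)) (induced_cr (orbit_P (L_ t)))
  (S3 R `\` real_plane R) (induced_cr (S3 R `\` real_plane R)).
Proof.
have fib p q := @gam2_fib R t t0 t1 t2 p q tn.
have gF (i : 'I_2) p : \det (vec_mx p) = 1 -> F t (mulr_vec (gam2 i) p) = F t p.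
  by move=> _; exact: gam2_F.
have crO := orb_cr t0 t1 t2 (@gam2_det R) gF fib (@gam2_sep R).
have indO := orb_induced t0 t1 t2 (@gam2_det R) gF fib (@gam2_sep R).
have tanO := orb_tangent t0 t1 t2 (@gam2_det R) gF fib (@gam2_sep R).
have dif := null_sphere_fdiffeo.
split=> //.
  by rewrite S3_nonreal_par; apply: hquad_cr; [exact: hn_S3 | exact: open_nonreal].
rewrite S3_nonreal_par (orbit_P_par t0 t1).
pose f := lift_chart (N1 := Psl2C R) (N2 := C2 R) (i := proj_chart) (j := tt) (fun q => pt (Pa q) (Pb q)).
have fE q : f (par (Psl2C R) proj_chart q) = par (C2 R) tt (pt (Pa q) (Pb q)).
  exact: (lift_chartE good_Psl2C).
exists f; split; first exact: (diffeo_par good_Psl2C good_C2 dif (fun q _ => fE q)).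
have [[U AU sF] [_ [FB _]]] := dif.
apply: (pushes_forward_par good_Psl2C AU sF) => [q _|q oq]; first exact: fE.
rewrite indO //; set w := crvec _ _.
have Tw : T01 R w by exact: crvec_T01.
have [a1 a2] := (T01P w).1 Tw.
have an1 : ann z1 q w by exists z1 => //; exact: isdC_z1.
have an2 : ann z2 q w by exists z2 => //; exact: isdC_z2.
apply: (push_cline good_C2 dif oq (@subset_refl _ _) _ _ _ _ (hquad_induced open_nonreal (FB q oq).1)).
- by rewrite Re_cvec; apply/tanO => //; exists 1, 0; rewrite !mul0r !addr0 !mul1r.
- by rewrite Im_cvec; apply/tanO => //; exists 'i%C, 0; rewrite !mul0r !addr0.
- apply/eqP => /crvec_eq0 [f0 g0]; have [p /sl2W_det dp pq] := oq.
  by have := fT_indep t0 t1 dp t2; rewrite pq f0 g0 !mul0r subrr eqxx.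
- have d := orb_dom oq.
  have ad0 : ann (fun q => z2 q + - 1) q w by annt.
  have ad : ann (fun q => (z2 q + - 1)^-1) q w by exact: (ann_V d ad0).
  by apply: T01_ann; [rewrite /Pa | rewrite /Pb]; annt.
Qed.

End SphericalHyperbolic.

Local Close Scope complex_scope.

Theorem proposition4p3 (R : realType) :
  (* V_t is a CR structure on SL_2(R) *)
  (forall t : R, t != 0 -> t != -1 -> cr_structure (SL2 R) (V_ t)) /\
  (* (a) *)
  (forall v : 'cV[R[i]]_2, submanifold 3 (orbit_C2 v) ->
    cr_equivalent (SL2 R) (V_ 1) (orbit_C2 v) (induced_cr (orbit_C2 v))) /\
  (forall K : set (C2 R), is_chain K ->
    cr_equivalent (SL2 R) (V_ 1) (S3 R `\` K) (induced_cr (S3 R `\` K))) /\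
  (* (b) *)
  (forall t : R, 0 < t < 1 ->
    cr_cover 4 (SL2 R) (V_ t) (orbit_P (L_ t)) (induced_cr (orbit_P (L_ t)))) /\
  (forall t : R, -1 < t < 0 ->
    cr_cover 2 (SL2 R) (V_ t) (orbit_P (L_ t)) (induced_cr (orbit_P (L_ t)))) /\
  (* (c) *)
  (let O := orbit_P (L_ (- 3 + 2 * Num.sqrt 2)) in
   cr_equivalent O (induced_cr O)
     (S3 R `\` real_plane R) (induced_cr (S3 R `\` real_plane R))).
Proof.
split; [exact: SL2_cr | split; [|split; [exact: chain_equiv | split; [|split]]]].
- by move=> v /submanifold3_orbit_C2; exact: orbit_C2_nondeg_cr.
- move=> t /andP[tp tl]; have t0 : t != 0 by rewrite gt_eqF.
  have t1 : 1 + t != 0 by rewrite gt_eqF // addr_gt0.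
  have t2 : 1 - t != 0 by rewrite gt_eqF // subr_gt0.
  apply: (orb_cover t0 t1 t2 (gam4_det tp) _ (gam4_fib t0 t1 t2 tp) (gam4_sep tp)).
  by move=> i p _; exact: gam4_F.
- move=> t /andP[tl tn]; have t0 : t != 0 by rewrite lt_eqF.
  have t1 : 1 + t != 0 by rewrite gt_eqF // -ltrBlDl sub0r.
  have t2 : 1 - t != 0 by rewrite gt_eqF // subr_gt0 (lt_trans tn).
  apply: (orb_cover t0 t1 t2 (@gam2_det R) _ (fun p q => @gam2_fib R t t0 t1 t2 p q tn) (@gam2_sep R)).
  by move=> i p _; exact: gam2_F.
- have s2 : Num.sqrt 2 * Num.sqrt 2 = 2 :> R by rewrite -expr2 sqr_sqrtr.
  have sp : 0 <= Num.sqrt 2 :> R by exact: sqrtr_ge0.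
  apply: null_orbit_equiv; [nra | nra | ].
  set u := Num.sqrt 2 in s2 *.
  (* For t = -3 + 2 u one has (1 + t) / 2 = u - 1, and t + (u - 1)^2 = u^2 - 2. *)
  transitivity ((u * u - 2) : R); last by rewrite s2 subrr.
  by field.
Qed.
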